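(* Let $(R,\mathfrak m,K)$ be a formally equidimensional local ring and let $\mathcal M=\{M_n\}_n$ be a sequence of finitely generated $R$-modules for which $\operatorname{rank}$ is defined and nonzero. Then for every ideal $I$ of $R$, $I^{*\mathcal M,\operatorname{rank}}\subseteq\overline I$, the integral closure of $I$. That is, integrally closed ideals of $R$ are $\mathcal M$-closed with respect to rank. Hence, radical ideals are $\mathcal M$-closed with respect to rank, and so prime ideals are $\mathcal M$-closed with respect to rank.
   Context: A local ring is Noetherian; it is formally equidimensional if its $\mathfrak m$-adic completion $\widehat R$ satisfies $\dim(\widehat R/\mathfrak p)=\dim\widehat R$ for every minimal prime $\mathfrak p$ of $\widehat R$. $\ell$ is length. A finitely generated $R$-module $M$ has rank $r$ if $\ell_{R_{\mathfrak p}}(M_{\mathfrak p})=r\,\ell_{R_{\mathfrak p}}(R_{\mathfrak p})$ for every minimal prime $\mathfrak p$ of $R$ with $\dim(R/\mathfrak p)=\dim R$. Closure: for finitely generated $R$-modules $A\subseteq B$ with $B/A$ of finite length, $A^{*\mathcal M,\operatorname{rank}}_B$ is the largest submodule $A'$ with $A\subseteq A'\subseteq B$ such that $\ell\big(\operatorname{Im}(M_n\otimes_R(A'/A)\to M_n\otimes_R(B/A))\big)=\mathrm o(\operatorname{rank}(M_n))$ as $n\to\infty$. In general $A^{*\mathcal M,\operatorname{rank}}_B=\bigcap_t(A+\mathfrak m^tB)^{*\mathcal M,\operatorname{rank}}_B$. For an ideal $I$, $I^{*\mathcal M,\operatorname{rank}}$ means $I^{*\mathcal M,\operatorname{rank}}_R$;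 $I$ is $\mathcal M$-closed with respect to rank if $I^{*\mathcal M,\operatorname{rank}}=I$. *)

(* Defs.v *)
From HB Require Import structures.
From mathcomp Require Import all_boot all_algebra.
From mathcomp Require Import boolp ring_quotient freeg ring.

Set Implicit Arguments.
Unset Strict Implicit.
Unset Printing Implicit Defensive.

Import GRing.Theory.
Local Open Scope ring_scope.
Local Open Scope quotient_scope.

(* Supremum of a nonempty set of natural numbers; None stands for infinity. *)
Definition nat_sup (S : nat -> Prop) : option nat :=
  if pselect (exists n, S n /\ forall k, S k -> (k <= n)%N) is left e
  then Some (projT1 (cid e)) else None.

(* With boolp's classical `[< _ >], {pred V} covers all subsets of V. *)
Record submodule (R : pzRingType) (V : lmodType R) := Submodule {
  submodule_pred :> {pred V};
  submoduleP : submod_closed submodule_pred }.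

HB.instance Definition _ (R : pzRingType) (V : lmodType R) (N : submodule V) :=
  GRing.isSubmodClosed.Build R V (submodule_pred N)
    (GRing.submod_closed_semi (submoduleP N)).

Definition ideal (R : pzRingType) := submodule (R^o : lmodType R).

Section Submodules.
Variables (R : pzRingType) (V : lmodType R).
Implicit Types (X : V -> Prop) (A B N : submodule V).

Definition span_pred X : {pred V} := fun x => `[< exists s : seq (R * V),
  (forall c, c \in s -> X c.2) /\ x = \sum_(c <- s) c.1 *: c.2 >].

Lemma span_closed X : submod_closed (span_pred X).
Proof.
split=> [|a _ _ /asboolP[s [sX ->]] /asboolP[t [tX ->]]]; apply/asboolP.
  by exists [::]; rewrite big_nil.
exists ([seq (a * c.1, c.2) | c <- s] ++ t); split=> [c|].
  by rewrite mem_cat => /orP[/mapP[d /sX ? ->]|/tX].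
rewrite big_cat big_map scaler_sumr; congr (_ + _).
by apply: eq_bigr => c _; rewrite scalerA.
Qed.

Definition submodule_span X : submodule V := Submodule (span_closed X).

Lemma full_closed : submod_closed (predT : {pred V}). Proof. by []. Qed.

Definition submodule_full : submodule V := Submodule full_closed.

Definition finitely_generated N : Prop :=
  exists s : seq V, N =i submodule_span (fun x => x \in s).

Definition sum_pred A B : {pred V} :=
  fun x => `[< exists a b, [/\ a \in A, b \in B & x = a + b] >].

Lemma sum_closed A B : submod_closed (sum_pred A B).
Proof.
split=> [|k _ _ /asboolP[a [b [aA bB ->]]] /asboolP[c [d [cA dB ->]]]].
  by apply/asboolP; exists 0, 0; rewrite !rpred0 addr0.
apply/asboolP; exists (k *: a + c), (k *: b + d).
by rewrite !(rpredD, rpredZ) // scalerDr addrACA.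
Qed.

Definition submodule_sum A B : submodule V := Submodule (sum_closed A B).

Definition ideal_mul (J : {pred R}) N : submodule V :=
  submodule_span (fun x => exists a v, [/\ a \in J, v \in N & x = a *: v]).

(* strict chains C_0 < ... < C_n of submodules of N *)
Definition has_chain N (n : nat) : Prop :=
  exists C : nat -> submodule V,
    (forall i, (i < n)%N ->
       {subset C i <= C i.+1} /\ ~ {subset C i.+1 <= C i}) /\
    {subset C n <= N}.

Definition module_length N : option nat := nat_sup (has_chain N).

End Submodules.

Fixpoint ideal_exp (R : pzRingType) (J : {pred R}) (n : nat) : ideal R :=
  if n is n'.+1 then ideal_mul J (ideal_exp J n') else submodule_full R^o.

Definition sub_module (R : pzRingType) (V : lmodType R) (N : submodule V) :=
  {x : V | x \in N}.

HB.instance Definition _ (R : pzRingType) (V : lmodType R) (N : submodule V) :=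
  SubChoice.on (sub_module N).
HB.instance Definition _ (R : pzRingType) (V : lmodType R) (N : submodule V) :=
  [SubChoice_isSubLmodule of sub_module N by <:].

Definition quot_module (R : pzRingType) (V : lmodType R) (N : submodule V) :=
  Quotient.quot N.

Section QuotModule.
Variables (R : pzRingType) (V : lmodType R) (N : submodule V).

HB.instance Definition _ := ZmodQuotient.on (quot_module N).

Definition quot_scale (a : R) : quot_module N -> quot_module N :=
  lift_op1 (quot_module N) ( *:%R a).

Lemma quot_pi_scale a x : quot_scale a (\pi_(quot_module N) x) = \pi_(quot_module N) (a *: x).
Proof.
rewrite /quot_scale; unlock; apply/eqP; rewrite piE Quotient.equivE -scalerBr.
by apply: rpredZ; rewrite Quotient.idealrBE reprK.
Qed.

Lemma quot_scaleA a b v : quot_scale a (quot_scale b v) = quot_scale (a * b) v.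
Proof. by elim/quotW: v => v; rewrite !quot_pi_scale scalerA. Qed.

Lemma quot_scale1 : left_id 1 quot_scale.
Proof. by elim/quotW => v; rewrite !quot_pi_scale scale1r. Qed.

Lemma quot_scaleDr : right_distributive quot_scale +%R.
Proof.
move=> a; elim/quotW => u; elim/quotW => v.
by rewrite -raddfD !quot_pi_scale -raddfD scalerDr.
Qed.

Lemma quot_scaleDl v : {morph quot_scale^~ v : a b / a + b}.
Proof.
by elim/quotW: v => v a b; rewrite !quot_pi_scale -raddfD scalerDl.
Qed.

HB.instance Definition _ := GRing.Zmodule_isLmodule.Build R (quot_module N)
  quot_scaleA quot_scale1 quot_scaleDr quot_scaleDl.

Lemma quot_piZ a x :
  \pi_(quot_module N) (a *: x) = a *: \pi_(quot_module N) x.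
Proof. by rewrite [RHS]quot_pi_scale. Qed.

End QuotModule.

(* prime_idealr R is the type of (classically, all) prime ideals of R. *)
Definition has_prime_chain (R : comNzRingType) (n : nat) : Prop :=
  exists P : nat -> prime_idealr R, forall i, (i < n)%N ->
    {subset P i <= P i.+1} /\ ~ {subset P i.+1 <= P i}.

Definition krull_dim (R : comNzRingType) : option nat :=
  nat_sup (has_prime_chain R).

Definition minimal_prime (R : comNzRingType) (P : prime_idealr R) : Prop :=
  forall Q : prime_idealr R, {subset Q <= P} -> {subset P <= Q}.

Definition loc_den (R : comNzRingType) (P : prime_idealr R) := {s : R | s \notin P}.

Section Localization.
Variables (R : comNzRingType) (P : prime_idealr R).
Local Notation den := (loc_den P).
Implicit Types s t u : den.

Lemma den1_subproof : 1 \notin P. Proof. by rewrite idealr1. Qed.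
Definition den1 : den := exist _ 1 den1_subproof.

Lemma denM_subproof s t : val s * val t \notin P.
Proof. by rewrite prime_idealrM negb_or (valP s) (valP t). Qed.
Definition denM s t : den := exist _ (val s * val t) (denM_subproof s t).

Section Module.
Variable M : lmodType R.

(* m / s = n / t iff u (t m - s n) = 0 for some u outside P *)
Definition loc_equiv (x y : M * den) : bool :=
  `[< exists u, val u *: (val y.2 *: x.1 - val x.2 *: y.1) = 0 >].

Lemma loc_equiv_is_equiv : equiv_class_of loc_equiv.
Proof.
split=> [x | x y | y x z].
- by apply/asboolP; exists den1; rewrite subrr scaler0.
- by apply/asboolP/asboolP=> -[u uxy]; exists u; rewrite -opprB scalerN uxy oppr0.
- move=> /asboolP[u uxy] /asboolP[v vyz]; apply/asboolP.
  exists (denM (denM u v) y.2).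
  have -> : val (denM (denM u v) y.2) *: (val z.2 *: x.1 - val x.2 *: z.1) =
      (val v * val z.2) *: (val u *: (val y.2 *: x.1 - val x.2 *: y.1)) +
      (val u * val x.2) *: (val v *: (val z.2 *: y.1 - val y.2 *: z.1)).
    rewrite /= !(scalerBr, scalerA).
    rewrite [in RHS](_ : val v * val z.2 * val u * val x.2 =
                         val u * val x.2 * val v * val z.2); last by ring.
    by rewrite addrA subrK; congr (_ *: _ - _ *: _); ring.
  by rewrite uxy vyz !scaler0 addr0.
Qed.

Canonical loc_equiv_equiv := EquivRelPack loc_equiv_is_equiv.
Canonical loc_equiv_encModRel := defaultEncModRel loc_equiv.

Definition loc_module := {eq_quot loc_equiv}.

HB.instance Definition _ : EqQuotient _ loc_equiv loc_module :=
  EqQuotient.on loc_module.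
HB.instance Definition _ := Choice.on loc_module.

Lemma loc_eqP (x y : M * den) :
  reflect (exists u, val u *: (val y.2 *: x.1 - val x.2 *: y.1) = 0)
    (\pi_loc_module x == \pi_loc_module y).
Proof. by rewrite piE; apply: asboolP. Qed.

Definition loc_pair_add (x y : M * den) : M * den :=
  (val y.2 *: x.1 + val x.2 *: y.1, denM x.2 y.2).
Definition loc_pair_opp (x : M * den) : M * den := (- x.1, x.2).

Definition loc_zero : loc_module := \pi_loc_module (0, den1).
Definition loc_add := lift_op2 loc_module loc_pair_add.
Definition loc_opp := lift_op1 loc_module loc_pair_opp.

Lemma loc_pi_add x y : loc_add (\pi x) (\pi y) = \pi_loc_module (loc_pair_add x y).
Proof.
rewrite /loc_add; unlock; apply/eqP/loc_eqP.
have /eqP/loc_eqP[u ux] := reprK (\pi_loc_module x).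
have /eqP/loc_eqP[v vy] := reprK (\pi_loc_module y).
move: (repr _) ux (repr _) vy => x' ux y' vy.
exists (denM u v) => /=.
have -> : (val u * val v) *: ((val x.2 * val y.2) *:
      (val y'.2 *: x'.1 + val x'.2 *: y'.1) -
      (val x'.2 * val y'.2) *: (val y.2 *: x.1 + val x.2 *: y.1)) =
   (val v * val y.2 * val y'.2) *: (val u *: (val x.2 *: x'.1 - val x'.2 *: x.1))
   + (val u * val x.2 * val x'.2) *:
       (val v *: (val y.2 *: y'.1 - val y'.2 *: y.1)).
  rewrite !(scalerBr, scalerDr, scalerA) opprD addrACA.
  by congr (_ *: _ - _ *: _ + (_ *: _ - _ *: _)); ring.
by rewrite ux vy !scaler0 addr0.
Qed.

Lemma loc_pi_opp x : loc_opp (\pi x) = \pi_loc_module (loc_pair_opp x).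
Proof.
rewrite /loc_opp; unlock; apply/eqP/loc_eqP.
have /eqP/loc_eqP[u ux] := reprK (\pi_loc_module x).
move: (repr _) ux => x' ux; exists u => /=.
by rewrite !scalerN -opprD scalerN ux oppr0.
Qed.

Lemma loc_addA : associative loc_add.
Proof.
elim/quotW=> x; elim/quotW=> y; elim/quotW=> z; rewrite !loc_pi_add.
congr \pi; rewrite /loc_pair_add; congr pair; last by apply: val_inj => /=; ring.
rewrite /= !(scalerDr, scalerA) !addrA.
by congr (_ *: _ + _ *: _ + _ *: _); ring.
Qed.

Lemma loc_addC : commutative loc_add.
Proof.
elim/quotW=> x; elim/quotW=> y; rewrite !loc_pi_add.
by congr \pi; rewrite /loc_pair_add addrC; congr pair; apply: val_inj; apply: mulrC.
Qed.

Lemma loc_add0 : left_id loc_zero loc_add.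
Proof.
elim/quotW=> x; rewrite loc_pi_add; congr \pi; case: x => m s.
by rewrite /loc_pair_add /= scaler0 add0r scale1r; congr pair; apply: val_inj;
  apply: mul1r.
Qed.

Lemma loc_addN : left_inverse loc_zero loc_opp loc_add.
Proof.
elim/quotW=> x; rewrite loc_pi_opp loc_pi_add; apply/eqP/loc_eqP; exists den1.
by rewrite /= scalerN addNr !scaler0 subrr scaler0.
Qed.

HB.instance Definition _ :=
  GRing.isZmodule.Build loc_module loc_addA loc_addC loc_add0 loc_addN.

Lemma loc_pi_addr x y :
  \pi_loc_module x + \pi_loc_module y = \pi_loc_module (loc_pair_add x y).
Proof. exact: loc_pi_add. Qed.

End Module.

Definition loc_pair_scale (M : lmodType R) (a : R^o * den) (x : M * den) :
  M * den := (a.1 *: x.1, denM a.2 x.2).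

Definition loc_scale (M : lmodType R) (a : loc_module R^o) (x : loc_module M) :
  loc_module M := \pi_(loc_module M) (loc_pair_scale (repr a) (repr x)).

Lemma loc_pi_scale (M : lmodType R) a x :
  loc_scale (\pi a) (\pi x) = \pi_(loc_module M) (loc_pair_scale a x).
Proof.
rewrite /loc_scale; apply/eqP/loc_eqP.
have /eqP/loc_eqP[u ua] := reprK (\pi_(loc_module R^o) a).
have /eqP/loc_eqP[v vx] := reprK (\pi_(loc_module M) x).
move: (repr _) ua (repr _) vx => a' ua x' vx.
have {}ua : val u * (val a.2 * a'.1 - val a'.2 * a.1) = 0 := ua.
exists (denM u v) => /=.
have -> : (val u * val v) *: ((val a.2 * val x.2) *: (a'.1 *: x'.1) -
      (val a'.2 * val x'.2) *: (a.1 *: x.1)) =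
  (val u * (val a.2 * a'.1 - val a'.2 * a.1) * (val v * val x.2)) *: x'.1
  + (val u * val a'.2 * a.1) *: (val v *: (val x.2 *: x'.1 - val x'.2 *: x.1)).
  rewrite !(scalerBr, scalerA) addrA -scalerDl.
  by congr (_ *: _ - _ *: _); ring.
by rewrite ua vx mul0r scale0r scaler0 addr0.
Qed.

Section Module.
Variable M : lmodType R.
Implicit Types (a b : loc_module R^o) (x y : loc_module M).

Lemma loc_pair_eq (p q : M * den) :
  p.1 = q.1 -> val p.2 = val q.2 -> \pi_(loc_module M) p = \pi_(loc_module M) q.
Proof. by case: p q => [m s] [n t] /= -> /val_inj ->. Qed.

Lemma loc_scaleA a b x :
  loc_scale a (loc_scale b x) = loc_scale (loc_scale a b) x.
Proof.
elim/quotW: a => a; elim/quotW: b => b; elim/quotW: x => x.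
by rewrite !loc_pi_scale; apply: loc_pair_eq; rewrite /= ?scalerA ?mulrA.
Qed.

Definition loc_one : loc_module R^o := \pi_(loc_module R^o) (1, den1).

Lemma loc_scale1 : left_id loc_one (@loc_scale M).
Proof.
elim/quotW=> x; rewrite loc_pi_scale.
by apply: loc_pair_eq; rewrite /= ?scale1r ?mul1r.
Qed.

Lemma loc_scaleDr : right_distributive (@loc_scale M) +%R.
Proof.
elim/quotW=> a; elim/quotW=> x; elim/quotW=> y.
rewrite !(loc_pi_addr, loc_pi_scale); apply/eqP/loc_eqP.
exists den1; rewrite /= scale1r !(scalerDr, scalerA) opprD addrACA -!scalerBl.
by rewrite [X in X *: _](_ : _ = 0) ?[X in _ + X *: _](_ : _ = 0) ?scale0r ?addr0 //;
  ring.
Qed.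

Lemma loc_scaleDl x : {morph (@loc_scale M)^~ x : a b / a + b}.
Proof.
elim/quotW: x => x; elim/quotW=> a; elim/quotW=> b.
rewrite !(loc_pi_addr, loc_pi_scale); apply/eqP/loc_eqP.
exists den1; rewrite /= scale1r !(scalerDr, scalerA) -scalerDl -scalerBl.
by rewrite [X in X *: _](_ : _ = 0) ?scale0r //=; rewrite /GRing.scale /=; ring.
Qed.

End Module.

Definition loc_ring := loc_module R^o.

HB.instance Definition _ := GRing.Zmodule.on loc_ring.

Lemma loc_mulC : commutative (@loc_scale R^o).
Proof.
elim/quotW=> a; elim/quotW=> b; rewrite !loc_pi_scale.
by apply: loc_pair_eq; apply: mulrC.
Qed.

HB.instance Definition _ := GRing.Zmodule_isComPzRing.Build loc_ring
  (@loc_scaleA R^o) loc_mulC (@loc_scale1 R^o)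
  (fun a b c => @loc_scaleDl R^o c a b).

HB.instance Definition _ (M : lmodType R) :=
  GRing.Zmodule_isLmodule.Build loc_ring (loc_module M)
    (@loc_scaleA M) (@loc_scale1 M) (@loc_scaleDr M) (@loc_scaleDl M).

End Localization.

Section Maps.
Variables (R : pzRingType) (V W : lmodType R).

Lemma lin_image_closed (f : {linear V -> W}) :
  submod_closed (fun y => `[< exists x, f x = y >] : bool).
Proof.
split=> [|a _ _ /asboolP[x <-] /asboolP[y <-]]; apply/asboolP.
  by exists 0; rewrite raddf0.
by exists (a *: x + y); rewrite linearP.
Qed.

Definition lin_image (f : {linear V -> W}) : submodule W := Submodule (lin_image_closed f).

Variables (N : submodule V) (g : {linear V -> W}).
Hypothesis gN0 : forall x, x \in N -> g x = 0.

Definition quot_lift of (forall x, x \in N -> g x = 0) :=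
  fun q : quot_module N => g (repr q).

Lemma quot_lift_pi x : quot_lift gN0 (\pi_(quot_module N) x) = g x.
Proof.
apply/eqP; rewrite -subr_eq0 -raddfB; apply/eqP/gN0.
by rewrite Quotient.idealrBE reprK.
Qed.

Lemma quot_lift_linear : linear (quot_lift gN0).
Proof.
move=> a; elim/quotW=> x; elim/quotW=> y.
by rewrite -quot_piZ -raddfD !quot_lift_pi linearP.
Qed.

HB.instance Definition _ :=
  GRing.isLinear.Build R (quot_module N) W _ (quot_lift gN0) quot_lift_linear.

End Maps.

Section SubQuotient.
Variables (R : pzRingType) (V : lmodType R) (A A' : submodule V).

Lemma restrict_closed :
  submod_closed (fun x : sub_module A' => val x \in A).
Proof.
split=> [|a x y xA yA]; rewrite unfold_in ?raddf0 ?rpred0 //.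
by rewrite linearP rpredD ?rpredZ.
Qed.

Definition sub_restrict : submodule (sub_module A') := Submodule restrict_closed.

Definition pi_val (x : sub_module A') : quot_module A :=
  \pi_(quot_module A) (val x).

Lemma pi_val_linear : linear pi_val.
Proof.
by move=> a x y; rewrite /pi_val linearP raddfD /= quot_piZ.
Qed.

HB.instance Definition _ := GRing.isLinear.Build R (sub_module A')
  (quot_module A) _ pi_val pi_val_linear.

Lemma pi_val_sub_restrict x : x \in sub_restrict -> pi_val x = 0.
Proof.
move=> xA; rewrite /pi_val -[0](raddf0 (\pi_(quot_module A))); apply/eqP.
by rewrite -Quotient.idealrBE subr0.
Qed.

Definition sub_quot := quot_module sub_restrict.

Definition sub_quot_incl : {linear sub_quot -> quot_module A} :=
  quot_lift pi_val_sub_restrict.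

End SubQuotient.

Section FreeModule.
Variables (R : comNzRingType) (K : choiceType) (V : lmodType R) (f : K -> V).

Definition freeg_lift (D : {freeg K / R}) : V := fglift f D.

Lemma freeg_lift_additive : zmod_morphism freeg_lift.
Proof. exact: lift_is_additive. Qed.

HB.instance Definition _ :=
  GRing.isZmodMorphism.Build {freeg K / R} V freeg_lift freeg_lift_additive.

Lemma freeg_lift_scalable : scalable freeg_lift.
Proof.
move=> c D; rewrite -{2}[D]freeg_sumE [c *: D]/(fgscale c D) /fgscale !raddf_sum.
by apply: eq_bigr => x _; rewrite /= /freeg_lift !liftU scalerA.
Qed.

HB.instance Definition _ := GRing.isScalable.Build R {freeg K / R} V _
  freeg_lift freeg_lift_scalable.

End FreeModule.

Section Tensor.
Variable R : comNzRingType.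

Variant tensor_rel (M N : lmodType R) : {freeg (M * N) / R} -> Prop :=
| TensorDl m m' n : tensor_rel (<< (m + m', n) >> - << (m, n) >> - << (m', n) >>)
| TensorDr m n n' : tensor_rel (<< (m, n + n') >> - << (m, n) >> - << (m, n') >>)
| TensorZl a m n : tensor_rel (<< (a *: m, n) >> - a *: << (m, n) >>)
| TensorZr a m n : tensor_rel (<< (m, a *: n) >> - a *: << (m, n) >>).

Definition tensor (M N : lmodType R) := quot_module (submodule_span (@tensor_rel M N)).

Definition pure_tensor (M N : lmodType R) (m : M) (n : N) : tensor M N :=
  \pi_(quot_module (submodule_span (@tensor_rel M N))) << (m, n) >>.

Section Theory.
Variables M N : lmodType R.
Implicit Types (m : M) (n : N).

Lemma tensor_rel0 (D : {freeg (M * N) / R}) : tensor_rel D ->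
  \pi_(quot_module (submodule_span (@tensor_rel M N))) D = 0.
Proof.
move=> relD; rewrite -[0](raddf0 (\pi_(quot_module (submodule_span (@tensor_rel M N))))).
apply/eqP; rewrite -Quotient.idealrBE subr0; apply/asboolP.
exists [:: (1, D)]; rewrite big_seq1 scale1r; split=> // c.
by rewrite mem_seq1 => /eqP ->.
Qed.

Lemma pure_tensorDl m m' n :
  pure_tensor (m + m') n = pure_tensor m n + pure_tensor m' n.
Proof.
have /= := tensor_rel0 (TensorDl m m' n); rewrite !raddfB /= => /eqP.
by rewrite -addrA -opprD subr_eq0 => /eqP.
Qed.

Lemma pure_tensorDr m n n' :
  pure_tensor m (n + n') = pure_tensor m n + pure_tensor m n'.
Proof.
have /= := tensor_rel0 (TensorDr m n n'); rewrite !raddfB /= => /eqP.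
by rewrite -addrA -opprD subr_eq0 => /eqP.
Qed.

Lemma pure_tensorZl a m n : pure_tensor (a *: m) n = a *: pure_tensor m n.
Proof.
have /= := tensor_rel0 (TensorZl a m n); rewrite raddfB /= quot_piZ => /eqP.
by rewrite subr_eq0 => /eqP.
Qed.

Lemma pure_tensorZr a m n : pure_tensor m (a *: n) = a *: pure_tensor m n.
Proof.
have /= := tensor_rel0 (TensorZr a m n); rewrite raddfB /= quot_piZ => /eqP.
by rewrite subr_eq0 => /eqP.
Qed.

End Theory.

Variables (M N M' N' : lmodType R) (f : {linear M -> M'}) (g : {linear N -> N'}).

Definition tensor_map_free : {freeg (M * N) / R} -> tensor M' N' :=
  freeg_lift (fun p => pure_tensor (f p.1) (g p.2)).

HB.instance Definition _ := GRing.Linear.on tensor_map_free.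

Lemma tensor_map_freeE m n :
  tensor_map_free << (m, n) >> = pure_tensor (f m) (g n).
Proof. by rewrite /tensor_map_free /freeg_lift liftU scale1r. Qed.

Lemma tensor_map_rel D : tensor_rel D -> tensor_map_free D = 0.
Proof.
case=> *; rewrite !raddfB /=; try rewrite [tensor_map_free (_ *: _)]linearZ /=.
all: rewrite !tensor_map_freeE /=.
- by rewrite (raddfD f) pure_tensorDl -addrA -opprD subrr.
- by rewrite (raddfD g) pure_tensorDr -addrA -opprD subrr.
- by rewrite [f (_ *: _)]linearZ /= pure_tensorZl subrr.
- by rewrite [g (_ *: _)]linearZ /= pure_tensorZr subrr.
Qed.

Lemma tensor_map_rel0 x :
  x \in submodule_span (@tensor_rel M N) -> tensor_map_free x = 0.
Proof.
move=> /asboolP[s [relS ->]]; rewrite raddf_sum big1_seq // => c /= /relS relc.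
by rewrite linearZ /= tensor_map_rel // scaler0.
Qed.

Definition tensor_map : {linear tensor M N -> tensor M' N'} :=
  quot_lift tensor_map_rel0.

Lemma tensor_mapE m n :
  tensor_map (pure_tensor m n) = pure_tensor (f m) (g n).
Proof. by rewrite -tensor_map_freeE; apply: quot_lift_pi. Qed.

End Tensor.

Definition noetherian (R : comNzRingType) : Prop :=
  forall I : ideal R, finitely_generated I.

(* idealr R is the type of proper ideals of R. *)
Definition maximal_ideal (R : comNzRingType) (m : idealr R) : Prop :=
  forall J : idealr R, {subset m <= J} -> {subset J <= m}.

Definition local_ring (R : comNzRingType) (m : idealr R) : Prop :=
  [/\ noetherian R, maximal_ideal m
    & forall m' : idealr R, maximal_ideal m' -> m' =i m].

Section Completion.
Variables (R : comNzRingType) (m : idealr R).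

(* m ^ (n + 1): the exponent starts at 1 because R / m ^ 0 is the zero ring,
   which comNzRingType excludes. *)
Definition ideal_pow (n : nat) : {pred R} := ideal_exp m n.+1.

Lemma ideal_pow_sub n : {subset ideal_pow n <= m}.
Proof.
move=> x /asboolP[s [sm ->]]; rewrite big_seq; apply: rpred_sum => c /sm[a [v [am _ ->]]].
by apply: idealMr; rewrite [_ *: _]mulrC; apply: idealMr.
Qed.

Lemma ideal_pow_closed n : idealr_closed (ideal_pow n).
Proof.
pose I : ideal R := ideal_exp m n.+1.
split=> [||a u v uI vI]; first exact: (rpred0 I).
  by apply/negP => /ideal_pow_sub; rewrite idealr1.
by apply: (rpredD (S := I)) => //; apply: (@rpredZ _ _ I).
Qed.

HB.instance Definition _ n := isIdealr.Build R (ideal_pow n) (ideal_pow_closed n).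

Definition residues := forall n, {ideal_quot (ideal_pow n)}.

HB.instance Definition _ := Choice.on residues.

Implicit Types x y z : residues.

Definition residues_add x y : residues := fun n => x n + y n.
Definition residues_opp x : residues := fun n => - x n.
Definition residues_mul x y : residues := fun n => x n * y n.

Lemma residues_addA : associative residues_add.
Proof. by move=> x y z; apply: functional_extensionality_dep => n; apply: addrA. Qed.
Lemma residues_addC : commutative residues_add.
Proof. by move=> x y; apply: functional_extensionality_dep => n; apply: addrC. Qed.
Lemma residues_add0 : left_id (fun n => 0 : {ideal_quot _}) residues_add.
Proof. by move=> x; apply: functional_extensionality_dep => n; apply: add0r. Qed.
Lemma residues_addN :
  left_inverse (fun n => 0 : {ideal_quot _}) residues_opp residues_add.
Proof. by move=> x; apply: functional_extensionality_dep => n; apply: addNr. Qed.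

HB.instance Definition _ := GRing.isZmodule.Build residues
  residues_addA residues_addC residues_add0 residues_addN.

Lemma residues_mulA : associative residues_mul.
Proof. by move=> x y z; apply: functional_extensionality_dep => n; apply: mulrA. Qed.
Lemma residues_mulC : commutative residues_mul.
Proof. by move=> x y; apply: functional_extensionality_dep => n; apply: mulrC. Qed.
Lemma residues_mul1 : left_id (fun n => 1 : {ideal_quot _}) residues_mul.
Proof. by move=> x; apply: functional_extensionality_dep => n; apply: mul1r. Qed.
Lemma residues_mulD : left_distributive residues_mul +%R.
Proof. by move=> x y z; apply: functional_extensionality_dep => n; apply: mulrDl. Qed.
Lemma residues_1neq0 : (fun n => 1 : {ideal_quot _}) != 0 :> residues.
Proof. by apply/eqP => /(congr1 (@^~ 0)) /eqP; rewrite oner_eq0. Qed.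

HB.instance Definition _ := GRing.Zmodule_isComNzRing.Build residues
  residues_mulA residues_mulC residues_mul1 residues_mulD residues_1neq0.

(* x n and x (n + 1) are the classes of a common element of R, that is,
   R / m ^ (n + 2) -> R / m ^ (n + 1) maps x (n + 1) to x n *)
Definition coherent : {pred residues} := fun x => `[< forall n, exists a : R,
  x n = \pi_({ideal_quot (ideal_pow n)}) a /\
  x n.+1 = \pi_({ideal_quot (ideal_pow n.+1)}) a >].

Lemma coherent_closed : subring_closed coherent.
Proof.
split.
- by apply/asboolP => n; exists 1; rewrite !rmorph1.
- move=> x y /asboolP xc /asboolP yc; apply/asboolP => n.
  have [[a [xa xa']] [b [yb yb']]] := (xc n, yc n).
  by exists (a - b); rewrite !raddfB /= -xa -xa' -yb -yb'.
- move=> x y /asboolP xc /asboolP yc; apply/asboolP => n.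
  have [[a [xa xa']] [b [yb yb']]] := (xc n, yc n).
  by exists (a * b); rewrite !rmorphM /= -xa -xa' -yb -yb'.
Qed.

HB.instance Definition _ :=
  GRing.isSubringClosed.Build residues coherent coherent_closed.

(* the m-adic completion, as the inverse limit of the rings R / m ^ (n + 1) *)
Definition completion := {x : residues | x \in coherent}.

HB.instance Definition _ := SubChoice.on completion.
HB.instance Definition _ := [SubChoice_isSubComNzRing of completion by <:].

End Completion.

Definition formally_equidimensional (R : comNzRingType) (m : idealr R) : Prop :=
  forall P : prime_idealr (completion m), minimal_prime P ->
    krull_dim {ideal_quot P} = krull_dim (completion m).

Definition has_rank (R : comNzRingType) (M : lmodType R) (r : rat) : Prop :=
  forall P : prime_idealr R, minimal_prime P ->
    krull_dim {ideal_quot P} = krull_dim R ->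
    exists a b : nat, [/\ module_length (submodule_full (loc_module P M)) = Some a,
      module_length (submodule_full (loc_ring P)^o) = Some b & a%:R = r * b%:R].

Section Closure.
Variables (R : comNzRingType) (m : idealr R).
(* r n stands for the rank of M n *)
Variables (M : nat -> lmodType R) (r : nat -> rat).

Section Module.
Variable B : lmodType R.
Implicit Types A C : submodule B.

(* Im (M_n (x) C/A -> M_n (x) B/A), for A contained in C *)
Definition tensor_image A C (n : nat) : submodule (tensor (M n) (quot_module A)) :=
  lin_image (tensor_map (idfun : {linear M n -> M n}) (sub_quot_incl A C)).

Definition asymptotically_null A C : Prop :=
  {subset A <= C} /\
  forall eps : rat, 0 < eps -> exists n0, forall n, (n0 <= n)%N ->
    exists l, module_length (tensor_image A C n) = Some l /\ l%:R <= eps * r n.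

(* the closure of A in B when B/A has finite length: the largest C such that
   asymptotically_null A C *)
Definition fin_closure A : {pred B} := fun x => `[< exists C : submodule B,
  [/\ asymptotically_null A C,
      forall C', asymptotically_null A C' -> {subset C' <= C} & x \in C] >].

(* If B/A has finite length, then m ^ t B is contained in A for large t, and this
   is fin_closure A. *)
Definition rank_closure A : {pred B} := fun x => `[< forall t : nat,
  x \in fin_closure (submodule_sum A
       (ideal_mul (R := R) (ideal_exp m t) (submodule_full B))) >].

End Module.

Definition rank_closed (I : ideal R) : Prop := rank_closure I =i I.

End Closure.

Definition integral_closure (R : comNzRingType) (I : ideal R) : {pred R} :=
  fun x => `[< exists n (a : 'I_n.+1 -> R),
    (forall i : 'I_n.+1, a i \in ideal_exp I (n.+1 - i)) /\
    x ^+ n.+1 + \sum_(i < n.+1) a i * x ^+ i = 0 >].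

Definition integrally_closed (R : comNzRingType) (I : ideal R) : Prop :=
  integral_closure I =i I.

Definition radical_ideal (R : comNzRingType) (I : ideal R) : Prop :=
  forall x n, x ^+ n \in I -> x \in I.

Definition prime_ideal (R : comNzRingType) (I : ideal R) : Prop :=
  1 \notin I /\ prime_idealr_closed I.

(* Main.v *)
Require Import Defs.
From HB Require Import structures.
From mathcomp Require Import all_boot all_order all_algebra ring_quotient.
From mathcomp Require Import generic_quotient boolp ring lra.
From mathcomp Require freeg classical_sets.

Set Implicit Arguments.
Unset Strict Implicit.
Unset Printing Implicit Defensive.

Import Order.TTheory GRing.Theory Num.Theory.
Local Open Scope ring_scope.

(* Suppose that u lies in the closure of I but is not integral over I. The elements
   c u^N + w, with c outside m and w in the sum of the I^(N-i) u^i for i < N, form a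
   multiplicative set that omits 0, so it misses a minimal prime P of R: u is not
   integral over I modulo P.

   Then u is not integral over J = I + m^t modulo P for some t. To see this, adjoin
   the fractions a/u of the generators a of I one by one, as images of polynomial
   variables: this reduces to I = 0. There, choose a prime q maximal among those
   that avoid u; by the principal ideal theorem m is minimal over q + (u), so a
   power of m lies in q + u m locally at m, and u is not integral over that power.

   If x_1, ..., x_s generate M_n modulo m M_n + (J M_n : u), with s minimal, then s
   is at most the length of the image of M_n (x) (J + uR)/J in M_n (x) R/J, and a
   determinant that is nonzero modulo P (as u is not integral over J) shows that
   x_1, ..., x_s generate M_n at P. Hence rank (M_n) <= s, which contradicts
   s = o(rank (M_n)).

   The rank is tested only at the minimal primes P with dim R/P = dim R. These are
   all of them: if x_1, ..., x_c is a system of parameters of R/P and Q is a minimal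
   prime of the completion over P, the height theorem gives
   dim (completion) = dim (completion / Q) <= c, and a system of parameters of the
   completion can be approximated by one of R. The completion is Noetherian by
   Cohen's theorem and successive approximation. *)

(** * Submodules and ideals *)

(** The closure only sees lengths over R/(I + m^t), because R/I need not have finite length. Hence
    nonintegrality over I must be carried to I + m^t for a single t before any tensor product
    appears, and it must be carried modulo a fixed minimal prime P: the rank is read off at P, so
    the determinant has to be nonzero there. After that, a single index n gives the contradiction.

    Nonintegrality is expressed in a field K that receives R with kernel P. The field stays fixed
    while R is replaced by polynomial rings over it. These are Noetherian but not local, which is
    why the condition [separated] carries a prime n rather than the maximal ideal.

    Apart from the modules in the definition of rank, nothing is localized: a statement at a prime
    is one that holds after multiplication by some element outside that prime. *)

Section SubmoduleBasics.
Variables (R : pzRingType) (V : lmodType R).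
Implicit Types (N : submodule V) (X S : V -> Prop).

Definition is_submodule S : Prop :=
  [/\ S 0, forall x y, S x -> S y -> S (x + y) & forall a x, S x -> S (a *: x)].

Lemma submodule_of_closed S : is_submodule S ->
  submod_closed ((fun x => `[< S x >]) : {pred V}).
Proof.
case=> S0 SD SZ; split=> [|a x y /asboolP Sx /asboolP Sy]; apply/asboolP => //.
exact/SD/Sy/SZ.
Qed.

Definition submodule_of S (hS : is_submodule S) : submodule V :=
  Submodule (submodule_of_closed hS).

Lemma submodule_ofP S (hS : is_submodule S) x :
  reflect (S x) (x \in submodule_of hS).
Proof. exact: asboolP. Qed.

Lemma mem_submodule_span X x : X x -> x \in submodule_span X.
Proof.
move=> Xx; apply/asboolP; exists [:: (1, x)]; rewrite big_seq1 scale1r.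
by split=> // c; rewrite mem_seq1 => /eqP->.
Qed.

Lemma submodule_span_min X N :
  (forall x, X x -> x \in N) -> {subset submodule_span X <= N}.
Proof.
move=> XN x /asboolP[s [sX ->]]; rewrite big_seq; apply: rpred_sum => c /sX/XN.
exact: rpredZ.
Qed.

Lemma submodule_span_ind X S : is_submodule S -> (forall x, X x -> S x) ->
  forall x, x \in submodule_span X -> S x.
Proof.
move=> hS XS x xX; apply/(submodule_ofP hS).
by apply: submodule_span_min xX => y /XS ?; apply/submodule_ofP.
Qed.

Lemma zero_submoduleP x : x \in submodule_span (fun _ : V => False) <-> x = 0.
Proof.
split=> [|->]; last exact: rpred0.
move: x; apply: submodule_span_ind => //.
by split=> // [x y -> ->|a x ->]; rewrite ?addr0 ?scaler0.
Qed.

Definition spans k (g : 'I_k -> V) N : Prop :=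
  N =i submodule_span (fun x => exists i, x = g i).

Lemma spansP k (g : 'I_k -> V) x :
  x \in submodule_span (fun x => exists i, x = g i) <->
  exists c : 'I_k -> R, x = \sum_i c i *: g i.
Proof.
split=> [|[c ->]]; last first.
  by apply: rpred_sum => i _; apply/rpredZ/mem_submodule_span; exists i.
move: x; apply: submodule_span_ind => [|x [i ->]].
  split=> [|x y [c ->] [d ->]|a x [c ->]].
  - by exists (fun=> 0); rewrite big1 // => i _; rewrite scale0r.
  - exists (fun i => c i + d i); rewrite -big_split.
    by apply: eq_bigr => i _; rewrite scalerDl.
  - exists (fun i => a * c i); rewrite scaler_sumr.
    by apply: eq_bigr => i _; rewrite scalerA.
exists (fun j => (j == i)%:R); rewrite (bigD1 i) //= eqxx scale1r big1 ?addr0 //.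
by move=> j /negPf->; rewrite scale0r.
Qed.

Lemma finitely_generatedP N :
  finitely_generated N <-> exists k (g : 'I_k -> V), spans g N.
Proof.
split=> [[s Ns]|[k [g Ng]]].
  exists (size s), (fun i => s`_i) => x; rewrite Ns; apply/idP/idP;
    apply: submodule_span_min => {}x.
    move=> xs; apply: mem_submodule_span.
    by exists (Ordinal (etrans (index_mem x s) xs)); rewrite nth_index.
  by case=> i ->; apply: mem_submodule_span; rewrite mem_nth.
exists (codom g) => x; rewrite Ng; apply/idP/idP;
  apply: submodule_span_min => {}x.
  by case=> i ->; apply/mem_submodule_span/codom_f.
by case/codomP => i ->; apply: mem_submodule_span; exists i.
Qed.

Lemma mem_submodule_sum (A B : submodule V) a b :
  a \in A -> b \in B -> a + b \in submodule_sum A B.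
Proof. by move=> aA bB; apply/asboolP; exists a, b. Qed.

Lemma submodule_sum_l (A B : submodule V) : {subset A <= submodule_sum A B}.
Proof. by move=> a aA; rewrite -[a]addr0 mem_submodule_sum ?rpred0. Qed.

Lemma submodule_sum_r (A B : submodule V) : {subset B <= submodule_sum A B}.
Proof. by move=> a aA; rewrite -[a]add0r mem_submodule_sum ?rpred0. Qed.

Lemma submodule_sum_min (A B N : submodule V) :
  {subset A <= N} -> {subset B <= N} -> {subset submodule_sum A B <= N}.
Proof. by move=> AN BN _ /asboolP[a [b [/AN aN /BN bN ->]]]; rewrite rpredD. Qed.

End SubmoduleBasics.

Section Ideals.
Variable R : comNzRingType.
Implicit Types (I J K : ideal R) (x y z a b c d u v w : R).

Lemma ideal0 I : (0 : R) \in I. Proof. exact: (rpred0 I). Qed.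
Lemma idealD I x y : x \in I -> y \in I -> x + y \in I.
Proof. exact: (@rpredD _ I). Qed.
Lemma idealB I x y : x \in I -> y \in I -> x - y \in I.
Proof. exact: (@rpredB _ I). Qed.
Lemma idealN I x : x \in I -> - x \in I.
Proof. by move=> xI; rewrite -[- x]add0r idealB ?ideal0. Qed.
Lemma ideal_mull I a x : x \in I -> a * x \in I.
Proof. exact: (@rpredZ _ _ I). Qed.
Lemma ideal_mulr I a x : x \in I -> x * a \in I.
Proof. by rewrite mulrC; apply: ideal_mull. Qed.
Lemma ideal_sum (T : Type) (r : seq T) (P : pred T) (F : T -> R) I :
  (forall i, P i -> F i \in I) -> \sum_(i <- r | P i) F i \in I.
Proof. exact: (@rpred_sum _ I). Qed.
Lemma idealBl I x y : x - y \in I -> y \in I -> x \in I.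
Proof. by move=> xyI yI; rewrite -[x](subrK y) idealD. Qed.
Lemma idealBr I x y : x - y \in I -> x \in I -> y \in I.
Proof. by move=> xyI xI; rewrite -[y](subKr x) idealB. Qed.

Lemma ideal_one I x : 1 \in I -> x \in I.
Proof. by move=> I1; rewrite -[x]mulr1 ideal_mull. Qed.

Definition is_ideal (S : R -> Prop) : Prop := @is_submodule R R^o S.
Definition ideal_of S (hS : is_ideal S) : ideal R := submodule_of hS.

Lemma ideal_ofP S (hS : is_ideal S) x : reflect (S x) (x \in ideal_of hS).
Proof. exact: (submodule_ofP (V := R^o)). Qed.

Lemma ideal_span_ind (X S : R -> Prop) : is_ideal S -> (forall x, X x -> S x) ->
  forall x, x \in (submodule_span (V := R^o) X) -> S x.
Proof. exact: submodule_span_ind. Qed.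

Definition principal x : ideal R := @submodule_span R R^o (fun y => y = x).

Lemma principalP x y : y \in principal x <-> exists a, y = a * x.
Proof.
split=> [|[a ->]]; last by apply: ideal_mull; apply: mem_submodule_span.
move: y; apply: ideal_span_ind => [|y ->]; last by exists 1; rewrite mul1r.
split=> [|_ _ [a ->] [b ->]|b _ [a ->]]; first by exists 0; rewrite mul0r.
- by exists (a + b); rewrite mulrDl.
- by exists (b * a); rewrite -mulrA.
Qed.

Definition adjoin I x : ideal R := submodule_sum I (principal x).

Lemma adjoinP I x y : y \in adjoin I x <-> exists b a, b \in I /\ y = b + a * x.
Proof.
split=> [/asboolP[b [c [bI /principalP[a ->] ->]]]|[b [a [bI ->]]]].
  by exists b, a.
by apply: mem_submodule_sum => //; apply/principalP; exists a.
Qed.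

Lemma adjoin_sub I x : {subset I <= adjoin I x}.
Proof. exact: submodule_sum_l. Qed.

Lemma adjoin_mem I x : x \in adjoin I x.
Proof. by apply/adjoinP; exists 0, 1; rewrite ideal0 mul1r add0r. Qed.

Lemma adjoin_min I x J :
  {subset I <= J} -> x \in J -> {subset adjoin I x <= J}.
Proof. by move=> IJ xJ _ /adjoinP[b [a [/IJ bJ ->]]]; rewrite idealD ?ideal_mull. Qed.

Definition zero_ideal : ideal R := @submodule_span R R^o (fun=> False).

Lemma zero_idealP x : x \in zero_ideal -> x = 0.
Proof. by move=> /(@zero_submoduleP R R^o). Qed.

Lemma zero_ideal_sub I : {subset zero_ideal <= I}.
Proof. by move=> x /zero_idealP->; apply: ideal0. Qed.

Lemma prime_ideal_intro (P : ideal R) : 1 \notin P ->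
  (forall a b, a * b \in P -> a \notin P -> b \in P) -> prime_ideal P.
Proof.
by move=> P1 PM; split=> // a b abP; case: (boolP (a \in P)) => //= /(PM a b abP).
Qed.

Lemma prime_idealM (P : ideal R) x y :
  prime_ideal P -> x * y \in P -> x \in P \/ y \in P.
Proof. by move=> [_ Pp] /Pp/orP. Qed.

Lemma prime_idealMn (P : ideal R) x y :
  prime_ideal P -> x \notin P -> y \notin P -> x * y \notin P.
Proof.
by move=> Pp xP yP; apply/negP => /(prime_idealM Pp)[]; apply/negP.
Qed.

Lemma prime_idealX (P : ideal R) x n : prime_ideal P -> x ^+ n \in P -> x \in P.
Proof.
move=> Pp; elim: n => [|n IH].
  by rewrite expr0; case: Pp => /negP.
by rewrite exprS => /(prime_idealM Pp)[|/IH].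
Qed.

Lemma prime_idealXn (P : ideal R) x n :
  prime_ideal P -> x \notin P -> x ^+ n \notin P.
Proof. by move=> Pp; apply/contraNN/prime_idealX. Qed.

Lemma prime_ideal_prod (P : ideal R) (T : Type) (r : seq T) (F : T -> R) :
  prime_ideal P -> (forall i, F i \notin P) -> \prod_(i <- r) F i \notin P.
Proof.
move=> Pp FP; elim/big_rec: _ => [|i x _ xP]; first by case: Pp.
exact: prime_idealMn.
Qed.

Lemma ideal_mulP (J K N : ideal R) :
  (forall a x, a \in J -> x \in K -> a * x \in N) -> {subset ideal_mul J K <= N}.
Proof. by move=> JK; apply: submodule_span_min => _ [a [v [aJ vK ->]]]; apply: JK. Qed.

Lemma mem_ideal_mul (J K : ideal R) a x :
  a \in J -> x \in K -> a * x \in ideal_mul J K.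
Proof. by move=> aJ xK; apply: mem_submodule_span; exists a, x. Qed.

Lemma ideal_exp1 (J : ideal R) : ideal_exp J 1 =i J.
Proof.
move=> x; apply/idP/idP => [|xJ]; first by apply: ideal_mulP => a y aJ _; apply: ideal_mulr.
by rewrite -[x]mulr1; apply: mem_ideal_mul.
Qed.

Lemma ideal_expD (J : ideal R) i j x y :
  x \in ideal_exp J i -> y \in ideal_exp J j -> x * y \in ideal_exp J (i + j).
Proof.
move=> xi yj; move: x xi; elim: i => [|i IH]; first by move=> x _; apply: ideal_mull.
apply: ideal_span_ind => [|_ [a [v [aJ vi ->]]]].
  split=> [|x z xS zS|a x xS]; first by rewrite mul0r ideal0.
    by rewrite mulrDl idealD.
  by rewrite -[a *: x]/(a * x) -mulrA ideal_mull.
by rewrite -[a *: v]/(a * v) -mulrA; apply: mem_ideal_mul => //; apply: IH.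
Qed.

Lemma colon_is_ideal (N : ideal R) c : is_ideal (fun x => c * x \in N).
Proof.
split=> [|x y xN yN|a x xN]; first by rewrite mulr0 ideal0.
  by rewrite mulrDr idealD.
by rewrite -[a *: x]/(a * x) mulrCA ideal_mull.
Qed.

Definition colon (N : ideal R) c : ideal R := ideal_of (colon_is_ideal N c).

Lemma colonP (N : ideal R) c x : reflect (c * x \in N) (x \in colon N c).
Proof. exact: ideal_ofP. Qed.

Lemma ideal_exp_add_min (J N : ideal R) i j :
  (forall x y, x \in ideal_exp J i -> y \in ideal_exp J j -> x * y \in N) ->
  {subset ideal_exp J (i + j) <= N}.
Proof.
elim: i N => [|i IH] N ijN; first by move=> y yj; rewrite -[y]mul1r ijN.
apply: ideal_mulP => c x cJ xij; apply/colonP; apply: IH x xij => x y xi yj.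
by apply/colonP; rewrite mulrA ijN // mem_ideal_mul.
Qed.

Lemma ideal_exp_mem (J : ideal R) n x : x \in J -> x ^+ n \in ideal_exp J n.
Proof.
by move=> xJ; elim: n => // n IH; rewrite exprS; apply: mem_ideal_mul.
Qed.

Lemma ideal_expS_sub (J : ideal R) n :
  {subset ideal_exp J n.+1 <= ideal_exp J n}.
Proof. by apply: ideal_mulP => a x _; apply: ideal_mull. Qed.

Lemma ideal_exp_le (J : ideal R) i j : (i <= j)%N ->
  {subset ideal_exp J j <= ideal_exp J i}.
Proof.
move=> /subnKC <-; elim: (j - i)%N => [|k IH]; first by rewrite addn0.
by rewrite addnS => x /ideal_expS_sub/IH.
Qed.

Lemma ideal_exp_prime (P J : ideal R) n : prime_ideal P ->
  {subset ideal_exp J n <= P} -> {subset J <= P}.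
Proof.
by move=> Pp JP x xJ; apply: (@prime_idealX P x n Pp); apply/JP/ideal_exp_mem.
Qed.

End Ideals.

(** * Primes of Noetherian rings *)

Section Noetherian.
Variable R : comNzRingType.
Hypothesis noethR : noetherian R.
Implicit Types (I J K P Q : ideal R) (x y z a b c d p q r u v w : R).

(** Otherwise choice builds a strictly ascending sequence in [F]. Its union is finitely generated,
    so one member contains all the generators and hence its own successor. *)
Lemma noetherian_maximal (F : ideal R -> Prop) I0 : F I0 ->
  exists I, F I /\ forall J, F J -> {subset I <= J} -> {subset J <= I}.
Proof.
move=> F0; apply: contrapT => noI.
have next (I : {I | F I}) : exists J : {J | F J},
    {subset sval I <= sval J} /\ ~ {subset sval J <= sval I}.
  apply: contrapT => noJ; apply: noI; exists (sval I); split; first exact: (svalP I).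
  move=> J FJ IJ; apply: contrapT => JI; apply: noJ.
  by exists (exist _ J FJ).
pose C := fix C n := if n is n'.+1 then projT1 (cid (next (C n'))) else exist _ I0 F0.
have Cnext n := projT2 (cid (next (C n))).
have Cle i j : (i <= j)%N -> {subset sval (C i) <= sval (C j)}.
  move=> /subnKC<-; elim: (j - i)%N => [|k IH] x; first by rewrite addn0.
  by rewrite addnS => /IH; apply: (Cnext _).1.
have CU : @is_ideal R (fun x => exists n, x \in sval (C n)).
  split=> [|x y [i xi] [j yj]|a x [i xi]].
  - by exists 0%N; apply: ideal0.
  - exists (maxn i j); apply: idealD.
      by apply: Cle xi; apply: leq_maxl.
    by apply: Cle yj; apply: leq_maxr.
  - by exists i; apply: ideal_mull.
have /finitely_generatedP[k [g Ug]] := noethR (ideal_of CU).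
have gU i : exists n, g i \in sval (C n).
  by apply/(ideal_ofP CU); rewrite Ug; apply: mem_submodule_span; exists i.
pose n i := projT1 (cid (gU i)).
have gn i : g i \in sval (C (n i)) := projT2 (cid (gU i)).
pose N := \max_i n i.
case: (Cnext N) => _; apply=> x xN.
have: x \in ideal_of CU by apply/ideal_ofP; exists N.+1.
rewrite Ug; move: x {xN}; apply: submodule_span_min => _ [i ->].
by apply: Cle (gn i); apply: leq_bigmax.
Qed.

Lemma noetherian_ind (G : ideal R -> Prop) :
  (forall K, (forall K', {subset K <= K'} -> ~ {subset K' <= K} -> G K') -> G K) ->
  forall K, G K.
Proof.
move=> IH K; apply: contrapT => GK.
have [I [GI maxI]] := noetherian_maximal (F := fun I => ~ G I) GK.
by apply/GI/IH => J IJ JI; apply: contrapT => GJ; apply/JI/maxI.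
Qed.

(** A substitute for primary decomposition: a proper ideal that is not prime contains a product
    [a * b] with [a] and [b] outside it, and both adjoined ideals are strictly larger. *)
Lemma noetherian_prime_ind (G : ideal R -> Prop) :
  (forall K, 1 \in K -> G K) -> (forall K, prime_ideal K -> G K) ->
  (forall K a b, a * b \in K -> G (adjoin K a) -> G (adjoin K b) -> G K) ->
  forall K, G K.
Proof.
move=> G1 Gp GM; apply: noetherian_ind => K IH.
have [/G1//|K1] := boolP (1 \in K).
have [/Gp//|Kp] := pselect (prime_ideal K).
have /existsNP[a /existsNP[b]] : ~ prime_idealr_closed K by move=> Kc; apply: Kp.
move=> /not_implyP[abK /negP]; rewrite negb_or => /andP[aK bK].
have up c : c \notin K -> ~ {subset adjoin K c <= K}.
  by move=> /negP cK /(_ c (adjoin_mem K c)).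
by apply: (GM K a b) => //; apply: IH (up _ _) => //; apply: adjoin_sub.
Qed.

Lemma noetherian_chain (C : nat -> ideal R) :
  (forall n, {subset C n <= C n.+1}) -> exists n, forall k, {subset C k <= C n}.
Proof.
move=> Cnext; have Cle i j : (i <= j)%N -> {subset C i <= C j}.
  move=> /subnKC<-; elim: (j - i)%N => [|k IH] x; first by rewrite addn0.
  by rewrite addnS => /IH; apply: Cnext.
have [|_ [[n ->] maxn]] :=
  @noetherian_maximal (fun I => exists n, I = C n) (C 0%N); first by exists 0%N.
exists n => k; have [kn|/ltnW nk] := leqP k n; first exact: Cle.
by apply: maxn (Cle _ _ nk); exists k.
Qed.

Definition prime_over K P : Prop := prime_ideal P /\ {subset K <= P}.
Definition minimal_over K P : Prop :=
  prime_over K P /\ forall Q, prime_over K Q -> {subset Q <= P} -> {subset P <= Q}.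

Lemma prime_avoiding (S : R -> Prop) K : S 1 -> (forall x y, S x -> S y -> S (x * y)) ->
  (forall x, x \in K -> ~ S x) ->
  exists P, prime_over K P /\ forall x, x \in P -> ~ S x.
Proof.
move=> S1 SM KS.
have [P [[KP PS] maxP]] := @noetherian_maximal
  (fun I => {subset K <= I} /\ forall x, x \in I -> ~ S x) K (conj (fun _ => id) KS).
exists P; do 2![split=> //]; apply: prime_ideal_intro => [|a b abP aP].
  by apply/negP => /PS.
apply: contrapT => /negP bP.
have meet c : c \notin P -> exists p r, p \in P /\ S (p + r * c).
  move=> cP; apply: contrapT => noS.
  case/negP: cP; apply: (maxP (adjoin P c)); last first.
  - exact: adjoin_mem.
  - exact: adjoin_sub.
  split=> [x /KP/adjoin_sub//|_ /adjoinP[p [r [pP ->]]] Sp].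
  by apply: noS; exists p, r.
have [[p [r [pP Sp]]] [q [w [qP Sq]]]] := (meet a aP, meet b bP).
apply: PS (SM _ _ Sp Sq).
have -> : (p + r * a) * (q + w * b) = p * (q + w * b) + (r * a) * q + r * w * (a * b).
  by ring.
by apply: idealD; [apply: idealD; [apply: ideal_mulr|apply: ideal_mull]|apply: ideal_mull].
Qed.

(** Prime induction yields a finite family of primes over [K] such that every prime over [K]
    contains one of them. Dropping a member that contains another one keeps this property; the
    antichain left at the end consists of minimal primes. *)
Lemma minimal_primes K : exists n (F : 'I_n -> ideal R),
  [/\ forall i, minimal_over K (F i),
      forall Q, prime_over K Q -> exists i, {subset F i <= Q}
    & forall i j, {subset F i <= F j} -> i = j].
Proof.
pose good n (F : 'I_n -> ideal R) := (forall i, prime_over K (F i)) /\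
  forall Q, prime_over K Q -> exists i, {subset F i <= Q}.
have [n0 [F0 good0]] : exists n F, good n F.
  rewrite {}/good; move: K; apply: noetherian_prime_ind => [K K1|K Kp|K a b abK].
  - exists 0%N, (fun=> K); split=> [[]//|Q [[/negP Q1 _] KQ]].
    by case: Q1; apply: KQ.
  - by exists 1%N, (fun=> K); split=> [i|Q [_ KQ]]; [split|exists ord0].
  - move=> [n [F [aF Fa]]] [m [G [bG Gb]]].
    exists (n + m)%N, (fun i => match split i with inl j => F j | inr j => G j end).
    split=> [i|Q [Qp KQ]].
      case: (split i) => j.
        by have [Pp aP] := aF j; split=> // x xK; apply/aP/adjoin_sub.
      by have [Pp bP] := bG j; split=> // x xK; apply/bP/adjoin_sub.
    have [aQ|bQ] := prime_idealM Qp (KQ _ abK).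
      have [|i FiQ] := Fa Q; first by split=> //; apply: adjoin_min.
      by exists (lshift m i); rewrite (unsplitK (inl i)).
    have [|i GiQ] := Gb Q; first by split=> //; apply: adjoin_min.
    by exists (rshift n i); rewrite (unsplitK (inr i)).
elim: n0 F0 good0 => [|n IH] F [FK KF].
  by exists 0%N, F; split=> // - [].
have [anti|] := pselect (forall i j, {subset F i <= F j} -> i = j).
  exists n.+1, F; split=> // i; split=> // Q /KF[j FjQ] QFi x.
  by have <- : j = i; [apply: anti => y /FjQ/QFi|apply: FjQ].
move=> /existsNP[i /existsNP[j]] /not_implyP[Fij /eqP neq_ij].
apply: (IH (fun k : 'I_n => F (lift j k))).
split=> [k|Q /KF[k FkQ]]; first exact: FK.
have [k' kE|kE] := unliftP j k; first by exists k'; rewrite -kE.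
have [i' iE|iE] := unliftP j i; last by rewrite iE eqxx in neq_ij.
by exists i'; rewrite -iE => x /Fij; rewrite -kE; apply: FkQ.
Qed.

Lemma minimal_over_exists K Q : prime_over K Q ->
  exists2 P, minimal_over K P & {subset P <= Q}.
Proof.
move=> KQ; have [n [F [minF KF _]]] := minimal_primes K.
by have [i FiQ] := KF Q KQ; exists (F i).
Qed.

(** By induction [x] avoids all the primes but [F ord0]. If it lies there, it is corrected by an
    element of [J] that is in every other prime but not in [F ord0]; the antichain hypothesis
    supplies one. *)
Lemma prime_avoidance J n (F : 'I_n -> ideal R) :
  (forall i, prime_ideal (F i)) -> (forall i, ~ {subset J <= F i}) ->
  (forall i j, {subset F i <= F j} -> i = j) ->
  exists2 x, x \in J & forall i, x \notin F i.
Proof.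
elim: n F => [|n IH] F Fp JF anti; first by exists 0; [apply: ideal0|case].
have [//|//|i j /anti/lift_inj//|x xJ xF] := IH (fun i => F (lift ord0 i)).
have [xF0|xF0] := boolP (x \in F ord0); last first.
  by exists x => // i; case: (unliftP ord0 i) => [j|] ->.
have [y yJ yF0] : exists2 y, y \in J & y \notin F ord0.
  apply: contrapT => noy; apply: (JF ord0) => y yJ.
  by apply: contrapT => /negP yF0; apply: noy; exists y.
have sepF i : exists z, z \notin F ord0 /\ z \in F (lift ord0 i).
  apply: contrapT => noz.
  suff /anti/eqP : {subset F (lift ord0 i) <= F ord0} by rewrite eq_sym eq_liftF.
  by move=> z zF; apply: contrapT => /negP zF0; apply: noz; exists z.
pose z i := projT1 (cid (sepF i)).
have zF0 : \prod_i z i \notin F ord0.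
  by apply: prime_ideal_prod => // i; case: (projT2 (cid (sepF i))).
have zF i : \prod_i z i \in F (lift ord0 i).
  by rewrite (bigD1 i) //= ideal_mulr //; case: (projT2 (cid (sepF i))).
exists (x + y * \prod_i z i); first by rewrite idealD ?ideal_mulr.
move=> i; case: (unliftP ord0 i) => [j|] ->.
  apply: contraNN (xF j) => /(idealB)/(_ (ideal_mull y (zF j))).
  by rewrite addrK.
apply/negP => /(idealB)/(_ xF0); rewrite addrAC subrr add0r.
by apply/negP; apply: prime_idealMn yF0 zF0; apply: Fp.
Qed.

(** Locally at [P] the ideal [J] lies in the radical of [K], so a power of it lies in [K]; [s] is a
    common denominator. In the prime induction the exponents for [adjoin K a] and [adjoin K b] add
    up, because the product of these two ideals lies in [K]. *)
Lemma local_power P J K : prime_ideal P ->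
  (forall Q, prime_over K Q -> {subset Q <= P} -> {subset J <= Q}) ->
  exists s N, s \notin P /\ forall x, x \in ideal_exp J N -> s * x \in K.
Proof.
move=> Pp; have P1 : 1 \notin P by case: Pp.
move: K; apply: noetherian_prime_ind => [K K1 _|K Kp KP|K a b abK IHa IHb KP].
- by exists 1, 0%N; split=> // x _; apply: ideal_one.
- have [KsP|] := pselect {subset K <= P}.
    exists 1, 1%N; split=> // x; rewrite ideal_exp1 mul1r.
    by apply: KP => //; split.
  move=> /existsNP[s /not_implyP[sK /negP sP]].
  by exists s, 0%N; split=> // x _; apply: ideal_mulr.
have sub c Q : prime_over (adjoin K c) Q -> prime_over K Q.
  by case=> Qp KQ; split=> // x /adjoin_sub/KQ.
have [|s [N [sP sN]]] := IHa; first by move=> Q /sub; apply: KP.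
have [|t [M [tP tM]]] := IHb; first by move=> Q /sub; apply: KP.
exists (s * t), (N + M)%N; split; first exact: prime_idealMn.
have prodK x y : x \in adjoin K a -> y \in adjoin K b -> x * y \in K.
  move=> /adjoinP[k [c [kK ->]]] /adjoinP[l [d [lK ->]]].
  have -> : (k + c * a) * (l + d * b) = k * (l + d * b) + c * a * l + c * d * (a * b).
    by ring.
  by apply: idealD; [apply: idealD; [apply: ideal_mulr|apply: ideal_mull]|apply: ideal_mull].
move=> x xNM; apply/colonP; apply: ideal_exp_add_min xNM => y z yN zM.
by apply/colonP; rewrite mulrACA prodK ?sN ?tM.
Qed.

End Noetherian.

(** * Determinants and Nakayama's lemma at a prime *)

Section Determinants.
Variable R : comNzRingType.

Lemma det_scale_mem (V : lmodType R) (N : submodule V) k (A : 'M[R]_k) (g : 'I_k -> V) :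
  (forall i, \sum_j A i j *: g j \in N) -> forall i, \det A *: g i \in N.
Proof.
move=> Ag i; suff -> : \det A *: g i = \sum_l \adj A i l *: \sum_j A l j *: g j.
  by apply: rpred_sum => l _; apply/rpredZ/Ag.
transitivity (\sum_j (\adj A *m A) i j *: g j).
  rewrite mul_adj_mx (bigD1 i) //= mxE eqxx big1 ?addr0 // => j /negPf ji.
  by rewrite mxE eq_sym ji scale0r.
under [RHS]eq_bigr => l _ do rewrite scaler_sumr.
rewrite exchange_big; apply: eq_bigr => j _.
by rewrite mxE scaler_suml; apply: eq_bigr => l _; rewrite scalerA.
Qed.

Lemma ideal_prod_congr (I : ideal R) (T : Type) (r : seq T) (F G : T -> R) :
  (forall i, F i - G i \in I) -> \prod_(i <- r) F i - \prod_(i <- r) G i \in I.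
Proof.
move=> FG; elim/big_rec2: _ => [|i x y _ xyI]; first by rewrite subrr ideal0.
have -> : F i * y - G i * x = (F i - G i) * y + G i * (y - x) by ring.
by apply: idealD; [apply: ideal_mulr|apply: ideal_mull].
Qed.

Lemma ideal_det_congr (I : ideal R) k (A B : 'M[R]_k) :
  (forall i j, A i j - B i j \in I) -> \det A - \det B \in I.
Proof.
move=> AB; rewrite /determinant -sumrB; apply: ideal_sum => s _.
by rewrite -mulrBr; apply/ideal_mull/ideal_prod_congr.
Qed.

Lemma module_mul_spans (V : lmodType R) (J : ideal R) (N : submodule V) k
    (g : 'I_k -> V) x : spans g N -> x \in ideal_mul J N ->
  exists2 c : 'I_k -> R, forall i, c i \in J & x = \sum_i c i *: g i.
Proof.
move=> Ng; move: x; apply: submodule_span_ind => [|_ [a [v [aJ vN ->]]]].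
  split=> [|x y [c cJ ->] [d dJ ->]|a x [c cJ ->]].
  - by exists (fun=> 0) => [i|]; rewrite ?ideal0 // big1 // => i _; rewrite scale0r.
  - exists (fun i => c i + d i) => [i|]; first exact: idealD.
    by rewrite -big_split; apply: eq_bigr => i _; rewrite scalerDl.
  - exists (fun i => a * c i) => [i|]; first exact: ideal_mull.
    by rewrite scaler_sumr; apply: eq_bigr => i _; rewrite scalerA.
move: vN; rewrite Ng => /spansP[c ->]; exists (fun i => a * c i) => [i|].
  exact: ideal_mulr.
by rewrite scaler_sumr; apply: eq_bigr => i _; rewrite scalerA.
Qed.

Lemma ideal_mul_spans (J N : ideal R) k (g : 'I_k -> R) x :
  spans (V := R^o) g N -> x \in ideal_mul J N ->
  exists2 c : 'I_k -> R, forall i, c i \in J & x = \sum_i c i * g i.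
Proof. exact: (@module_mul_spans R^o). Qed.

(** Nakayama's lemma in the localization at [P]. The determinant of the relation matrix [A] carries
    [N] into [N']; modulo [P] it is the product of the multipliers [s i], so it is outside [P]. *)
Lemma nakayama (P N N' : ideal R) : prime_ideal P -> finitely_generated N ->
  (forall y, y \in N -> exists2 s, s \notin P & s * y \in submodule_sum (ideal_mul P N) N') ->
  exists2 s, s \notin P & forall y, y \in N -> s * y \in N'.
Proof.
move=> Pp /finitely_generatedP[k [g Ng]] PN.
have gN i : g i \in N by rewrite Ng; apply: mem_submodule_span; exists i.
have coef i : exists sc : R * ('I_k -> R), [/\ sc.1 \notin P, forall j, sc.2 j \in P
    & sc.1 * g i - \sum_j sc.2 j * g j \in N'].
  have [s sP /asboolP[a [b [/(ideal_mul_spans Ng)[c cP ->] bN' sE]]]] := PN _ (gN i).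
  by exists (s, c); split; rewrite //= sE addrAC subrr add0r.
pose s i := (projT1 (cid (coef i))).1; pose c i := (projT1 (cid (coef i))).2.
have sP i : s i \notin P by rewrite /s; case: (cid _) => /= sc [].
have cP i j : c i j \in P by rewrite /c; case: (cid _) => /= sc [].
have scN i : s i * g i - \sum_j c i j * g j \in N'.
  by rewrite /s /c; case: (cid _) => /= sc [].
pose A : 'M[R]_k := \matrix_(i, j) (s i *+ (i == j) - c i j).
exists (\det A).
  have : \det A - \det (diag_mx (\row_i s i)) \in P.
    apply: ideal_det_congr => i j; rewrite !mxE.
    by rewrite addrAC subrr add0r idealN.
  rewrite det_diag => /idealBr AP; apply/negP => /AP; apply/negP.
  by apply: prime_ideal_prod => // i; rewrite mxE.
move=> y; rewrite Ng => /spansP[d ->].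
rewrite [_ * _]mulr_sumr; apply: ideal_sum => i _; rewrite mulrCA; apply: ideal_mull.
apply: (det_scale_mem (V := R^o)) => {}i.
rewrite (eq_bigr (fun j => (s i *+ (i == j)) * g j - c i j * g j)) => [|j _].
  rewrite sumrB (bigD1 i) //= eqxx big1 ?addr0 ?scN // => j.
  by rewrite eq_sym => /negPf->; rewrite mul0r.
by rewrite mxE -mulrBl.
Qed.

End Determinants.

(** * Krull's principal ideal theorem *)

Section PrincipalIdealTheorem.
Variable R : comNzRingType.
Hypothesis noethR : noetherian R.
Implicit Types (I J K P Q U W N : ideal R) (x y z a b c d s t p q r u v w : R).

(** The image of [a] in the localization at [P] lies in the extension of [I]. *)
Definition locally_in P I a : Prop := exists2 s, s \notin P & s * a \in I.

Lemma locally_in_mem P I a : prime_ideal P -> a \in I -> locally_in P I a.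
Proof. by move=> [P1 _] aI; exists 1; rewrite ?mul1r. Qed.

Lemma locally_in_sub P I J a : {subset I <= J} -> locally_in P I a -> locally_in P J a.
Proof. by move=> IJ [s sP /IJ]; exists s. Qed.

Lemma locally_in_is_ideal P I : prime_ideal P -> is_ideal (locally_in P I).
Proof.
move=> Pp; split=> [|a b [s sP sa] [t tP tb]|a b [s sP sb]].
- by apply: locally_in_mem => //; apply: ideal0.
- exists (s * t); first exact: prime_idealMn.
  rewrite mulrDr; apply: idealD; last by rewrite -mulrA ideal_mull.
  by rewrite mulrAC ideal_mulr.
- by exists s; rewrite // -[a *: b]/(a * b) mulrCA ideal_mull.
Qed.

(* The descending chain condition for the localization at P of the submodules of
   (W + U) / U. *)
Definition locally_artinian P U W : Prop :=
  forall C : nat -> ideal R, (forall n, {subset C n.+1 <= C n}) ->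
  exists n, forall n' a, (n <= n')%N -> a \in C n -> a \in W ->
    locally_in P (submodule_sum (C n') U) a.

Lemma descending_le (C : nat -> ideal R) i j : (forall n, {subset C n.+1 <= C n}) ->
  (i <= j)%N -> {subset C j <= C i}.
Proof.
move=> Cdec /subnKC <-; elim: (j - i)%N => [|k IH] x; first by rewrite addn0.
by rewrite addnS => /Cdec/IH.
Qed.

(** Up to a multiplier, an element of [W] in the chain lies in [C n'] modulo [V]. The error term
    stays in the chain, so the condition for [V] modulo [U] applies to it. *)
Lemma locally_artinian_trans P U V W : prime_ideal P ->
  locally_artinian P U V -> locally_artinian P V W -> locally_artinian P U W.
Proof.
move=> Pp UV VW C Cdec.
have [[n1 UVn] [n2 VWn]] := (UV C Cdec, VW C Cdec).
exists (maxn n1 n2) => n' a; rewrite geq_max => /andP[n1n' n2n'] aC aW.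
have [|s sP /asboolP[c [v [cC vV sa]]]] := VWn n' a n2n' _ aW.
  by apply: descending_le aC => //; apply: leq_maxr.
have vC : v \in C n1.
  have -> : v = s * a - c by rewrite sa addrAC subrr add0r.
  rewrite idealB ?ideal_mull //.
    by apply: descending_le aC => //; apply: leq_maxl.
  exact: descending_le cC.
have [t tP /asboolP[d [u [dC uU tv]]]] := UVn n' v n1n' vC vV.
exists (t * s); first exact: prime_idealMn.
rewrite -mulrA sa mulrDr tv addrA; apply: mem_submodule_sum => //.
by rewrite idealD ?ideal_mull.
Qed.

Lemma locally_artinian_sub P U W W' : {subset W' <= W} ->
  locally_artinian P U W -> locally_artinian P U W'.
Proof.
move=> W'W UW C /UW[n Un]; exists n => n' a nn' aC /W'W; exact: Un.
Qed.

(** Locally at [P] the quotient of [adjoin U x] by [U] is zero or the residue field. So either some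
    [C n] meets [adjoin U x] only in [U], or every [C n'] contains some [w + d * x] with [d] outside
    [P], which recovers all of [adjoin U x]. *)
Lemma locally_artinian_adjoin P U x : prime_ideal P ->
  (forall c, c \in P -> c * x \in U) -> locally_artinian P U (adjoin U x).
Proof.
move=> Pp Px C Cdec.
have [[n Cn]|noC] := pselect (exists n, forall a, a \in C n -> a \in adjoin U x ->
    locally_in P U a).
  exists n => n' a _ aC aW; apply: locally_in_sub (Cn a aC aW).
  exact: submodule_sum_r.
exists 0%N => n' _ _ _ /adjoinP[u [c [uU ->]]].
have [a [aC [/adjoinP[w [d [wU aE]]] aU]]] : exists a, a \in C n' /\
    (a \in adjoin U x /\ ~ locally_in P U a).
  apply: contrapT => noa; apply: noC; exists n' => a aC aW.
  by apply: contrapT => aU; apply: noa; exists a.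
have dP : d \notin P.
  apply/negP => dP; apply: aU; apply: locally_in_mem => //.
  by rewrite aE idealD ?Px.
exists d => //; have -> : d * (u + c * x) = c * a + (d * u - c * w).
  by rewrite aE; ring.
by apply: mem_submodule_sum; [|apply: idealB]; apply: ideal_mull.
Qed.

Lemma locally_artinian_fg P U N : prime_ideal P -> finitely_generated N ->
  (forall c y, c \in P -> y \in N -> c * y \in U) -> locally_artinian P U N.
Proof.
move=> Pp /finitely_generatedP[k [g Ng]] PN.
have gN i : g i \in N by rewrite Ng; apply: mem_submodule_span; exists i.
have {gN} PgU i c : c \in P -> c * g i \in U by move=> cP; apply: PN.
suff [W [UW _ gW]] : exists W, [/\ locally_artinian P U W, {subset U <= W}
    & forall i, g i \in W].
  apply: locally_artinian_sub UW => x; rewrite Ng.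
  by apply: submodule_span_min x => _ [i ->].
elim: k g PgU {Ng} => [|k IH] g PgU.
  exists U; split=> // [C Cdec|[]//]; exists 0%N => n' a _ aC aU.
  by apply: locally_in_mem => //; apply: submodule_sum_r.
have [|W [UW sUW gW]] := IH (fun i => g (lift ord0 i)).
  by move=> i c cP; apply: PgU.
exists (adjoin W (g ord0)); split=> [|x /sUW/adjoin_sub//|i].
  apply: locally_artinian_trans UW _ => //.
  by apply: locally_artinian_adjoin => // c /PgU-/(_ ord0)/sUW.
by case: (unliftP ord0 i) => [j|] ->; [apply/adjoin_sub/gW|apply: adjoin_mem].
Qed.

(** Locally at [P] some power of [P] lies in [K], and each of the finitely many layers P^i / P^(i+1)
    is finite-dimensional over the residue field. *)
Lemma locally_artinian_minimal P K : minimal_over K P ->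
  locally_artinian P K (submodule_full R^o).
Proof.
move=> [[Pp KP] minP]; have [|s [n [sP snK]]] := local_power noethR (J := P) (K := K) Pp.
  by move=> Q; apply: minP.
suff: locally_artinian P K (ideal_exp P 0) by [].
have: locally_artinian P K (ideal_exp P n).
  move=> C Cdec; exists 0%N => n' a _ _ /snK; exists s => //.
  exact: submodule_sum_r.
elim: n {snK} => // n IH Kn; apply: IH.
apply: locally_artinian_trans Kn _ => //; apply: locally_artinian_fg => //.
by move=> c y; apply: mem_ideal_mul.
Qed.

Section SymbolicPowers.
Variables (p q P : ideal R) (x : R).
Hypotheses (pp : prime_ideal p) (qp : prime_ideal q).

(** For [p] inside [q], the preimage in R of the n-th symbolic power of q/p in R/p. *)
Definition symbolic n : ideal R :=
  ideal_of (@locally_in_is_ideal q (submodule_sum (ideal_exp q n) p) qp).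

Lemma symbolicP n y :
  reflect (locally_in q (submodule_sum (ideal_exp q n) p) y) (y \in symbolic n).
Proof. exact: ideal_ofP. Qed.

Lemma symbolic_dec n : {subset symbolic n.+1 <= symbolic n}.
Proof.
move=> y /symbolicP yn; apply/symbolicP; apply: locally_in_sub yn.
apply: submodule_sum_min => z zn; last exact: submodule_sum_r.
exact/submodule_sum_l/ideal_expS_sub.
Qed.

Lemma symbolic_sub n : {subset p <= symbolic n}.
Proof.
move=> y yp; apply/symbolicP; apply: locally_in_mem => //.
exact: submodule_sum_r.
Qed.

(** Krull's proof in R/p. The symbolic powers of [q] become stationary modulo [x], since the
    localization at [P] modulo [adjoin p x] is Artinian. Nakayama at [P] removes the words modulo
    [x], and Nakayama at [q] then makes a power of [q] vanish modulo [p], which forces [q] into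
    [p]. *)
Lemma principal_ideal_theorem : {subset p <= q} -> ~ {subset q <= p} ->
  {subset q <= P} -> ~ {subset P <= q} -> minimal_over (adjoin p x) P -> False.
Proof.
move=> pq nqp qP nPq minP; have [[Pp xpP] min] := minP.
have xP : x \in P by apply/xpP/adjoin_mem.
have xq : x \notin q.
  by apply/negP => xq; apply/nPq/(min q) => //; split=> //; apply: adjoin_min.
pose C n := submodule_sum (symbolic n) (adjoin p x).
have [|n Cn] := locally_artinian_minimal minP (C := C).
  move=> n; apply: submodule_sum_min; last exact: submodule_sum_r.
  by move=> y /symbolic_dec; apply: submodule_sum_l.
(* Up to a multiplier, an element of the n-th symbolic power is [b + c * x] with [b] in the next
   one. As [x] is outside [q], the factor [c] is again in the n-th one, and [x] is in [P]. *)
have [|y yn|s sP sn] := @nakayama _ P (symbolic n) (symbolic n.+1) Pp.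
- exact: noethR.
- have [|//|s sP] := Cn n.+1 y (leqnSn n); first exact: submodule_sum_l.
  move=> syC; exists s => //.
  have /adjoinP[b [c [bn sy]]] : s * y \in adjoin (symbolic n.+1) x.
    have sub : {subset adjoin p x <= adjoin (symbolic n.+1) x}.
      by apply: adjoin_min; [move=> z /symbolic_sub/adjoin_sub|apply: adjoin_mem].
    move: syC; apply: submodule_sum_min => //; apply: submodule_sum_min => //.
    exact: adjoin_sub.
  have /symbolicP[t tq tcx] : x * c \in symbolic n.
    have -> : x * c = s * y - b by rewrite sy mulrC addrAC subrr add0r.
    by apply: idealB; [apply: ideal_mull|apply: symbolic_dec].
  rewrite sy addrC; apply: mem_submodule_sum => //; rewrite mulrC.
  apply: mem_ideal_mul => //; apply/symbolicP; exists (t * x).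
    exact: prime_idealMn.
  by rewrite -mulrA.
(* Equality of two consecutive symbolic powers puts q^n into q^(n+1) + p locally at [q]. *)
have [|y yn|t tq tn] := @nakayama _ q (ideal_exp q n) p qp.
- exact: noethR.
- have /symbolicP[t tq tsy] : s * y \in symbolic n.+1.
    apply/sn/symbolicP; apply: locally_in_mem => //.
    exact: submodule_sum_l.
  exists (t * s); last by rewrite -mulrA.
  by apply: prime_idealMn => //; apply: contraNN sP => /qP.
apply/nqp/(@ideal_exp_prime _ p q n) => // y /tn/(prime_idealM pp)[] // tp.
by case/negP: tq; apply: pq.
Qed.

End SymbolicPowers.

End PrincipalIdealTheorem.

(** * Chains of primes, the height theorem and systems of parameters *)

Section PrimeChains.
Variable R : comNzRingType.
Implicit Types (I J K P Q p q r m : ideal R) (x y : R) (xs : seq R).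

Definition strict p q : Prop := {subset p <= q} /\ ~ {subset q <= p}.

Inductive pchain p : nat -> ideal R -> Prop :=
| pchain0 : prime_ideal p -> pchain p 0 p
| pchainS n q q' : pchain p n q -> strict q q' -> prime_ideal q' -> pchain p n.+1 q'.

Lemma pchain_prime p n q : pchain p n q -> prime_ideal p /\ prime_ideal q.
Proof. by elim=> {n q} [pp|n q q' _ [pp _] _ q'p]; split. Qed.

Lemma pchain_sub p n q : pchain p n q -> {subset p <= q}.
Proof. by elim=> {n q} [_ x|n q q' _ pq [qq' _] _ x /pq/qq']. Qed.

Lemma pchain_inv p n q : pchain p n q ->
  if n is n'.+1 then exists r, [/\ pchain p n' r, strict r q & prime_ideal q]
  else q = p.
Proof. by case=> {n q} // n q q' pq qq' q'p; exists q. Qed.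

Lemma pchain_strict p n q : pchain p n.+1 q -> ~ {subset q <= p}.
Proof.
move=> /pchain_inv[q' [/pchain_sub pq' [_ q'q] _]] qp; apply: q'q => x /qp.
exact: pq'.
Qed.

Lemma pchain_cons p p' n q : prime_ideal p -> strict p p' -> pchain p' n q ->
  pchain p n.+1 q.
Proof.
move=> pp pp'; elim=> {n q} [p'p|n q q' _ IH qq' q'p].
  by apply: pchainS pp' p'p; apply: pchain0.
exact: pchainS IH qq' q'p.
Qed.

Hypothesis noethR : noetherian R.

(** The chain is rerouted through [x] from the top down. If the prime [r] below [q] misses [x], it
    is replaced by a prime [r'] inside [q] that is minimal over [r0] and [x], where [r0] precedes
    [r]. The principal ideal theorem shows that [r'] is not [q], because [r] lies strictly between
    [r0] and [q]. *)
Lemma pchain_through p n q x : pchain p n.+1 q -> x \in q ->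
  exists p', [/\ strict p p', x \in p' & pchain p' n q].
Proof.
elim: n q => [|n IH] q pq xq.
  have [r [/pchain_inv-> pq' qp]] := pchain_inv pq.
  by exists q; split=> //; apply: pchain0.
have [r [pr rq qp]] := pchain_inv pq.
have [xr|xr] := boolP (x \in r).
  have [p' [pp' xp' p'r]] := IH r pr xr.
  by exists p'; split=> //; apply: pchainS p'r rq qp.
have [r0 [pr0 r0r rp]] := pchain_inv pr.
have [_ r0p] := pchain_prime pr0.
have [|r' min_r' r'q] := minimal_over_exists noethR (K := adjoin r0 x) (Q := q).
  split=> //; apply: adjoin_min xq => y; case: r0r => r0r _ /r0r; exact: rq.1.
have [[r'p xr'] _] := min_r'.
have r0r' : strict r0 r'.
  split=> [y /adjoin_sub/xr'//|r'r0]; case/negP: xr; apply/r0r.1/r'r0/xr'.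
  exact: adjoin_mem.
have qr' : ~ {subset q <= r'}.
  move=> qr'; have min_q : minimal_over (adjoin r0 x) q.
    split=> [|Q Qo Qq y /qr'].
      split=> //; apply: adjoin_min xq => y; case: r0r => r0r _ /r0r; exact: rq.1.
    by apply: min_r'.2 => // z /Qq/qr'.
  apply: (principal_ideal_theorem noethR r0p rp _ _ _ _ min_q).
  - exact: r0r.1.
  - exact: r0r.2.
  - exact: rq.1.
  - exact: rq.2.
have [p' [pp' xp' p'r']] := IH r' (pchainS pr0 r0r' r'p) (xr' _ (adjoin_mem _ _)).
by exists p'; split=> //; apply: pchainS p'r' _ qp.
Qed.

(** Krull's height theorem relative to [p]. By [pchain_through] each element of [xs] costs at most
    one step of the chain; once none is left, the minimality of [q] leaves no room for a step. *)
Lemma pchain_height xs p n q : pchain p n q -> {subset xs <= q} ->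
  (forall Q, prime_over p Q -> {subset xs <= Q} -> {subset Q <= q} -> {subset q <= Q}) ->
  (n <= size xs)%N.
Proof.
elim: xs p n => [|x xs IH] p [|n] // pq xsq min.
  case: (pchain_strict pq); apply: (min p) => //; last exact: pchain_sub pq.
  by split=> //; case: (pchain_prime pq).
have [p' [[pp' _] xp' p'q]] := pchain_through pq (xsq x (mem_head _ _)).
rewrite ltnS; apply: (IH p') => // [y yxs|Q [Qp p'Q] xsQ].
  by apply: xsq; rewrite inE yxs orbT.
apply: min; first by split=> // y /pp'/p'Q.
by move=> y; rewrite inE => /predU1P[->|/xsQ//]; apply: p'Q.
Qed.

Section Local.
Variable m : ideal R.
Hypotheses (m_prime : prime_ideal m)
  (m_max : forall Q, prime_ideal Q -> {subset Q <= m}).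

(** For a proper [J], this says that [xs] generates in R/J an ideal primary to the maximal ideal;
    the length of [xs] need not be minimal. *)
Definition parameters J xs : Prop := {subset xs <= m} /\
  forall Q, prime_over J Q -> {subset xs <= Q} -> {subset m <= Q}.

(** A chain that ends strictly below [m] is first prolonged to [m], where the height bound
    applies. *)
Lemma pchain_le_parameters J xs p n q : parameters J xs ->
  {subset J <= p} -> pchain p n q -> (n <= size xs)%N.
Proof.
move=> [xsm xsJ] Jp pq; have [_ qp] := pchain_prime pq.
have [mq|mq] := pselect {subset m <= q}.
  apply: (pchain_height pq) => [x /xsm/mq//|Q [Qp pQ] xsQ Qq x /(m_max qp)].
  by apply: xsJ => //; split=> // y /Jp/pQ.
apply: ltnW; apply: (pchain_height (q := m)) => //.
  by apply: pchainS pq _ m_prime; split=> //; apply: m_max.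
by move=> Q [Qp pQ] xsQ _; apply: xsJ => //; split=> // y /Jp/pQ.
Qed.

(** Choose [x] in [m] outside the minimal primes of [J] other than [m]. A chain above [adjoin J x]
    then extends downwards by one of these primes, so that the bound drops by one. *)
Lemma parameters_exist c J :
  (forall p n q, {subset J <= p} -> pchain p n q -> (n <= c)%N) ->
  exists2 xs, size xs = c & parameters J xs.
Proof.
elim: c J => [|c IH] J Jc.
  exists [::] => //; split=> // Q [Qp JQ] _; apply: contrapT => mQ.
  suff: (1 <= 0)%N by [].
  apply: (Jc Q _ m) => //; apply: pchainS (pchain0 Qp) _ _ => //.
  by split=> //; apply: m_max.
have [n [F [minF JF anti]]] := minimal_primes noethR J.
(* A minimal prime that contains [m] is left out, as no [x] in [m] could avoid it; a chain above
   such a prime has length zero. *)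
pose A : pred 'I_n := fun i => ~~ `[< {subset m <= F i} >].
have [i|i|i j|x xm xF] := prime_avoidance (J := m) (F := fun i : 'I_#|A| => F (enum_val i)).
- by case: (minF (enum_val i)) => -[].
- by have /asboolPn := enum_valP i.
- by move=> /anti/enum_val_inj.
have [|xs szxs [xsm xsJ]] := IH (adjoin J x).
  move=> p k q Jp pq; have [pp _] := pchain_prime pq.
  have [|i Fip] := JF p; first by split=> // y /adjoin_sub/Jp.
  have [mFi|mFi] := pselect {subset m <= F i}.
    case: k pq => // k /[dup]/pchain_prime[_ qp]/pchain_strict[] y.
    by move=> /(m_max qp)/mFi/Fip.
  have iA : i \in A by rewrite unfold_in; apply/asboolPn.
  have xFi : x \notin F i by rewrite -(enum_rankK_in iA iA); apply: xF.
  rewrite -ltnS; apply: (Jc (F i) _ q); first by case: (minF i) => -[].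
  apply: pchain_cons pq; first by case: (minF i) => -[].
  by split=> // pFi; case/negP: xFi; apply/pFi/Jp/adjoin_mem.
exists (x :: xs); first by rewrite /= szxs.
split=> [y|Q [Qp JQ] xsQ].
  by rewrite inE => /predU1P[->|/xsm].
apply: xsJ => [|y yxs]; last by apply: xsQ; rewrite inE yxs orbT.
by split=> //; apply: adjoin_min => //; apply/xsQ/mem_head.
Qed.

End Local.

End PrimeChains.

(** * The Hilbert basis and Krull intersection theorems *)

Section IdealSpan.
Variable R : comNzRingType.

Definition ideal_span k (g : 'I_k -> R) : ideal R :=
  submodule_span (V := R^o) (fun x => exists i, x = g i).

Lemma ideal_spanP k (g : 'I_k -> R) x :
  x \in ideal_span g <-> exists c : 'I_k -> R, x = \sum_i c i * g i.
Proof. exact: (spansP (V := R^o)). Qed.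

Lemma ideal_span_mem k (g : 'I_k -> R) i : g i \in ideal_span g.
Proof. by apply: mem_submodule_span; exists i. Qed.

Lemma ideal_span_min k (g : 'I_k -> R) (J : ideal R) :
  (forall i, g i \in J) -> {subset ideal_span g <= J}.
Proof. by move=> gJ; apply: submodule_span_min => _ [i ->]. Qed.

Lemma finitely_generated_sum (A B : ideal R) : finitely_generated A ->
  finitely_generated B -> finitely_generated (submodule_sum A B).
Proof.
move=> [s As] [t Bt]; exists (s ++ t) => x; apply/idP/idP.
  apply: submodule_sum_min => {}x; rewrite ?As ?Bt;
    apply: submodule_span_min => y ys; apply: mem_submodule_span;
    by rewrite mem_cat ys ?orbT.
apply: submodule_span_min => y; rewrite mem_cat => /orP[ys|yt].
  by apply: submodule_sum_l; rewrite As; apply: mem_submodule_span.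
by apply: submodule_sum_r; rewrite Bt; apply: mem_submodule_span.
Qed.

Lemma finitely_generated_span k (g : 'I_k -> R) : finitely_generated (ideal_span g).
Proof. by apply/finitely_generatedP; exists k, g. Qed.

End IdealSpan.

Lemma ideal_exp_morph (R S : comNzRingType) (f : {rmorphism R -> S})
    (J : ideal R) (J' : ideal S) n x :
  (forall y, y \in J -> f y \in J') -> x \in ideal_exp J n -> f x \in ideal_exp J' n.
Proof.
move=> fJ; elim: n x => // n IH; apply: ideal_span_ind => [|_ [a [v [aJ vJ ->]]]].
  split=> [|x y xJ yJ|a x xJ]; first by rewrite rmorph0 ideal0.
    by rewrite rmorphD idealD.
  by rewrite -[a *: x]/(a * x) rmorphM ideal_mull.
by rewrite -[a *: v]/(a * v) rmorphM mem_ideal_mul ?fJ ?IH.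
Qed.

Section HilbertBasis.
Variable R : comNzRingType.
Hypothesis noethR : noetherian R.
Variable I : ideal {poly R}.

Definition lead_at n (c : R) : Prop :=
  exists F : {poly R}, [/\ F \in I, (size F <= n.+1)%N & F`_n = c].

Lemma lead_at_is_ideal n : is_ideal (lead_at n).
Proof.
split=> [|_ _ [F [FI sF <-]] [G [GI sG <-]]|a _ [F [FI sF <-]]].
- by exists 0; rewrite ideal0 size_poly0 coef0.
- exists (F + G); split; rewrite ?idealD ?coefD //.
  by apply: leq_trans (size_polyD _ _) _; rewrite geq_max sF.
- exists (a%:P * F); split; rewrite ?ideal_mull ?coefCM //.
  by rewrite mul_polyC; apply: leq_trans (size_scale_leq _ _) sF.
Qed.

Definition lead_ideal n : ideal R := ideal_of (lead_at_is_ideal n).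

Lemma lead_idealP n c : reflect (lead_at n c) (c \in lead_ideal n).
Proof. exact: ideal_ofP. Qed.

Lemma lead_ideal_incr n : {subset lead_ideal n <= lead_ideal n.+1}.
Proof.
move=> c /lead_idealP[F [FI sF <-]]; apply/lead_idealP.
exists (F * 'X); split; rewrite ?ideal_mulr ?coefMX //.
by apply: leq_trans (size_polyMleq _ _) _; rewrite size_polyX addn2.
Qed.

Lemma size_cancel n (F G : {poly R}) : (size F <= n.+1)%N -> (size G <= n.+1)%N ->
  F`_n = G`_n -> (size (F - G)%R <= n)%N.
Proof.
move=> sF sG FG; apply/leq_sizeP => j; rewrite leq_eqVlt => /predU1P[<-|nj].
  by rewrite coefB FG subrr.
by rewrite coefB !nth_default ?subrr // (leq_trans _ nj).
Qed.

Lemma low_degree_finitely_generated n : exists J : ideal {poly R},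
  [/\ finitely_generated J, {subset J <= I}
    & forall F, F \in I -> (size F <= n)%N -> F \in J].
Proof.
elim: n => [|n [J [Jfg JI IJ]]].
  exists (ideal_span (fun i : 'I_0 => 0)); split.
  - exact: finitely_generated_span.
  - by apply: ideal_span_min; case.
  - by move=> F _; rewrite leqn0 size_poly_eq0 => /eqP->; apply: ideal0.
have /finitely_generatedP[k [c Ic]] := noethR (lead_ideal n).
have lift i : exists F : {poly R}, [/\ F \in I, (size F <= n.+1)%N & F`_n = c i].
  by apply/lead_idealP; rewrite Ic; apply: mem_submodule_span; exists i.
pose f i := projT1 (cid (lift i)).
have fI i : f i \in I by case: (projT2 (cid (lift i))).
have sf i : (size (f i) <= n.+1)%N by case: (projT2 (cid (lift i))).
have fc i : (f i)`_n = c i by case: (projT2 (cid (lift i))).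
exists (submodule_sum J (ideal_span f)); split.
- exact/finitely_generated_sum/finitely_generated_span.
- by apply: submodule_sum_min => //; apply: ideal_span_min.
move=> F FI sF; have : F`_n \in lead_ideal n by apply/lead_idealP; exists F.
rewrite Ic => /spansP[d dE]; pose G := \sum_i (d i)%:P * f i.
rewrite -[F](subrK G); apply: mem_submodule_sum; last first.
  by apply/ideal_spanP; exists (fun i => (d i)%:P).
apply: IJ.
  by apply: idealB => //; apply: ideal_sum => i _; apply: ideal_mull.
apply: size_cancel => //.
  apply: leq_trans (size_sum _ _ _) _; apply/bigmax_leqP => i _.
  by rewrite mul_polyC; apply: leq_trans (size_scale_leq _ _) (sf i).
by rewrite dE coef_sum; apply: eq_bigr => i _; rewrite coefCM fc.
Qed.

(** Once the ideals of leading coefficients are stable at [n0], generators for the bounded degrees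
    suffice: the top coefficient of a longer polynomial is that of some [G] of degree at most [n0],
    shifted by a power of the variable. *)
Lemma poly_ideal_finitely_generated : finitely_generated I.
Proof.
have [n0 stab] := noetherian_chain noethR lead_ideal_incr.
have [J [[s Js] JI IJ]] := low_degree_finitely_generated n0.+1.
exists s => F; rewrite -Js; apply/idP/idP => [|/JI//].
have [n] := ubnP (size F); elim: n F => // n IH F; rewrite ltnS => sF FI.
have [sF0|sF0] := leqP (size F) n0.+1; first exact: IJ.
have sFn : size F = (size F).-1.+1 by rewrite prednK // (leq_trans _ sF0).
have n0F : (n0 <= (size F).-1)%N by rewrite -ltnS -sFn ltnW.
have /stab/lead_idealP[G [GI sG GF]] : F`_(size F).-1 \in lead_ideal (size F).-1.
  by apply/lead_idealP; exists F; rewrite -sFn.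
pose H := G * 'X^((size F).-1 - n0).
have HJ : H \in J by apply/ideal_mulr/IJ.
apply: (@idealBl _ _ _ H) (HJ); apply: IH; last by apply: idealB => //; apply: JI.
apply: leq_trans sF; rewrite sFn ltnS; apply: size_cancel.
- by rewrite -sFn.
- apply: leq_trans (size_polyMleq _ _) _; rewrite size_polyXn addnS /=.
  by apply: leq_trans (leq_add sG (leqnn _)) _; rewrite addSn subnKC.
- by rewrite coefMXn ltnNge leq_subr /= subKn.
Qed.

End HilbertBasis.

Theorem hilbert_basis (R : comNzRingType) : noetherian R -> noetherian {poly R}.
Proof. by move=> noethR I; apply: poly_ideal_finitely_generated. Qed.

Section KrullIntersection.
Variables (R : comNzRingType) (m : ideal R).
Hypotheses (noethR : noetherian R) (m_prime : prime_ideal m).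

Lemma pow_intersection_is_ideal : is_ideal (fun x => forall n, x \in ideal_exp m n).
Proof.
split=> [n|x y xm ym n|a x xm n]; first exact: ideal0.
  exact: idealD.
exact: ideal_mull.
Qed.

(** Let [N] be the intersection of the powers, and take [L] maximal with [L] containing [m N] and
    meeting [N] only in [m N]. Each element of [m] has a power in [L], so locally a power of [m],
    and with it [N], lies in [L]. Then [N] is locally [m N], and Nakayama applies. *)
Lemma krull_intersection x : (forall n, x \in ideal_exp m n) ->
  exists2 s, s \notin m & s * x = 0.
Proof.
pose N : ideal R := ideal_of pow_intersection_is_ideal.
have mNN : {subset ideal_mul m N <= N}.
  by apply: ideal_mulP => a y _; apply: ideal_mull.
have [L [[mNL LN] maxL]] := noetherian_maximal noethR
  (F := fun L => {subset ideal_mul m N <= L} /\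
     forall y, y \in L -> y \in N -> y \in ideal_mul m N)
  (I0 := ideal_mul m N) (conj (fun _ => id) (fun _ h _ => h)).
(* When the colon ideals of [L] by the powers of [z] are stable from [i] on, [adjoin L (z ^+ i)]
   still meets [N] only in [m N], so the maximality of [L] puts [z ^+ i] into [L]. *)
have powL z : z \in m -> exists i, z ^+ i \in L.
  move=> zm; have [|i stab] := noetherian_chain noethR (C := fun i => colon L (z ^+ i)).
    by move=> i y /colonP zy; apply/colonP; rewrite exprS -mulrA ideal_mull.
  exists i; apply: (maxL (adjoin L (z ^+ i))) (adjoin_mem _ _); last exact: adjoin_sub.
  split=> [y /mNL/(@adjoin_sub _ L (z ^+ i))//|_ /adjoinP[b [r [bL ->]]] yN].
  apply: (LN _ _ yN); apply: idealD => //; rewrite mulrC; apply/colonP/(stab i.+1)/colonP.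
  have -> : z ^+ i.+1 * r = z * (b + r * z ^+ i) - z * b by rewrite exprS; ring.
  by apply: idealB; [apply/mNL/mem_ideal_mul|apply: ideal_mull].
have [|s [k [sm sk]]] := local_power noethR (J := m) (K := L) m_prime.
  by move=> Q [Qp LQ] _ z /powL[i /LQ/(prime_idealX Qp)].
have [|y yN|t tm tN] := @nakayama _ m N (zero_ideal R) m_prime.
- exact: noethR.
- exists s => //; apply/submodule_sum_l/LN; last exact: ideal_mull.
  by apply: sk; move/ideal_ofP: yN.
by move=> xm; exists t => //; apply/zero_idealP/tN/ideal_ofP.
Qed.

End KrullIntersection.

(** * Integrality tested in a field *)

Section PrimeIdealPack.
Variables (R : comNzRingType) (P : ideal R).
Hypothesis Pp : prime_ideal P.

Lemma prime_ideal_idealr_closed : idealr_closed (submodule_pred P).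
Proof.
split; [exact: ideal0|by case: Pp|move=> a x y xP yP].
by apply: idealD => //; apply: ideal_mull.
Qed.

Definition prime_idealr_of : prime_idealr R :=
  HB.pack_for (prime_idealr R) (submodule_pred P)
    (isIdealr.Build R (submodule_pred P) prime_ideal_idealr_closed)
    (isPrimeIdealrClosed.Build R (submodule_pred P) Pp.2).

Lemma prime_idealr_ofE x : (x \in prime_idealr_of) = (x \in P).
Proof. by []. Qed.

End PrimeIdealPack.

Section DomainQuotient.
Variables (R : comNzRingType) (P : prime_idealr R).

(** A separate name for the quotient ring, to carry the domain structure from which its fraction
    field is formed. *)
Definition domain_quot := {ideal_quot P}.
HB.instance Definition _ := GRing.ComNzRing.on domain_quot.

Definition domain_unit : pred domain_quot := fun x => `[< exists y, y * x = 1 >].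
Definition domain_inv (x : domain_quot) : domain_quot :=
  if pselect (exists y, y * x = 1) is left h then projT1 (cid h) else x.

Lemma domain_mulVx : {in domain_unit, left_inverse 1 domain_inv *%R}.
Proof.
move=> x /asboolP xu; rewrite /domain_inv; case: pselect => // h.
exact: projT2 (cid h).
Qed.

Lemma domain_unitPl x y : y * x = 1 -> domain_unit x.
Proof. by move=> yx; apply/asboolP; exists y. Qed.

Lemma domain_inv_out : {in [predC domain_unit], domain_inv =1 id}.
Proof.
by move=> x /asboolPn xu; rewrite /domain_inv; case: pselect.
Qed.

HB.instance Definition _ := GRing.ComNzRing_hasMulInverse.Build domain_quot
  domain_mulVx domain_unitPl domain_inv_out.
HB.instance Definition _ := GRing.ComUnitRing_isIntegral.Build domain_quot
  (@Quotient.rquot_IdomainAxiom R P).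

End DomainQuotient.

Lemma residue_field (R : comNzRingType) (P : ideal R) : prime_ideal P ->
  exists (K : fieldType) (phi : {rmorphism R -> K}), forall x, (phi x == 0) = (x \in P).
Proof.
move=> Pp; pose D := domain_quot (prime_idealr_of Pp).
pose f : {rmorphism R -> D} :=
  \pi_({ideal_quot (prime_idealr_of Pp)})%qT.
exists {fraction D}, (@tofrac D \o f) => x /=.
rewrite tofrac_eq0 -[x in RHS]subr0 -(prime_idealr_ofE Pp) Quotient.idealrBE.
by congr (_ == _); rewrite -[LHS](rmorph0 f).
Qed.

Section FractionAlgebra.
Variables (A : comNzRingType) (K : fieldType) (phi : {rmorphism A -> K}).

(* The ideal generated by phi(J)/v in the ring phi(A)[phi(J)/v]. *)
Inductive frac_ideal (v : K) (J : ideal A) : K -> Prop :=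
| frac_ideal0 : frac_ideal v J 0
| frac_ideal_gen j : j \in J -> frac_ideal v J (phi j / v)
| frac_idealD x y : frac_ideal v J x -> frac_ideal v J y -> frac_ideal v J (x + y)
| frac_idealZ a x : frac_ideal v J x -> frac_ideal v J (phi a * x)
| frac_idealM x y : frac_ideal v J x -> frac_ideal v J y -> frac_ideal v J (x * y).

(* With v = phi u: after localizing at n, u is not integral over J modulo the
   kernel of phi. *)
Definition separated (n : ideal A) (v : K) (J : ideal A) : Prop :=
  forall c, c \notin n -> ~ frac_ideal v J (phi c).

Lemma frac_idealN v J x : frac_ideal v J x -> frac_ideal v J (- x).
Proof. by move=> /(frac_idealZ (-1)); rewrite rmorphN1 mulN1r. Qed.

Lemma frac_idealB v J x y :
  frac_ideal v J x -> frac_ideal v J y -> frac_ideal v J (x - y).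
Proof. by move=> xJ /frac_idealN; apply: frac_idealD. Qed.

Lemma frac_ideal_sum v J (T : Type) (r : seq T) (F : T -> K) :
  (forall i, frac_ideal v J (F i)) -> frac_ideal v J (\sum_(i <- r) F i).
Proof.
move=> FJ; elim/big_rec: _ => [|i x _ xJ]; first exact: frac_ideal0.
exact: frac_idealD.
Qed.

Lemma kernel_is_ideal : is_ideal (fun x => phi x = 0).
Proof.
split=> [|x y x0 y0|a x x0]; first exact: rmorph0.
  by rewrite rmorphD x0 y0 addr0.
by rewrite -[a *: x]/(a * x) rmorphM x0 mulr0.
Qed.

Definition kernel : ideal A := ideal_of kernel_is_ideal.

Lemma kernelP x : reflect (phi x = 0) (x \in kernel).
Proof. exact: ideal_ofP. Qed.

Lemma kernel_prime : prime_ideal kernel.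
Proof.
apply: prime_ideal_intro => [|a b /kernelP/eqP ab0 /kernelP/eqP a0].
  by apply/kernelP/eqP; rewrite rmorph1 oner_eq0.
by apply/kernelP/eqP; move: ab0; rewrite rmorphM mulf_eq0 (negPf a0).
Qed.

(* Powers of u and s clear the denominators of the elements of frac_ideal. *)
Lemma separated_divisible (n q J : ideal A) (u s : A) : prime_ideal n ->
  prime_ideal q -> {subset kernel <= q} -> {subset q <= n} -> u \notin q ->
  s \notin n -> (forall j, j \in J -> exists2 b, b \in n & s * j - u * b \in q) ->
  separated n (phi u) J.
Proof.
move=> np qp kerq qn uq sn Jdiv c cn cJ.
have u0 : phi u != 0 by apply: contraNneq uq => u0; apply/kerq/kernelP.
have: exists N w k b, [/\ phi u ^+ N * phi c = phi w, b \in n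
    & s ^+ k * w - u ^+ N * b \in q].
  move: (phi c) cJ => y; elim=> {y} [|j jJ|x y _ [N1 [w1 [k1 [b1 [E1 b1n q1]]]]]
     _ [N2 [w2 [k2 [b2 [E2 b2n q2]]]]]|a x _ [N [w [k [b [E bn qb]]]]]|
     x y _ [N1 [w1 [k1 [b1 [E1 b1n q1]]]]]
     _ [N2 [w2 [k2 [b2 [E2 b2n q2]]]]]].
  - by exists 0%N, 0, 0%N, 0; rewrite mulr0 rmorph0 !mulr0 subrr !ideal0.
  - have [b bn qb] := Jdiv j jJ; exists 1%N, j, 1%N, b.
    by rewrite !expr1 mulrC divfK.
  - exists (N1 + N2)%N, (u ^+ N2 * w1 + u ^+ N1 * w2), (k1 + k2)%N,
      (s ^+ k2 * b1 + s ^+ k1 * b2); split.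
    + by rewrite rmorphD !rmorphM !rmorphXn /= -E1 -E2 exprD; ring.
    + by rewrite idealD ?ideal_mull.
    + have -> : s ^+ (k1 + k2) * (u ^+ N2 * w1 + u ^+ N1 * w2) -
          u ^+ (N1 + N2) * (s ^+ k2 * b1 + s ^+ k1 * b2) =
          s ^+ k2 * u ^+ N2 * (s ^+ k1 * w1 - u ^+ N1 * b1) +
          s ^+ k1 * u ^+ N1 * (s ^+ k2 * w2 - u ^+ N2 * b2) by rewrite !exprD; ring.
      by rewrite idealD ?ideal_mull.
  - exists N, (a * w), k, (a * b); split; last 2 [exact: ideal_mull].
    + by rewrite rmorphM -E mulrCA.
    + have -> : s ^+ k * (a * w) - u ^+ N * (a * b) = a * (s ^+ k * w - u ^+ N * b).
        by ring.
      exact: ideal_mull.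
  - exists (N1 + N2)%N, (w1 * w2), (k1 + k2)%N, (b1 * b2); split.
    + by rewrite rmorphM -E1 -E2 exprD mulrACA.
    + exact: ideal_mull.
    + have -> : s ^+ (k1 + k2) * (w1 * w2) - u ^+ (N1 + N2) * (b1 * b2) =
          s ^+ k2 * w2 * (s ^+ k1 * w1 - u ^+ N1 * b1) +
          u ^+ N1 * b1 * (s ^+ k2 * w2 - u ^+ N2 * b2) by rewrite !exprD; ring.
      by rewrite idealD ?ideal_mull.
move=> [N [w [k [b [E bn qb]]]]].
have: u ^+ N * (s ^+ k * c - b) \in q.
  have -> : u ^+ N * (s ^+ k * c - b) =
      s ^+ k * (u ^+ N * c - w) + (s ^+ k * w - u ^+ N * b) by ring.
  rewrite idealD ?ideal_mull //; apply/kerq/kernelP.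
  by rewrite rmorphB rmorphM rmorphXn E subrr.
(* Since [u] is outside [q], the element [s ^+ k * c] is congruent to [b] modulo [q] and so lies in
   [n], although neither [s] nor [c] does. *)
move=> /(prime_idealM qp)[/(prime_idealX qp)|/qn/idealBl/(_ bn)]; first exact/negP.
by apply/negP/prime_idealMn => //; apply: prime_idealXn.
Qed.

Lemma separated_kernel_sub n v J : separated n v J -> {subset kernel <= n}.
Proof.
move=> sep x /kernelP x0; apply: contrapT => /negP/sep; rewrite x0; apply.
exact: frac_ideal0.
Qed.

Hypothesis noethA : noetherian A.

(** If [n] were not minimal over [adjoin q u], there would be [y] in [n] outside all minimal primes
    of [adjoin q u]. Take [P] inside [n] minimal over [adjoin q y]. If [u] is in [P], a minimal
    prime of [adjoin q u] lies strictly between [q] and [P], against the principal ideal theorem for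
    [y]; if not, the maximality of [q] puts [y] into [q]. *)
Lemma maximal_avoiding_prime (p n : ideal A) (u : A) : prime_ideal p ->
  prime_ideal n -> {subset p <= n} -> u \notin p -> u \in n ->
  exists q, [/\ prime_over p q, {subset q <= n}, u \notin q
    & minimal_over (adjoin q u) n].
Proof.
move=> pp np pn up un.
have [q [[qp pq qn uq] maxq]] := noetherian_maximal noethA
  (F := fun q => [/\ prime_ideal q, {subset p <= q}, {subset q <= n} & u \notin q])
  (I0 := p) (And4 pp (fun _ => id) pn up).
exists q; split=> //; split; first by split=> //; apply: adjoin_min.
move=> Q [Qp qQ] Qn; apply: contrapT => nQ.
have [k [F [minF coverF anti]]] := minimal_primes noethA (adjoin q u).
have [i|i|//|y yn yF] := prime_avoidance (J := n) (F := F).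
- by case: (minF i) => -[].
- move=> nFi; apply: nQ => x xn; case: (minF i) => _ /(_ Q); apply; last exact: nFi.
    by split.
  by move=> z /Qn/nFi.
have [P minP Pn] : exists2 P, minimal_over (adjoin q y) P & {subset P <= n}.
  by apply: minimal_over_exists => //; split=> //; apply: adjoin_min.
have [[Pp qyP] _] := minP.
have yP : y \in P by apply/qyP/adjoin_mem.
have qP : {subset q <= P} by move=> x /(@adjoin_sub _ q y)/qyP.
have [uP|uP] := boolP (u \in P).
  have [|i FiP] := coverF P; first by split=> //; apply: adjoin_min.
  have [[Fp quF] _] := minF i.
  apply: (principal_ideal_theorem noethA qp Fp _ _ FiP _ minP).
  - by move=> x /(@adjoin_sub _ q u)/quF.
  - by move=> /(_ u (quF u (adjoin_mem q u))); apply/negP.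
  - by move=> /(_ y yP); apply/negP.
have yq : y \in q by apply: (maxq P) yP => //; split=> // x /pq/qP.
have [|i FiQ] := coverF n; first by split=> //; apply: adjoin_min.
by case/negP: (yF i); case: (minF i) => -[_ +] _; apply; apply: adjoin_sub.
Qed.

(** The case without generators, which ends the induction of [separated_pow]; [J0] serves to place
    the kernel inside [n]. *)
Lemma separated_pow_base (n : ideal A) (u : A) (J0 : ideal A) : prime_ideal n ->
  phi u != 0 -> separated n (phi u) J0 ->
  exists t, separated n (phi u) (ideal_exp n t).
Proof.
move=> np u0 /separated_kernel_sub kern.
have uker : u \notin kernel by apply/kernelP/eqP.
have [un|un] := boolP (u \in n); last first.
  (* Here [u] is invertible at [n]: with [u] itself as the multiplier, each [j] in [n] is its own
     quotient. *)
  exists 1%N; apply: (separated_divisible (s := u) np kernel_prime) => // j.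
  by rewrite ideal_exp1 => jn; exists j; rewrite // subrr ideal0.
have [q [[qp kerq] qn uq minn]] := maximal_avoiding_prime kernel_prime np kern uker un.
have [|s [N [sn sN]]] := local_power noethA (J := n) (K := adjoin q u) np.
  by case: minn.
(* The power [N] makes an element, up to [s], a multiple of [u] modulo [q]; the one remaining factor
   from [n] puts the quotient into [n]. *)
exists N.+1; apply: (separated_divisible (s := s) np qp) => //.
apply: ideal_span_ind => [|_ [a [v [an vN ->]]]].
  split=> [|x y [b bn xb] [c cn yc]|a x [b bn xb]].
  - by exists 0; rewrite ?ideal0 // !mulr0 subrr ideal0.
  - exists (b + c); first exact: idealD.
    have -> : s * (x + y) - u * (b + c) = (s * x - u * b) + (s * y - u * c) by ring.
    exact: idealD.
  - exists (a * b); first exact: ideal_mull.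
    have -> : s * (a *: x) - u * (a * b) = a * (s * x - u * b).
      by rewrite -[a *: x]/(a * x); ring.
    exact: ideal_mull.
have /adjoinP[b [c [bq sv]]] := sN v vN.
exists (a * c); first exact: ideal_mulr.
have -> : s * (a *: v) - u * (a * c) = a * (s * v - c * u).
  by rewrite -[a *: v]/(a * v); ring.
by rewrite sv addrK ideal_mull.
Qed.

End FractionAlgebra.

Lemma separated_sub (A : comNzRingType) (K : fieldType) (phi : {rmorphism A -> K})
    n v (J J' : ideal A) : {subset J <= J'} ->
  separated phi n v J' -> separated phi n v J.
Proof.
move=> JJ' sep c /sep cJ' cJ; apply: cJ'; elim: cJ => {c} [|j /JJ'|x y _ xJ _|a x _|x y _ xJ _].
- exact: frac_ideal0.
- exact: frac_ideal_gen.
- exact: frac_idealD.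
- exact: frac_idealZ.
- exact: frac_idealM.
Qed.

(* Adjoining the fraction g_0 / u to the ring as the image of a polynomial
   variable removes the generator g_0 of the ideal. *)
Lemma separated_pow (A : comNzRingType) (K : fieldType) (phi : {rmorphism A -> K})
    k (g : 'I_k -> A) (n : ideal A) (u : A) : noetherian A -> prime_ideal n ->
  phi u != 0 -> separated phi n (phi u) (ideal_span g) ->
  exists t, separated phi n (phi u) (submodule_sum (ideal_span g) (ideal_exp n t)).
Proof.
elim: k A phi g n u => [|k IH] A phi g n u noethA np u0 sep.
  have [t sept] := separated_pow_base noethA np u0 sep.
  exists t; apply: separated_sub sept; apply: submodule_sum_min => //.
  by apply: ideal_span_min; case.
pose v := phi u; pose z := phi (g ord0) / v.
pose psi : {rmorphism {poly A} -> K} := horner_eval z \o map_poly phi.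
have psiC a : psi a%:P = phi a by rewrite /= map_polyC /horner_eval hornerC.
have psiX : psi 'X = z by rewrite /= map_polyX /horner_eval hornerX.
(* The prime generated by [n] and the variable: the fraction [z], which is [psi 'X], then comes from
   an element of the new prime. *)
pose n'_pred (F : {poly A}) := F`_0 \in n.
have n'_ideal : is_ideal n'_pred.
  rewrite /n'_pred; split=> [|F G Fn Gn|a F Fn]; first by rewrite coef0 ideal0.
    by rewrite coefD idealD.
  by rewrite -[a *: F]/(a * F) coef0M ideal_mull.
pose n' := ideal_of n'_ideal.
have n'P F : (F \in n') = (F`_0 \in n) by apply/(ideal_ofP n'_ideal)/idP.
have n'p : prime_ideal n'.
  apply: prime_ideal_intro => [|F G]; rewrite !n'P; first by rewrite coef1; case: np.
  by rewrite coef0M => /(prime_idealM np)[->|].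
pose g' i := (g (lift ord0 i))%:P.
(* As [z] belongs to the fraction ideal, evaluation at [z] agrees with the constant term up to that
   ideal. *)
have psi_coef0 F : exists2 f, frac_ideal phi v (ideal_span g) f & psi F = phi F`_0 + f.
  elim/poly_ind: F => [|F c [f fI E]].
    by exists 0; [apply: frac_ideal0|rewrite coef0 !rmorph0 addr0].
  exists (phi F`_0 * z + f * z).
    have zI : frac_ideal phi v (ideal_span g) z by apply/frac_ideal_gen/ideal_span_mem.
    by apply: frac_idealD; [apply: frac_idealZ|apply: frac_idealM].
  rewrite rmorphD rmorphM psiX psiC E coefD coefMX coefC /= add0r.
  by rewrite mulrDl addrC.
have descend y : frac_ideal psi v (ideal_span g') y -> frac_ideal phi v (ideal_span g) y.
  elim=> {y} [|j /ideal_spanP[c ->]|x y _ xI _|F x _ xI|x y _ xI _].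
  - exact: frac_ideal0.
  - rewrite rmorph_sum mulr_suml; apply: frac_ideal_sum => i.
    have [f fI E] := psi_coef0 (c i); rewrite rmorphM E psiC mulrDl mulrDl -!mulrA.
    have gI : frac_ideal phi v (ideal_span g) (phi (g (lift ord0 i)) / v).
      by apply/frac_ideal_gen/ideal_span_mem.
    by apply: frac_idealD; [apply: frac_idealZ|apply: frac_idealM].
  - exact: frac_idealD.
  - have [f fI ->] := psi_coef0 F; rewrite mulrDl.
    by apply: frac_idealD; [apply: frac_idealZ|apply: frac_idealM].
  - exact: frac_idealM.
have [||||t sept] := IH {poly A} psi g' n' u%:P.
- exact: hilbert_basis.
- exact: n'p.
- by rewrite psiC.
- move=> F; rewrite n'P psiC => /sep nF /descend; have [f fI ->] := psi_coef0 F.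
  by move=> /frac_idealB/(_ fI); rewrite addrK.
exists t => c cn cI; rewrite psiC -/v in sept.
pose J' := submodule_sum (ideal_span g') (ideal_exp n' t).
(* The generator [g ord0] over [u] is the image of the variable, so its multiples go into [F]; the
   other generators and the power of [n] go into [f]. *)
have: exists f F, [/\ frac_ideal psi v J' f, F \in n' & phi c = f + psi F].
  move: (phi c) cI => y; elim=> {y}
    [|j /asboolP[_ [w [/ideal_spanP[d ->] wn ->]]]
     |x y _ [f [F [fJ Fn ->]]] _ [h [H [hJ Hn ->]]]|a x _ [f [F [fJ Fn ->]]]
     |x y _ [f [F [fJ Fn ->]]] _ [h [H [hJ Hn ->]]]].
  - by exists 0, 0; split; [apply: frac_ideal0|apply: ideal0|rewrite rmorph0 addr0].
  - exists (psi (\sum_i (d (lift ord0 i))%:P * g' i + w%:P) / v), ((d ord0)%:P * 'X).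
    split.
    + apply/frac_ideal_gen/mem_submodule_sum.
        by apply/ideal_spanP; exists (fun i => (d (lift ord0 i))%:P).
      apply: ideal_exp_morph wn => x xn; by rewrite n'P coefC.
    + by rewrite n'P coefMX ideal0.
    + have E : psi (\sum_i (d (lift ord0 i))%:P * g' i) =
          phi (\sum_i d (lift ord0 i) * g (lift ord0 i)).
        by rewrite !rmorph_sum; apply: eq_bigr => i _; rewrite !rmorphM !psiC.
      rewrite (rmorphD psi) (rmorphM psi) psiX !psiC E big_ord_recl /z.
      by rewrite 2!(rmorphD phi) (rmorphM phi); ring.
  - exists (f + h), (F + H); split; [exact: frac_idealD|exact: idealD|].
    by rewrite rmorphD addrACA.
  - exists (psi a%:P * f), (a%:P * F); split; [exact: frac_idealZ|exact: ideal_mull|].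
    by rewrite rmorphM psiC mulrDr.
  - exists (f * h + (psi F * h + psi H * f)), (F * H); split.
    + apply: frac_idealD; first exact: frac_idealM.
      by apply: frac_idealD; apply: frac_idealZ.
    + exact: ideal_mull.
    + by rewrite rmorphM; ring.
(* Since [c] is outside [n] and [F] is in [n'], the polynomial [c%:P - F] is outside [n'], yet its
   image is [f]. *)
move=> [f [F [fJ Fn E]]]; apply: (sept (c%:P - F)).
  by rewrite n'P coefB coefC /=; apply/negP => /idealBl; rewrite -n'P => /(_ Fn); apply/negP.
by rewrite rmorphB psiC E addrK.
Qed.

(** * Complete rings *)

Section CohenTheorem.
Variables (A : comNzRingType) (J : ideal A).
Hypothesis prime_fg : forall Q, prime_over J Q -> finitely_generated Q.

Let bad (I : ideal A) : Prop := {subset J <= I} /\ ~ finitely_generated I.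

(* The empty set is admitted because Zorn's lemma also tests the empty chain. *)
Let bad_set (X : A -> Prop) : Prop :=
  (forall x, ~ X x) \/ exists2 I, bad I & forall x, X x <-> x \in I.

(** If the union of the chain were finitely generated, one member would contain all the generators
    and equal the union. *)
Lemma bad_set_bigcup (F : (A -> Prop) -> Prop) :
  classical_sets.subset F bad_set -> classical_sets.total_on F classical_sets.subset ->
  bad_set (classical_sets.bigcup F id).
Proof.
move=> Fbad Ftot.
have [[X [FX [x0 Xx0]]]|noX] := pselect (exists X, F X /\ exists x, X x); last first.
  by left=> x [X FX Xx]; apply: noX; exists X; split=> //; exists x.
pose U x := exists2 X, F X & X x.
have directed Y Z : F Y -> F Z ->
    exists W, [/\ F W, forall x, Y x -> W x & forall x, Z x -> W x].
  by move=> FY FZ; case: (Ftot Y Z FY FZ) => sub; [exists Z|exists Y].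
have member Y y : F Y -> Y y -> exists2 I, bad I & forall x, Y x <-> x \in I.
  by move=> FY Yy; case: (Fbad Y FY) => // /(_ y).
have U_ideal : is_ideal U.
  split=> [|x y [Y FY Yx] [Z FZ Zy]|a x [Y FY Yx]].
  - have [I _ XI] := member X x0 FX Xx0.
    by exists X => //; apply/XI/ideal0.
  - have [W [FW YW ZW]] := directed Y Z FY FZ.
    have [I _ WI] := member W x FW (YW x Yx).
    by exists W => //; apply/WI; rewrite idealD //; apply/WI; [apply: YW|apply: ZW].
  - have [I _ YI] := member Y x FY Yx.
    by exists Y => //; apply/YI/ideal_mull/YI.
right; exists (ideal_of U_ideal); last by move=> x; split=> /(ideal_ofP U_ideal).
split=> [x xJ|].
  have [I [JI _] XI] := member X x0 FX Xx0.
  by apply/ideal_ofP; exists X => //; apply/XI/JI.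
move=> /finitely_generatedP[k [g Ug]].
have [Y [FY XY gY]] : exists Y, [/\ F Y, forall x, X x -> Y x & forall i, Y (g i)].
  have gU i : U (g i).
    by apply/(ideal_ofP U_ideal); rewrite Ug; apply: mem_submodule_span; exists i.
  elim: k g gU {Ug} => [|k IH] g gU.
    by exists X; split=> // -[].
  have [Y [FY XY gY]] := IH (fun i => g (lift ord0 i)) (fun i => gU _).
  have [Z FZ Zg] := gU ord0; have [W [FW YW ZW]] := directed Y Z FY FZ.
  exists W; split=> // [x /XY/YW//|i].
  by case: (unliftP ord0 i) => [j|] ->; [apply/YW/gY|apply: ZW].
have [I [_ Ifg] YI] := member Y x0 FY (XY x0 Xx0).
apply: Ifg; apply/finitely_generatedP; exists k, g => x; apply/idP/idP => [/YI Yx|].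
  by rewrite -Ug; apply/ideal_ofP; exists Y.
by move: x; apply: submodule_span_min => _ [i ->]; apply/YI.
Qed.

(** The form relative to [J] is the one that the induction for complete rings calls for. A maximal
    bad ideal [N] is prime: if [a * b] is in [N] with both factors outside, then [adjoin N a] and
    [colon N a] are finitely generated, and the [N]-parts of generators of the first together with
    [a] times generators of the second generate [N]. *)
Theorem cohen (I : ideal A) : {subset J <= I} -> finitely_generated I.
Proof.
move=> JI; apply: contrapT => Ifg.
have [X [Xbad Xmax]] := classical_sets.Zorn_bigcup bad_set_bigcup.
have [N [JN Nfg] XN] : exists2 N, bad N & forall x, X x <-> x \in N.
  case: Xbad => // X0; case: (Xmax (fun x => x \in I)); last by right; exists I.
  by split=> [x /X0//|/(_ 0 (ideal0 I))/X0].
have maxN a : a \notin N -> forall K : ideal A, {subset N <= K} -> a \in K ->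
    finitely_generated K.
  move=> aN K NK aK; apply: contrapT => Kfg.
  apply: (Xmax (fun x => x \in K)); last by right; exists K => //; split=> // x /JN/NK.
  by split=> [x /XN/NK//|/(_ a aK)/XN]; apply/negP.
apply: (Nfg); apply: prime_fg; split=> //; apply: prime_ideal_intro => [|a b abN aN].
  apply/negP => N1; apply: Nfg; exists [:: 1] => x; rewrite ideal_one //.
  by apply/esym/(ideal_one (I := submodule_span _))/mem_submodule_span/mem_head.
apply: contrapT => /negP bN.
have [|s Ns] := maxN a aN (adjoin N a) (@adjoin_sub _ N a); first exact: adjoin_mem.
have colonN : {subset N <= colon N a} by move=> x xN; apply/colonP/ideal_mull.
have [|t Ct] := maxN b bN (colon N a) colonN; first exact/colonP.
have dec c : exists nr : A * A, c \in s -> nr.1 \in N /\ c = nr.1 + nr.2 * a.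
  have [cs|] := boolP (c \in s); last by exists (0, 0).
  have /adjoinP[d [r [dN E]]] : c \in adjoin N a.
    by rewrite Ns; apply: mem_submodule_span.
  by exists (d, r).
pose n c := (projT1 (cid (dec c))).1; pose r c := (projT1 (cid (dec c))).2.
have nr c : c \in s -> n c \in N /\ c = n c + r c * a := projT2 (cid (dec c)).
apply: Nfg; exists (map n s ++ map ( *%R a) t) => x.
set G := submodule_span _; apply/idP/idP; last first.
  move: x; apply: submodule_span_min => x; rewrite mem_cat => /orP[/mapP[c cs ->]|].
    by case: (nr c cs).
  move=> /mapP[c ct ->]; apply/colonP; rewrite Ct; exact: mem_submodule_span.
have nG c : c \in s -> n c \in G.
  by move=> cs; apply: mem_submodule_span; rewrite mem_cat map_f.
have atG y : y \in colon N a -> a * y \in G.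
  rewrite Ct => yt; apply/colonP; move: y yt; apply: submodule_span_min => c ct.
  by apply/colonP/mem_submodule_span; rewrite mem_cat map_f ?orbT.
have split_s y : y \in adjoin N a -> exists2 d, y - d * a \in G & y - d * a \in N.
  rewrite Ns; move: y; apply: ideal_span_ind => [|c cs].
    split=> [|y z [d dG dN] [e eG eN]|b' y [d dG dN]].
    - by exists 0; rewrite mul0r subrr ideal0.
    - by exists (d + e); rewrite mulrDl opprD addrACA idealD.
    - by exists (b' * d); rewrite -[b' *: y]/(b' * y) -mulrA -mulrBr ideal_mull.
  have [ncN E] := nr c cs; have rE : c - r c * a = n c by rewrite {1}E addrK.
  by exists (r c); rewrite rE //; apply: nG.
move=> xN; have [d dG dN] := split_s x (@adjoin_sub _ N a x xN).
rewrite -[x](subrK (d * a)) idealD // mulrC; apply/atG/colonP; rewrite mulrC.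
exact: idealBr dN xN.
Qed.

End CohenTheorem.

(** * Noetherianity of complete filtered rings *)

Section CompleteFiltration.
Variables (R A : comNzRingType) (iota : {rmorphism R -> A}).
Variables (m : ideal R) (fil : nat -> ideal A).
Hypotheses (noethR : noetherian R)
  (R_unit : forall a, a \notin m -> exists b, a * b = 1)
  (m_proper : 1 \notin m)
  (iota_fil : forall n a, (iota a \in fil n) = (a \in ideal_exp m n))
  (fil_dec : forall n, {subset fil n.+1 <= fil n})
  (fil_approx : forall n x, exists a, x - iota a \in fil n)
  (fil_sep : forall x, (forall n, x \in fil n) -> x = 0)
  (fil_complete : forall z : nat -> A, (forall n, z n \in fil n) ->
     exists s, forall n, s - \sum_(i < n) z i \in fil n).

Lemma fil0 x : x \in fil 0.
Proof.
have [a xa] := fil_approx 0 x.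
by apply: idealBl xa _; rewrite iota_fil.
Qed.

(** Modulo [fil (i + j)] both factors are images of elements of R, where the claim is about powers
    of [m]. *)
Lemma filM i j x y : x \in fil i -> y \in fil j -> x * y \in fil (i + j).
Proof.
move=> xi yj; have [a xa] := fil_approx (i + j) x.
have [b yb] := fil_approx (i + j) y.
have fil_le k l z : (k <= l)%N -> z \in fil l -> z \in fil k.
  by move=> kl; apply: descending_le kl z.
have ai : a \in ideal_exp m i.
  by rewrite -iota_fil; apply: idealBr xi; apply: fil_le xa; apply: leq_addr.
have bj : b \in ideal_exp m j.
  by rewrite -iota_fil; apply: idealBr yj; apply: fil_le yb; apply: leq_addl.
have -> : x * y = (x - iota a) * y + iota a * (y - iota b) + iota (a * b).
  by rewrite rmorphM; ring.
rewrite idealD ?iota_fil ?ideal_expD //.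
by apply: idealD; [apply: ideal_mulr|apply: ideal_mull].
Qed.

Lemma filX n x : x \in fil 1 -> x ^+ n \in fil n.
Proof.
move=> x1; elim: n => [|n IH]; first exact: fil0.
by rewrite exprS -add1n filM.
Qed.

(** [Z n] describes the remainder after [n] corrections. The n-th correction has coefficients in
    [fil n], so the coefficients sum up to limits, and the combination with these limits differs
    from [z] by an element of every [fil n]. *)
Lemma successive_approximation k (f : 'I_k -> A) (Z : nat -> A -> Prop) :
  (forall n z, Z n z -> z \in fil n) ->
  (forall n z, Z n z ->
     exists2 c : 'I_k -> A, forall i, c i \in fil n & Z n.+1 (z - \sum_i c i * f i)) ->
  forall z, Z 0%N z -> z \in ideal_span f.
Proof.
move=> Zfil Zstep z Z0.
(* Choice needs coefficients for every [w]; outside [Z n] they are set to 0. *)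
have step n w : exists c : 'I_k -> A, Z n w ->
    (forall i, c i \in fil n) /\ Z n.+1 (w - \sum_i c i * f i).
  have [Zw|nZw] := pselect (Z n w); last by exists (fun=> 0).
  by have [c cn cZ] := Zstep n w Zw; exists c.
pose next n w := projT1 (cid (step n w)).
pose w := fix w n := if n is n'.+1 then w n' - \sum_i next n' (w n') i * f i else z.
have wZ n : Z n (w n).
  elim: n => [//|n IH] /=; rewrite /next; case: (cid _) => c /= /(_ IH)[_ cZ].
  exact: cZ.
pose c n := next n (w n).
have cfil n i : c n i \in fil n.
  by rewrite /c /next; case: (cid _) => d /= /(_ (wZ n))[].
have wE n : w n = z - \sum_(j < n) \sum_i c j i * f i.
  elim: n => [|n IH]; first by rewrite big_ord0 subr0.
  by rewrite /= {1}IH big_ord_recr /= opprD addrA.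
have lim i := cid (fil_complete (fun n => cfil n i)).
pose y i := projT1 (lim i).
have yfil i n : y i - \sum_(j < n) c j i \in fil n := projT2 (lim i) n.
apply/ideal_spanP; exists y; apply/eqP; rewrite -subr_eq0; apply/eqP/fil_sep => n.
have -> : z - \sum_i y i * f i = w n - \sum_i (y i - \sum_(j < n) c j i) * f i.
  under [in RHS]eq_bigr => i _ do rewrite mulrBl mulr_suml.
  rewrite sumrB exchange_big wE /=; ring.
apply: idealB; first exact/Zfil/wZ.
by apply: ideal_sum => i _; apply: ideal_mulr.
Qed.

Lemma fil1_unit x : x \in fil 1 -> exists y, (1 - x) * y = 1.
Proof.
move=> x1; have [s sE] := fil_complete (fun n => filX n x1).
exists s; apply/eqP; rewrite -subr_eq0; apply/eqP/fil_sep => n.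
have geom : (1 - x) * \sum_(i < n) x ^+ i = 1 - x ^+ n.
  by rewrite -opprB mulNr -subrX1 opprB.
have -> : (1 - x) * s - 1 = (1 - x) * (s - \sum_(i < n) x ^+ i) - x ^+ n.
  by rewrite mulrBr geom; ring.
by rewrite idealB ?ideal_mull ?filX.
Qed.

(** Modulo [fil 1], [x] is the image of a unit of R with inverse [b]; so [x * iota b] is 1 plus an
    element of [fil 1], which the geometric series inverts. *)
Lemma complete_unit x : x \notin fil 1 -> exists y, x * y = 1.
Proof.
move=> x1; have [a xa] := fil_approx 1 x.
have [|b ab] := R_unit (a := a).
  apply: contra x1 => am; apply: idealBl xa _.
  by rewrite iota_fil ideal_exp1.
have [|y yE] := @fil1_unit (- ((x - iota a) * iota b)).
  by rewrite idealN ?ideal_mulr.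
exists (iota b * y); rewrite mulrA -yE; congr (_ * y).
by rewrite opprK mulrBl -rmorphM ab rmorph1 addrC subrK.
Qed.

Lemma fil1_proper : 1 \notin fil 1.
Proof. by rewrite -(rmorph1 iota) iota_fil ideal_exp1. Qed.

Lemma fil1_prime : prime_ideal (fil 1).
Proof.
apply: prime_ideal_intro fil1_proper _ => a b ab /complete_unit[c ac].
by rewrite -[b]mul1r -ac mulrAC mulrC ideal_mull.
Qed.

Lemma prime_sub_fil1 Q : prime_ideal Q -> {subset Q <= fil 1}.
Proof.
move=> [Q1 _] x xQ; apply: contrapT => /negP/complete_unit[y xy].
by case/negP: Q1; rewrite -xy ideal_mulr.
Qed.

Lemma fil1_span k (g : 'I_k -> R) : spans (V := R^o) g m ->
  fil 1 =i ideal_span (fun i => iota (g i)).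
Proof.
move=> mg x; apply/idP/idP; last first.
  move: x; apply: ideal_span_min => i; rewrite iota_fil ideal_exp1 mg.
  exact: ideal_span_mem.
(* The remainder stays one level ahead of the coefficients, because the generators lie in
   [fil 1]. *)
pose Z n z := z \in fil n.+1.
apply: (successive_approximation (Z := Z)) => n z; first exact: fil_dec.
move=> zn; have [a za] := fil_approx n.+2 z.
have : a \in ideal_mul m (ideal_exp m n).
  by rewrite -/(ideal_exp m n.+1) -iota_fil; apply: idealBr zn; apply: fil_dec.
have comm : {subset ideal_mul m (ideal_exp m n) <= ideal_mul (ideal_exp m n) m}.
  by apply: ideal_mulP => b c bm cm; rewrite mulrC; apply: mem_ideal_mul.
move=> /comm/(ideal_mul_spans mg)[c cm aE]; exists (fun i => iota (c i)) => [i|].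
  by rewrite iota_fil.
rewrite /Z; have -> // : \sum_i iota (c i) * iota (g i) = iota a.
by rewrite aE rmorph_sum; apply: eq_bigr => i _; rewrite rmorphM.
Qed.

(** Induction on [zs], with Cohen's theorem relative to [ys]. A prime [Q] that contains [z] falls
    under the induction hypothesis with [z] moved to [ys]. Otherwise [adjoin Q z] does, and the
    [Q]-parts of its generators generate [Q]: modulo them, an element of [Q] is [z] times some
    element, which is again in [Q] by primality, so successive approximation applies. *)
Lemma complete_finitely_generated (zs ys : seq A) (I : ideal A) :
  (forall J : ideal A, {subset ys ++ zs <= J} -> {subset fil 1 <= J}) ->
  {subset zs <= fil 1} -> finitely_generated (fil 1) ->
  {subset ys <= I} -> finitely_generated I.
Proof.
move=> + + fg1; elim: zs ys I => [|z zs IH] ys I gen zsub ysI.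
  (* With no [zs] left, [I] contains [fil 1]; it is either [fil 1] or, containing a unit, the whole
     ring. *)
  have fI : {subset fil 1 <= I} by apply: gen => x; rewrite cats0 => /ysI.
  have [If|] := pselect {subset I <= fil 1}.
    case: fg1 => s fs; exists s => x; rewrite -fs; apply/idP/idP; [exact: If|exact: fI].
  move=> /existsNP[x /not_implyP[xI /negP/complete_unit[y xy]]].
  exists [:: 1] => u; rewrite ideal_one; last by rewrite -xy ideal_mulr.
  by apply/esym/(ideal_one (I := submodule_span _))/mem_submodule_span/mem_head.
have z1 : z \in fil 1 by apply/zsub/mem_head.
have fgz (K : ideal A) : {subset ys <= K} -> z \in K -> finitely_generated K.
  move=> ysK zK; apply: (IH (rcons ys z)) => [J|x xzs|x].
  - by rewrite cat_rcons; apply: gen.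
  - by apply: zsub; rewrite inE xzs orbT.
  - by rewrite mem_rcons inE => /predU1P[->|/ysK].
apply: (@cohen _ (submodule_span (V := A^o) (fun x => x \in ys))); last first.
  exact: submodule_span_min.
move=> Q [Qp ysQ]; have {ysQ} ysQ : {subset ys <= Q}.
  by move=> y yys; apply: ysQ; apply: mem_submodule_span.
have [zQ|zQ] := boolP (z \in Q); first exact: fgz.
have /finitely_generatedP[k [t Qt]] : finitely_generated (adjoin Q z).
  by apply: fgz (adjoin_mem _ _) => y /ysQ; apply: adjoin_sub.
have dec i : exists qc : A * A, qc.1 \in Q /\ t i = qc.1 + qc.2 * z.
  have /adjoinP[q [c [qQ E]]] : t i \in adjoin Q z by rewrite Qt; apply: ideal_span_mem.
  by exists (q, c).
pose q i := (projT1 (cid (dec i))).1; pose c i := (projT1 (cid (dec i))).2.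
have qQ i : q i \in Q by case: (projT2 (cid (dec i))).
have tE i : t i = q i + c i * z by case: (projT2 (cid (dec i))).
apply/finitely_generatedP; exists k, q => x; apply/idP/idP; last first.
  by move: x; apply: ideal_span_min.
move=> xQ; apply: (successive_approximation
    (Z := fun n w => exists2 h, h \in Q & w = z ^+ n * h)); last first.
- by exists x; rewrite ?mul1r.
- move=> n _ [h hQ ->]; have : h \in adjoin Q z by apply: adjoin_sub.
  rewrite Qt => /ideal_spanP[a hE]; exists (fun i => z ^+ n * a i) => [i|].
    by rewrite ideal_mulr ?filX.
  have E : h - \sum_i a i * q i = z * \sum_i a i * c i.
    rewrite hE -sumrB mulr_sumr; apply: eq_bigr => i _.
    by rewrite tE; ring.
  exists (\sum_i a i * c i).
    have /(prime_idealM Qp)[zQ'|//] : z * \sum_i a i * c i \in Q.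
      rewrite -E idealB //; apply: ideal_sum => i _; exact: ideal_mull.
    by rewrite zQ' in zQ.
  under eq_bigr => i _ do rewrite -mulrA.
  by rewrite -mulr_sumr -mulrBr E exprSr mulrA.
- by move=> n _ [h _ ->]; rewrite ideal_mulr ?filX.
Qed.

Theorem complete_noetherian : noetherian A.
Proof.
move=> I; have /finitely_generatedP[k [g mg]] := noethR m.
have fg := fil1_span mg.
apply: (@complete_finitely_generated (codom (fun i => iota (g i))) [::]) => //.
- move=> J gJ x; rewrite fg; move: x; apply: ideal_span_min => i.
  by apply: gJ; rewrite cat0s codom_f.
- move=> _ /codomP[i ->]; rewrite fg; exact: ideal_span_mem.
- by apply/finitely_generatedP; exists k, (fun i => iota (g i)).
Qed.

End CompleteFiltration.

(** * Local rings and the m-adic completion *)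

Section ProperIdealPack.
Variable R : comNzRingType.

Lemma idealr_submod_closed (I : idealr R) : @submod_closed R R^o (I : {pred R^o}).
Proof.
split=> [|a x y xI yI]; first exact: (rpred0 I).
by apply: (@rpredD _ I) => //; apply: (@idealMr _ I).
Qed.

Definition ideal_of_idealr (I : idealr R) : ideal R :=
  Submodule (idealr_submod_closed I).

Lemma proper_ideal_idealr_closed (I : ideal R) :
  1 \notin I -> idealr_closed (submodule_pred I).
Proof.
move=> I1; split; [exact: ideal0|exact: I1|move=> a x y xI yI].
by apply: idealD => //; apply: ideal_mull.
Qed.

Definition idealr_of (I : ideal R) (I1 : 1 \notin I) : idealr R :=
  HB.pack_for (idealr R) (submodule_pred I)
    (isIdealr.Build R (submodule_pred I) (proper_ideal_idealr_closed I1)).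

Lemma prime_idealr_prime (P : prime_idealr R) : prime_ideal (ideal_of_idealr P).
Proof.
apply: prime_ideal_intro => [|a b]; first by rewrite -[_ \in _]/(1 \in P) idealr1.
by rewrite -[_ \in _]/(a * b \in P) prime_idealrM => /orP[aP /negP[]|].
Qed.

End ProperIdealPack.

Section LocalRing.
Variables (R : comNzRingType) (m : idealr R).
Hypothesis localR : local_ring m.

Let mI := ideal_of_idealr m.

Lemma local_noetherian : noetherian R. Proof. by case: localR. Qed.

Lemma local_proper : 1 \notin mI.
Proof. by rewrite -[_ \in _]/(1 \in m) idealr1. Qed.

Lemma local_unit a : a \notin mI -> exists b, a * b = 1.
Proof.
case: localR => noethR _ uniq am; apply: contrapT => nob.
have [|J [[J1 aJ] maxJ]] := noetherian_maximal noethR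
  (F := fun J => 1 \notin J /\ a \in J) (I0 := principal a).
  split; last by apply/principalP; exists 1; rewrite mul1r.
  by apply/negP => /principalP[b b1]; apply: nob; exists b; rewrite mulrC.
case/negP: am; rewrite -[_ \in _]/(a \in m) -(uniq (idealr_of J1)) // => K JK.
apply: (maxJ (ideal_of_idealr K)) => //; split; last exact: JK.
by rewrite -[_ \in _]/(1 \in K) idealr1.
Qed.

Lemma local_prime : prime_ideal mI.
Proof.
apply: prime_ideal_intro local_proper _ => a b ab /local_unit[c ac].
by rewrite -[b]mul1r -ac mulrAC mulrC ideal_mull.
Qed.

Lemma local_max Q : prime_ideal Q -> {subset Q <= mI}.
Proof.
move=> [Q1 _] x xQ; apply: contrapT => /negP/local_unit[y xy].
by case/negP: Q1; rewrite -xy ideal_mulr.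
Qed.

Lemma local_intersection x : (forall n, x \in ideal_exp mI n) -> x = 0.
Proof.
move=> /(krull_intersection local_noetherian local_prime)[s /local_unit[t st] sx].
by rewrite -[x]mul1r -st mulrAC sx mul0r.
Qed.

End LocalRing.

Section Completion.
Variables (R : comNzRingType) (m : idealr R).

Let mI := ideal_of_idealr m.
Let pi n : R -> {ideal_quot (ideal_pow m n)} := \pi_({ideal_quot (ideal_pow m n)})%qT.

Lemma pi_eq n a b : (pi n a = pi n b) <-> (a - b \in ideal_exp mI n.+1).
Proof.
rewrite -[ideal_exp mI n.+1 : {pred R}]/(ideal_pow m n : {pred R}).
by rewrite Quotient.idealrBE; split=> [/eqP|/eqP].
Qed.

Lemma pi_le i n a b : (i <= n)%N -> pi n a = pi n b -> pi i a = pi i b.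
Proof. by move=> iN /pi_eq ab; apply/pi_eq; apply: ideal_exp_le ab. Qed.

Lemma constant_coherent a : (fun n => pi n a : {ideal_quot _}) \in @coherent R m.
Proof. by apply/asboolP => n; exists a. Qed.

Definition completion_map a : completion m :=
  exist (fun x : residues m => x \in @coherent R m) _ (constant_coherent a).

Lemma completion_map_is_zmod_morphism : zmod_morphism completion_map.
Proof.
move=> a b; apply: val_inj; apply: functional_extensionality_dep => n /=.
by rewrite /pi raddfB.
Qed.

Lemma completion_map_is_monoid_morphism : monoid_morphism completion_map.
Proof.
split=> [|a b]; apply: val_inj; apply: functional_extensionality_dep => n /=;
  by rewrite /pi ?rmorph1 ?rmorphM.
Qed.

HB.instance Definition _ := GRing.isZmodMorphism.Build R (completion m)
  completion_map completion_map_is_zmod_morphism.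
HB.instance Definition _ := GRing.isMonoidMorphism.Build R (completion m)
  completion_map completion_map_is_monoid_morphism.

(** Coordinate [i] lives in R/m^(i+1), so this is the kernel of the projection to R/m^n. *)
Definition in_filtration n (x : completion m) : Prop :=
  forall i, (i < n)%N -> (val x : residues m) i = 0.

Lemma in_filtration_is_ideal n : is_ideal (in_filtration n).
Proof.
split=> [//|x y xn yn i iN|a x xn i iN].
- rewrite -[LHS]/((val x : residues m) i + (val y : residues m) i).
  by rewrite xn // yn // addr0.
- rewrite -[LHS]/((val a : residues m) i * (val x : residues m) i).
  by rewrite xn // mulr0.
Qed.

Definition filtration n : ideal (completion m) := ideal_of (in_filtration_is_ideal n).

Lemma filtrationP n x : reflect (in_filtration n x) (x \in filtration n).
Proof. exact: ideal_ofP. Qed.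

Lemma completion_map_filtration n a :
  (completion_map a \in filtration n) = (a \in ideal_exp mI n).
Proof.
apply/filtrationP/idP => [|an i iN]; last first.
  apply/eqP; rewrite -[0](raddf0 (pi i)); apply/eqP/pi_eq; rewrite subr0.
  exact: ideal_exp_le an.
case: n => [//|n] /(_ n (leqnn _)) /= an; rewrite -[a]subr0.
by apply/pi_eq; rewrite an /pi raddf0.
Qed.

Lemma filtration_dec n : {subset filtration n.+1 <= filtration n}.
Proof. by move=> x /filtrationP xn; apply/filtrationP => i iN; apply/xn/ltnW. Qed.

Lemma completion_repr n (x : completion m) :
  exists a, forall i, (i <= n)%N -> (val x : residues m) i = pi i a.
Proof.
elim: n => [|n [a xa]].
  have /asboolP/(_ 0%N)[a [xa _]] := valP x.
  by exists a => i; rewrite leqn0 => /eqP->.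
have /asboolP/(_ n)[b [xb xb']] := valP x.
exists b => i; rewrite leq_eqVlt => /predU1P[->//|iN].
by rewrite xa //; apply: (@pi_le i n a b iN); rewrite -xa.
Qed.

Lemma filtration_approx n (x : completion m) :
  exists a, x - completion_map a \in filtration n.
Proof.
have [a xa] := completion_repr n x; exists a; apply/filtrationP => i iN.
rewrite -[LHS]/((val x : residues m) i - pi i a).
by rewrite xa ?subrr // ltnW.
Qed.

Lemma filtration_sep x : (forall n, x \in filtration n) -> x = 0.
Proof.
move=> xn; apply: val_inj; apply: functional_extensionality_dep => n.
by have /filtrationP/(_ n (leqnn _)) := xn n.+1.
Qed.

Lemma filtration_complete (z : nat -> completion m) :
  (forall n, z n \in filtration n) ->
  exists s, forall n, s - \sum_(i < n) z i \in filtration n.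
Proof.
move=> zn; pose S n := \sum_(i < n) z i.
have Sle n k i : (i < n)%N -> (val (S (n + k)%N) : residues m) i = (val (S n) : residues m) i.
  move=> iN; elim: k => [|k IH]; first by rewrite addn0.
  rewrite addnS {1}/S big_ord_recr /= -/(S (n + k)%N).
  rewrite -[LHS]/((val (S (n + k)%N) : residues m) i + (val (z (n + k)%N) : residues m) i).
  rewrite IH; have /filtrationP -> := zn (n + k)%N; first by rewrite addr0.
  exact: leq_trans iN (leq_addr _ _).
(* From the partial sum of index [n + 1] on, coordinate [n] no longer changes, so the diagonal is
   the limit. *)
pose s : residues m := fun n => (val (S n.+1) : residues m) n.
have sc : s \in @coherent R m.
  apply/asboolP => n; have [a Sa] := completion_repr n.+1 (S n.+2).
  exists a; split; last exact: (Sa n.+1 (leqnn _)).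
  by rewrite -[RHS]/(pi n a) -Sa // /s -(Sle n.+1 1%N n) ?addn1.
exists (exist (fun x : residues m => x \in @coherent R m) s sc) => n; apply/filtrationP => i iN.
rewrite -[LHS]/(s i - (val (S n) : residues m) i) /s.
by rewrite -(subnKC iN) Sle ?subrr.
Qed.

End Completion.

(** * Dimension and the completion *)

Lemma nat_supP (S : nat -> Prop) n :
  nat_sup S = Some n <-> S n /\ forall k, S k -> (k <= n)%N.
Proof.
rewrite /nat_sup; case: pselect => [e|noS]; split=> //; last first.
- by move=> Sn; case: noS; exists n.
- case: (cid e) => k /= [Sk maxk] [Sn maxn]; congr Some.
  by apply/eqP; rewrite eqn_leq maxn ?maxk.
- by case: (cid e) => k /= Sk [<-].
Qed.

Lemma nat_sup_exists (S : nat -> Prop) N : (exists n, S n) ->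
  (forall n, S n -> (n <= N)%N) -> exists2 n, nat_sup S = Some n & (n <= N)%N.
Proof.
move=> [n0 Sn0] SN; have exS : exists n, (fun n => `[< S n >]) n by exists n0; apply/asboolP.
have ubS n : `[< S n >] -> (n <= N)%N by move=> /asboolP/SN.
case: (ex_maxnP exS ubS) => n /asboolP Sn maxn; exists n; last exact: SN.
by apply/nat_supP; split=> // k Sk; apply/maxn/asboolP.
Qed.

Section KrullDimension.
Variable A : comNzRingType.
Implicit Types (P Q p q : ideal A).

Lemma pchain_of_fun (C : nat -> ideal A) n : (forall i, prime_ideal (C i)) ->
  (forall i, (i < n)%N -> strict (C i) (C i.+1)) -> pchain (C 0%N) n (C n).
Proof.
move=> Cp; elim: n => [|n IH] Cn; first exact: pchain0.
apply: pchainS (Cn n (leqnn _)) (Cp _); apply: IH => i iN.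
exact/Cn/ltnW.
Qed.

Lemma fun_of_pchain p n q : pchain p n q -> exists C : nat -> ideal A,
  [/\ forall i, prime_ideal (C i), C 0%N = p, C n = q
    & forall i, (i < n)%N -> strict (C i) (C i.+1)].
Proof.
elim=> {n q} [pp|n q q' pq [C [Cp C0 Cn Cs]] qq' q'p]; first by exists (fun=> p).
exists (fun i => if (i <= n)%N then C i else q'); split=> //.
- by move=> i; case: ifP.
- by rewrite ltnn.
- move=> i iSn; rewrite -[(i <= n)%N]ltnS iSn; case: (ltnP i n) => [/Cs//|ni].
  have -> : i = n by apply/eqP; rewrite eqn_leq ni -ltnS iSn.
  by rewrite Cn.
Qed.

Lemma has_prime_chainP n : has_prime_chain A n <-> exists p q, pchain p n q.
Proof.
split=> [[P Ps]|[p [q /fun_of_pchain[C [Cp _ _ Cs]]]]].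
  exists (ideal_of_idealr (P 0%N)), (ideal_of_idealr (P n)).
  apply: (@pchain_of_fun (fun i => ideal_of_idealr (P i))) => [i|]; last exact: Ps.
  exact: prime_idealr_prime.
by exists (fun i => prime_idealr_of (Cp i)); apply: Cs.
Qed.

Variable P : prime_idealr A.
Let D := {ideal_quot P}.
Let pi : {rmorphism A -> D} := \pi_({ideal_quot P})%qT.
Let IP := ideal_of_idealr P.

Lemma quot_pi_eq x y : (pi x = pi y) <-> (x - y \in IP).
Proof.
rewrite -[_ \in IP]/(x - y \in P) Quotient.idealrBE; split=> [xy|/eqP//].
by apply/eqP.
Qed.

Lemma quot_pi_surj (y : D) : pi (repr y) = y. Proof. exact: reprK. Qed.

Lemma quot_has_prime_chainP n :
  has_prime_chain D n <-> exists p q, {subset IP <= p} /\ pchain p n q.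
Proof.
split=> [[C Cs]|[p [q [Pp /fun_of_pchain[C [Cp C0 _ Cs]]]]]].
  have comap_ideal i : is_ideal (fun x => pi x \in C i).
    split=> [|x y xC yC|a x xC]; first by rewrite rmorph0 (rpred0 (C i)).
      by rewrite rmorphD (rpredD xC yC).
    by rewrite -[a *: x]/(a * x) rmorphM; apply: (@idealMr _ (C i)).
  pose C' i : ideal A := ideal_of (comap_ideal i).
  have C'P i x : (x \in C' i) = (pi x \in C i) by apply/(ideal_ofP (comap_ideal i))/idP.
  exists (C' 0%N), (C' n); split=> [x xP|].
    rewrite C'P; have /quot_pi_eq -> : x - 0 \in IP by rewrite subr0.
    by rewrite rmorph0 (rpred0 (C 0%N)).
  apply: pchain_of_fun => [i|i /Cs[sub nsub]].
    apply: prime_ideal_intro => [|a b]; rewrite !C'P ?rmorph1 ?idealr1 //.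
    by rewrite rmorphM prime_idealrM => /orP[->|].
  split=> [x|sub']; first by rewrite !C'P; apply: sub.
  by apply: nsub => y yC; have := sub' (repr y); rewrite !C'P quot_pi_surj; apply.
have PC i : (i <= n)%N -> {subset IP <= C i}.
  elim: i => [|i IH] iN x xP; first by rewrite C0; apply: Pp.
  by apply: (Cs i iN).1; apply: IH (ltnW iN) x xP.
(* A chain is indexed by all of [nat]; beyond [n] it is refilled with a prime that contains [IP], so
   that every term passes to the quotient. *)
have [C'' [C''p PC'' C''C]] : exists C'' : nat -> ideal A,
    [/\ forall i, prime_ideal (C'' i), forall i, {subset IP <= C'' i}
      & forall i, (i <= n)%N -> C'' i = C i].
  exists (fun i => if (i <= n)%N then C i else C 0%N); split=> [i|i|i ->//].
    by case: ifP.
  by case: ifP => [/PC//|_]; apply: PC.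
have image_ideal i : is_ideal (fun y : D => repr y \in C'' i).
  have reprC x y : x - y \in IP -> y \in C'' i -> x \in C'' i.
    by move=> /(PC'' i); apply: idealBl.
  split=> [|x y xC yC|a x xC].
  - by apply: (reprC _ 0) (ideal0 _); apply/quot_pi_eq; rewrite quot_pi_surj rmorph0.
  - apply: (reprC _ (repr x + repr y)); last exact: idealD.
    by apply/quot_pi_eq; rewrite rmorphD !quot_pi_surj.
  - apply: (reprC _ (repr a * repr x)); last exact: ideal_mull.
    by apply/quot_pi_eq; rewrite rmorphM !quot_pi_surj.
pose E i : ideal D := ideal_of (image_ideal i).
have EP i x : (pi x \in E i) = (x \in C'' i).
  apply/(ideal_ofP (image_ideal i))/idP => [|xC].
    by apply: idealBr; apply/PC''/quot_pi_eq; rewrite quot_pi_surj.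
  by apply: idealBr xC; apply/PC''/quot_pi_eq; rewrite quot_pi_surj.
have Ep i : prime_ideal (E i).
  apply: prime_ideal_intro => [|a b].
    by rewrite -(rmorph1 pi) EP; case: (C''p i).
  rewrite -[a]quot_pi_surj -[b]quot_pi_surj -rmorphM !EP.
  by move=> /(prime_idealM (C''p i))[->|].
exists (fun i => prime_idealr_of (Ep i)) => i iN.
have [sub nsub] : strict (C'' i) (C'' i.+1) by rewrite !C''C ?(ltnW iN) //; apply: Cs.
split=> [y|sub'].
  by rewrite !prime_idealr_ofE -[y]quot_pi_surj !EP; apply: sub.
by apply: nsub => x; rewrite -!EP; apply: sub'.
Qed.

End KrullDimension.

(** * Minimal primes of a formally equidimensional ring *)

Section Equidimensional.
Variables (R : comNzRingType) (m : idealr R).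
Hypotheses (localR : local_ring m) (equidim : formally_equidimensional m).

Let mI := ideal_of_idealr m.
Let noethR := local_noetherian localR.
Let m_prime := local_prime localR.
Let m_max := local_max localR.
Let Ahat : comNzRingType := completion m.
Let iota : {rmorphism R -> Ahat} := @completion_map R m.
Let fil : nat -> ideal Ahat := @filtration R m.

Let iota_fil n a : (iota a \in fil n) = (a \in ideal_exp mI n).
Proof. exact: completion_map_filtration. Qed.

Lemma completion_noetherian : noetherian Ahat.
Proof.
apply: (@complete_noetherian R Ahat iota mI fil noethR).
- exact: local_unit localR.
- exact: iota_fil.
- exact: filtration_dec.
- exact: filtration_approx.
- exact: filtration_sep.
- exact: filtration_complete.
Qed.

Let max_prime : prime_ideal (fil 1).
Proof.
apply: (@fil1_prime R Ahat iota mI fil).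
- exact: local_unit localR.
- exact: local_proper.
- exact: iota_fil.
- exact: filtration_dec.
- exact: filtration_approx.
- exact: filtration_sep.
- exact: filtration_complete.
Qed.

Let max_max Q : prime_ideal Q -> {subset Q <= fil 1}.
Proof.
apply: (@prime_sub_fil1 R Ahat iota mI fil).
- exact: local_unit localR.
- exact: iota_fil.
- exact: filtration_dec.
- exact: filtration_approx.
- exact: filtration_sep.
- exact: filtration_complete.
Qed.

Lemma max_generated (Q : ideal Ahat) : (forall x, x \in mI -> iota x \in Q) -> {subset fil 1 <= Q}.
Proof.
move=> mQ; have /finitely_generatedP[k [g mg]] := noethR mI.
have fg : fil 1 =i ideal_span (fun i => iota (g i)).
  apply: (@fil1_span R Ahat iota mI fil) mg.
  - exact: iota_fil.
  - exact: filtration_dec.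
  - exact: filtration_approx.
  - exact: filtration_sep.
  - exact: filtration_complete.
move=> x; rewrite fg; move: x; apply: ideal_span_min => i; apply: mQ.
by rewrite mg; apply: ideal_span_mem.
Qed.

Lemma max_parameters (J : ideal R) : exists xs, parameters mI J xs.
Proof.
have [s ms] := noethR mI; exists s; split=> [x xs|Q _ sQ x].
  by rewrite ms; apply: mem_submodule_span.
by rewrite ms; move: x; apply: submodule_span_min.
Qed.

Lemma contraction_is_ideal (Q : ideal Ahat) : is_ideal (fun x => iota x \in Q).
Proof.
split=> [|x y xQ yQ|a x xQ]; first by rewrite rmorph0 ideal0.
  by rewrite rmorphD idealD.
by rewrite -[a *: x]/(a * x) rmorphM ideal_mull.
Qed.

Definition contraction (Q : ideal Ahat) : ideal R := ideal_of (contraction_is_ideal Q).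

Lemma contractionP (Q : ideal Ahat) x : (x \in contraction Q) = (iota x \in Q).
Proof. exact/(ideal_ofP (contraction_is_ideal Q))/idP. Qed.

Lemma contraction_prime (Q : ideal Ahat) : prime_ideal Q -> prime_ideal (contraction Q).
Proof.
move=> Qp; apply: prime_ideal_intro => [|a b]; rewrite !contractionP.
  by rewrite rmorph1; case: Qp.
by rewrite rmorphM => /(prime_idealM Qp)[->|].
Qed.

(* The completion map is injective, so the complement of P does not meet 0. *)
Lemma minimal_prime_over_completion (P : ideal R) : minimal_over (zero_ideal R) P ->
  exists2 Q, minimal_over (zero_ideal Ahat) Q & forall x, x \in P -> iota x \in Q.
Proof.
move=> [[Pp _] minP].
have [|y z [a aP <-] [b bP <-]|y /zero_idealP-> [a aP a0]|Q [[Qp _] QS]] :=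
  @prime_avoiding _ completion_noetherian (fun y => exists2 a, a \notin P & iota a = y)
    (zero_ideal Ahat).
- by exists 1; [case: Pp|rewrite rmorph1].
- by exists (a * b); [apply: prime_idealMn|rewrite rmorphM].
- case/negP: aP; suff -> : a = 0 by apply: ideal0.
  apply: (local_intersection localR) => n.
  by rewrite -iota_fil a0 ideal0.
have [Q' minQ' Q'Q] : exists2 Q', minimal_over (zero_ideal Ahat) Q' & {subset Q' <= Q}.
  by apply: (minimal_over_exists completion_noetherian); split=> // x /zero_ideal_sub.
exists Q' => // x xP; rewrite -contractionP; apply: minP xP.
- split; first by apply: contraction_prime; case: minQ' => -[].
  exact: zero_ideal_sub.
- move=> y; rewrite contractionP => /Q'Q/QS yS; apply: contrapT => /negP yP.
  by apply: yS; exists y.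
Qed.

Lemma parameters_completion (P : ideal R) (Q : ideal Ahat) xs : (forall x, x \in P -> iota x \in Q) ->
  parameters mI P xs -> parameters (fil 1) Q (map iota xs).
Proof.
move=> PQ [xsm xsP]; split=> [_ /mapP[x /xsm xm ->]|Q' [Q'p QQ'] xsQ'].
  by rewrite iota_fil ideal_exp1.
apply: max_generated => x xm; rewrite -contractionP; apply: xsP xm.
  split; first exact: contraction_prime.
  by move=> y /PQ/QQ'; rewrite contractionP.
by move=> y yxs; rewrite contractionP; apply/xsQ'/map_f.
Qed.

(** Parameters survive a perturbation of high order: if the N-th power of the maximal ideal lies in
    the ideal of the [ys], then approximations modulo [fil N.+1] satisfy m^N inside (xs) + m^(N+1),
    and Nakayama puts m^N into (xs) locally at [m]. *)
Lemma parameters_descend ys : parameters (fil 1) (zero_ideal Ahat) ys ->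
  exists2 xs, size xs = size ys & parameters mI (zero_ideal R) xs.
Proof.
move=> [ysm ysJ]; pose K := ideal_span (fun i : 'I_(size ys) => ys`_i).
have ysK y : y \in ys -> y \in K.
  move=> yys; rewrite -(nth_index 0 yys).
  have szy : (index y ys < size ys)%N by rewrite index_mem.
  exact: (ideal_span_mem _ (Ordinal szy)).
have [|s [N [s1 sN]]] := local_power completion_noetherian (J := fil 1) (K := K) max_prime.
  move=> Q [Qp KQ] _; apply: ysJ => [|y /ysK/KQ//].
  by split=> //; apply: zero_ideal_sub.
have [t st] : exists t, s * t = 1.
  apply: (@complete_unit R Ahat iota mI fil) s1.
  - exact: local_unit localR.
  - exact: iota_fil.
  - exact: filtration_dec.
  - exact: filtration_approx.
  - exact: filtration_sep.
  - exact: filtration_complete.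
have approx (y : Ahat) : exists a, y - iota a \in fil N.+1 := filtration_approx N.+1 y.
pose f y := projT1 (cid (approx y)).
have fE y : y - iota (f y) \in fil N.+1 := projT2 (cid (approx y)).
have fil1N z : z \in fil N.+1 -> z \in fil 1.
  by apply: descending_le => //; apply: filtration_dec.
exists (map f ys); first exact: size_map.
split=> [_ /mapP[y /ysm y1 ->]|Q [Qp _] xsQ].
  rewrite -[_ \in mI]ideal_exp1 -iota_fil.
  exact: idealBr (fil1N _ (fE y)) y1.
pose X := ideal_span (fun i : 'I_(size ys) => f ys`_i).
have [|a aN|u um uN] := @nakayama _ mI (ideal_exp mI N) X m_prime.
- exact: noethR.
- exists 1; first exact: local_proper; rewrite mul1r.
  have : iota a \in K.
    rewrite -[iota a]mul1r -st mulrAC; apply: ideal_mulr; apply: sN.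
    apply: ideal_exp_morph aN => y ym.
    by rewrite iota_fil ideal_exp1.
  move=> /ideal_spanP[b aE]; pose b' i := f (b i).
  rewrite -[a](subrK (\sum_i b' i * f ys`_i)); apply: mem_submodule_sum; last first.
    by apply/ideal_spanP; exists b'.
  rewrite -[ideal_mul _ _]/(ideal_exp mI N.+1) -iota_fil.
  rewrite rmorphB aE rmorph_sum -sumrB; apply: ideal_sum => i _; rewrite rmorphM.
  have -> : b i * ys`_i - iota (b' i) * iota (f ys`_i) =
      (b i - iota (b' i)) * ys`_i + iota (b' i) * (ys`_i - iota (f ys`_i)) by ring.
  by apply: idealD; [apply: ideal_mulr|apply: ideal_mull]; apply: fE.
have uQ : u \notin Q by apply: contraNN um; apply: m_max.
apply: (ideal_exp_prime (n := N) Qp) => a /uN ua.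
have : u * a \in Q.
  move: ua; apply: ideal_span_min => i; apply: xsQ.
  by apply: map_f; rewrite mem_nth.
by move=> /(prime_idealM Qp)[uQ'|//]; rewrite uQ' in uQ.
Qed.

Lemma minimal_prime_dim (P : prime_idealr R) : minimal_prime P ->
  krull_dim {ideal_quot P} = krull_dim R.
Proof.
move=> minP; pose IP := ideal_of_idealr P; pose above n := exists p q : ideal R,
  {subset IP <= p} /\ pchain p n q.
have IPp : prime_ideal IP by apply: prime_idealr_prime.
have minIP : minimal_over (zero_ideal R) IP.
  split=> [|Q [Qp _] QP]; first by split=> //; apply: zero_ideal_sub.
  exact: (minP (prime_idealr_of Qp)).
have [ms msP] := max_parameters IP.
(* [c] is the dimension of R/P; it is finite because generators of [m] bound all chains above
   [IP]. *)
have [c /nat_supP[[p0 [q0 [Pp0 chain0]]] maxc] _] : exists2 c, nat_sup above = Some c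
    & (c <= size ms)%N.
  apply: nat_sup_exists; first by exists 0%N, IP, IP; split=> //; apply: pchain0.
  move=> n [p [q [Pp pq]]].
  exact: (pchain_le_parameters noethR m_prime m_max msP Pp pq).
have [xs szxs xsP] : exists2 xs, size xs = c & parameters mI IP xs.
  apply: (parameters_exist noethR m_prime m_max) => p n q Pp pq.
  by apply: maxc; exists p, q.
have [Q minQ PQ] := minimal_prime_over_completion minIP.
have [Qp _] := minQ.1; pose Qr := prime_idealr_of Qp.
have minQr : minimal_prime Qr.
  move=> Q' Q'Q; apply: (minQ.2 (ideal_of_idealr Q')) => //.
  by split; [apply: prime_idealr_prime|apply: zero_ideal_sub].
have [c' dimQ c'c] : exists2 c', krull_dim {ideal_quot Qr} = Some c' & (c' <= c)%N.
  apply: nat_sup_exists => [|n /quot_has_prime_chainP[p [q [Qp' pq]]]].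
    exists 0%N; apply/quot_has_prime_chainP; exists Q, Q; split=> //.
    exact: pchain0.
  rewrite -szxs -(size_map iota).
  apply: (pchain_le_parameters completion_noetherian max_prime max_max _ _ pq).
    exact: parameters_completion PQ xsP.
  exact: Qp'.
(* Equidimensionality carries the bound [c'], and with it [c], from the quotient by [Q] to all
   chains of the completion. *)
move: (equidim minQr); rewrite dimQ => /esym/nat_supP[_ maxc'].
have [ys szys ysP] : exists2 ys, size ys = c & parameters (fil 1) (zero_ideal Ahat) ys.
  apply: (parameters_exist completion_noetherian max_prime max_max) => p n q _ pq.
  by apply: leq_trans c'c; apply/maxc'/has_prime_chainP; exists p, q.
have [zs szzs zsP] := parameters_descend ysP.
have -> : krull_dim {ideal_quot P} = Some c.
  apply/nat_supP; split; first by apply/quot_has_prime_chainP; exists p0, q0.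
  by move=> n /quot_has_prime_chainP; apply: maxc.
apply/esym/nat_supP; split; first by apply/has_prime_chainP; exists p0, q0.
move=> n /has_prime_chainP[p [q pq]]; rewrite -szys -szzs.
apply: (pchain_le_parameters noethR m_prime m_max zsP _ pq).
exact: zero_ideal_sub.
Qed.

End Equidimensional.

(** * Lengths, localization and tensor products *)

Section Chains.
Variables (A : pzRingType) (V : lmodType A).
Implicit Types (N X Y Z : submodule V) (C : nat -> submodule V).

Definition increasing_below n C : Prop := forall i, (i < n)%N -> {subset C i <= C i.+1}.

Lemma increasing_below_le n C i j : increasing_below n C -> (i <= j <= n)%N ->
  {subset C i <= C j}.
Proof.
move=> Cn /andP[/subnKC<-]; elim: (j - i)%N => [|k IH] kn x; first by rewrite addn0.
rewrite addnS in kn *; move=> /(IH (ltnW kn)); exact: Cn.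
Qed.

(** Repetitions are dropped from a weakly increasing chain, so that the traces of a strict chain on
    two submodules can be measured separately. *)
Lemma has_chain_count n C : increasing_below n C ->
  has_chain (C n) (\sum_(i < n) `[< ~ {subset C i.+1 <= C i} >]).
Proof.
elim: n => [|n IH] Cn; first by rewrite big_ord0; exists (fun=> C 0%N); split.
have [|D [Ds Dn]] := IH; first by move=> i iN; apply/Cn/ltnW.
rewrite big_ord_recr /=; set k := (\sum_(i < n) _)%N in Ds Dn *.
case: asboolP => [CnS|_]; last by rewrite addn0; exists D; split=> // x /Dn; apply: Cn.
rewrite addn1; exists (fun i => if (i <= k)%N then D i else C n.+1).
split=> [i ik|]; last by rewrite ltnn.
rewrite -[(i <= k)%N]ltnS ik; case: (ltnP i k) => [/Ds//|ki].
have -> : i = k by apply/eqP; rewrite eqn_leq ki -ltnS ik.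
by split=> [x /Dn|sub]; [apply: Cn|apply: CnS => x /sub/Dn].
Qed.

Lemma has_chain_increasing N n C : {subset C n <= N} -> increasing_below n C ->
  has_chain N (\sum_(i < n) `[< ~ {subset C i.+1 <= C i} >]).
Proof. by move=> CN /has_chain_count[D [Ds Dn]]; exists D; split=> // x /Dn/CN. Qed.

Definition submodule_cap X Y : submodule V.
Proof.
apply: (submodule_of (S := fun x => x \in X /\ x \in Y)).
split=> [|x y [xX xY] [yX yY]|a x [xX xY]]; rewrite ?rpred0 //.
  by rewrite !rpredD.
by rewrite !rpredZ.
Defined.

Lemma submodule_capP X Y x : reflect (x \in X /\ x \in Y) (x \in submodule_cap X Y).
Proof. exact: submodule_ofP. Qed.

(** A step of [C] at which neither the trace of [C i] on [Y] nor the trace of [C i + Y] on [Z] grows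
    is not strict. Hence every strict step is counted in at least one of the two traces. *)
Lemma has_chain_sum X Y Z n y z : {subset X <= submodule_sum Y Z} -> has_chain X n ->
  (forall k, has_chain Y k -> (k <= y)%N) -> (forall k, has_chain Z k -> (k <= z)%N) ->
  (n <= y + z)%N.
Proof.
move=> XYZ [C [Cs CX]] Yy Zz.
have Cn : increasing_below n C by move=> i /Cs[].
pose F i := submodule_cap (C i) Y.
pose G i := submodule_cap (submodule_sum (C i) Y) Z.
have Fn : increasing_below n F.
  move=> i iN x /submodule_capP[xC xY]; apply/submodule_capP; split=> //.
  exact: Cn xC.
have Gn : increasing_below n G.
  move=> i iN x /submodule_capP[xC xZ]; apply/submodule_capP; split=> //.
  move: xC; apply: submodule_sum_min => w wC; last exact: submodule_sum_r.
  exact/submodule_sum_l/(Cn i iN).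
have sF := has_chain_increasing (N := Y) _ Fn.
have sG := has_chain_increasing (N := Z) _ Gn.
apply: leq_trans (leq_add (Yy _ (sF _)) (Zz _ (sG _))); first last.
- by move=> x /submodule_capP[].
- by move=> x /submodule_capP[].
rewrite -big_split -[X in (X <= _)%N]card_ord -sum1_card.
apply: leq_sum => i _; have iN := ltn_ord i.
case: asboolP => [_|/contrapT subF] //; case: asboolP => [_|/contrapT subG] //.
case: (Cs i iN) => _ []; move=> w wC.
have /XYZ/asboolP[a [b [aY bZ wE]]] : w \in X.
  by apply/CX/(increasing_below_le Cn (i := i.+1)); rewrite // iN leqnn.
have /submodule_capP[/asboolP[c [d [cC dY bE]]] _] : b \in G i.
  apply/subG/submodule_capP; split=> //.
  have -> : b = w + (- a) by rewrite wE addrAC subrr add0r.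
  by apply: mem_submodule_sum => //; rewrite rpredN.
have /submodule_capP[adC _] : a + d \in F i.
  apply/subF/submodule_capP; split; last exact: rpredD.
  have -> : a + d = w - c by rewrite wE bE addrCA addrAC subrr add0r.
  by rewrite rpredB //; apply: Cn cC.
by rewrite wE bE addrCA rpredD.
Qed.

Lemma has_chain_zero N n : (forall x, x \in N -> x = 0) -> has_chain N n -> n = 0%N.
Proof.
case: n => // n N0 [C [Cs CN]]; have Cn : increasing_below n.+1 C by move=> i /Cs[].
case: (Cs 0%N) => // _ []; move=> x xC; suff -> : x = 0 by apply: rpred0.
by apply/N0/CN/(increasing_below_le Cn (i := 1%N)); rewrite // leqnn.
Qed.

(** The chain pulls back along scalar multiplication of [f] to a strict chain of ideals. *)
Lemma has_chain_cyclic (f : V) N n b : (forall x, x \in N -> exists a, x = a *: f) ->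
  (forall k, has_chain (submodule_full A^o) k -> (k <= b)%N) -> has_chain N n -> (n <= b)%N.
Proof.
move=> Nf bA [C [Cs CN]]; have Cn : increasing_below n C by move=> i /Cs[].
have pre_sub i : @is_submodule A A^o (fun a : A => a *: f \in C i).
  split=> [|a c aC cC|a c cC]; first by rewrite scale0r rpred0.
    by rewrite scalerDl rpredD.
  by rewrite -[a *: c]/(a * c) -scalerA rpredZ.
apply: bA; exists (fun i => submodule_of (pre_sub i)); split=> // i iN.
have [sub nsub] := Cs i iN; split=> [a /submodule_ofP/sub aC|sub'].
  exact/submodule_ofP.
apply: nsub => x xC; have [a E] : exists a, x = a *: f.
  by apply/Nf/CN/(increasing_below_le Cn (i := i.+1)); rewrite // iN leqnn.
by rewrite E in xC *; apply/(submodule_ofP (pre_sub i))/sub'/submodule_ofP.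
Qed.

Lemma has_chain_spans k (f : 'I_k -> V) N n b :
  {subset N <= submodule_span (fun x => exists i, x = f i)} ->
  (forall k, has_chain (submodule_full A^o) k -> (k <= b)%N) -> has_chain N n ->
  (n <= k * b)%N.
Proof.
move=> + bA; elim: k f N n => [|k IH] f N n Nf chN.
  rewrite (has_chain_zero _ chN) // => x /Nf/spansP[c ->].
  by rewrite big_ord0.
rewrite mulSn; pose g i := f (lift ord0 i).
apply: (has_chain_sum (Y := submodule_span (fun x => x = f ord0)) _ chN).
- move=> x /Nf; move: x; apply: submodule_span_min => _ [i ->].
  case: (unliftP ord0 i) => [j|] ->.
    by apply/submodule_sum_r/(@mem_submodule_span _ _ (fun x => exists i, x = g i)); exists j.
  exact/submodule_sum_l/mem_submodule_span.
- move=> l; apply: (has_chain_cyclic (f := f ord0)) => // x.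
  move: x; apply: submodule_span_ind => [|x ->]; last by exists 1; rewrite scale1r.
  split=> [|_ _ [a ->] [c ->]|a _ [c ->]]; first by exists 0; rewrite scale0r.
    by exists (a + c); rewrite scalerDl.
  by exists (a * c); rewrite scalerA.
- by move=> l; apply: (IH g).
Qed.

Lemma has_chain0 N : has_chain N 0.
Proof. by exists (fun=> N); split. Qed.

Lemma module_length_le N l n : module_length N = Some l -> has_chain N n -> (n <= l)%N.
Proof. by move=> /nat_supP[_]; apply. Qed.

End Chains.

Section Quotients.
Variables (A : pzRingType) (V : lmodType A) (N : submodule V).
Let pi : V -> quot_module N := \pi_(quot_module N)%qT.

Lemma quot_module_eqP x y : pi x = pi y <-> x - y \in N.
Proof. by rewrite Quotient.idealrBE; split=> [/eqP|/eqP]. Qed.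

Lemma quot_module_eq0P x : pi x = 0 <-> x \in N.
Proof. by rewrite -[0](raddf0 pi) -[x in _ <-> x \in _]subr0; apply: quot_module_eqP. Qed.

End Quotients.

Section Localization.
Variables (R : comNzRingType) (P : prime_idealr R) (M : lmodType R).

Let frac (V : lmodType R) (x : V) (s : loc_den P) : loc_module P V :=
  \pi_(loc_module P V)%qT (x, s).

(** [d] becomes invertible: [x / s0] is [1 / (d * s0)] times [d *: x], a combination of the
    [f j]. *)
Lemma loc_module_spans nu (g : 'I_nu -> M) s (f : 'I_s -> M) (d : R) :
  spans g (submodule_full M) -> d \notin P ->
  (forall i, d *: g i \in submodule_span (fun x => exists j, x = f j)) ->
  forall y : loc_module P M, y \in @submodule_span (loc_ring P) _
    (fun x => exists j, x = frac (f j) (den1 P)).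
Proof.
move=> Mg dP dg; set T := submodule_span _.
have scaleE (a : R) (s1 : loc_den P) (x : M) (s2 : loc_den P) :
  (frac (a : R^o) s1 : loc_ring P) *: frac x s2 = frac (a *: x) (denM s1 s2).
  exact: loc_pi_scale.
have T_sub : is_submodule (fun x => frac x (den1 P) \in T).
  split=> [|x y xT yT|a x xT]; first exact: (rpred0 T).
  - have -> : frac (x + y) (den1 P) = frac x (den1 P) + frac y (den1 P).
      rewrite [RHS]loc_pi_addr; apply: loc_pair_eq; rewrite /= ?scale1r //.
      by rewrite mulr1.
    exact: rpredD.
  - have -> : frac (a *: x) (den1 P) = (frac (a : R^o) (den1 P) : loc_ring P) *: frac x (den1 P).
      by rewrite scaleE; apply: loc_pair_eq; rewrite //= mulr1.
    exact: rpredZ.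
have fT y : y \in submodule_span (fun x => exists j, x = f j) -> frac y (den1 P) \in T.
  by move: y; apply: submodule_span_ind => // _ [j ->]; apply: mem_submodule_span; exists j.
have dT x : frac (d *: x) (den1 P) \in T.
  apply: fT; have : x \in submodule_full M by [].
  rewrite Mg => /spansP[c ->]; rewrite scaler_sumr; apply: rpred_sum => i _.
  by rewrite scalerA mulrC -scalerA rpredZ.
elim/quotW=> -[x s0]; pose dd : loc_den P := exist _ d dP.
have -> : \pi_(loc_module P M)%qT (x, s0) =
    (frac (1 : R^o) (denM dd s0) : loc_ring P) *: frac (d *: x) (den1 P).
  rewrite scaleE; apply/eqP/loc_eqP; exists (den1 P).
  by rewrite /= !scale1r mulr1 scalerA [val s0 * d]mulrC subrr.
exact: rpredZ.
Qed.

Lemma loc_ring_length_gt0 b :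
  module_length (submodule_full (loc_ring P)^o) = Some b -> (0 < b)%N.
Proof.
move=> /module_length_le; apply; pose Z := @submodule_span (loc_ring P) (loc_ring P)^o (fun=> False).
exists (fun i => if i == 0%N then Z else submodule_full _).
split=> // i; rewrite ltnS leqn0 => /eqP-> /=; split=> // /(_ 1 isT) one0.
have {one0} : (1 : loc_ring P) = 0 by move/(@zero_submoduleP _ (loc_ring P)^o): one0.
move=> /eqP/loc_eqP[[t tP] /=]; rewrite scaler0 subr0 scale1r => t0.
by case/negP: tP; rewrite -[t]mulr1 -[t * 1]/(t *: (1 : R^o)) t0 idealr0.
Qed.

End Localization.

Import (notations, canonicals, coercions) freeg.

Section TensorProducts.
Variable R : comNzRingType.
Implicit Types M N : lmodType R.

Lemma tensor_span M N (t : tensor M N) :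
  t \in submodule_span (fun t => exists x y, t = pure_tensor x y).
Proof.
elim/quotW: t => D; rewrite -[D]freeg.freeg_sumE raddf_sum; apply: rpred_sum => -[x y] _.
set c := freeg.coeff _ _; set T := submodule_span (fun t => exists x y, t = pure_tensor x y).
have cT : c *: pure_tensor x y \in T.
  by apply/rpredZ/mem_submodule_span; exists x, y.
have E : << c *g (x, y) >> = c *: (<< (x, y) >> : {freeg (M * N) / R}).
  rewrite [RHS]/(freeg.fgscale c _) /freeg.fgscale freeg.domU1 big_seq1.
  by rewrite freeg.coeffU eqxx !mulr1.
by move: cT; rewrite /pure_tensor -quot_piZ -E.
Qed.

Lemma pure_tensor0 M N (x : M) : pure_tensor x (0 : N) = 0.
Proof. by rewrite -[0 in LHS](scale0r 0) pure_tensorZr scale0r. Qed.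

Section Images.
Variables (M B : lmodType R) (A : submodule B).
Implicit Types C : submodule B.

Let pi : B -> quot_module A := \pi_(quot_module A)%qT.
Let image C := lin_image (tensor_map (idfun : {linear M -> M}) (sub_quot_incl A C)).

Lemma sub_quot_incl_pi C (c : sub_module C) :
  sub_quot_incl A C (\pi_(sub_quot A C)%qT c) = pi (val c).
Proof. exact: quot_lift_pi. Qed.

Lemma pure_tensor_image C (x : M) (c : B) : c \in C -> pure_tensor x (pi c) \in image C.
Proof.
move=> cC; apply/asboolP.
exists (pure_tensor x (\pi_(sub_quot A C)%qT (exist _ c cC : sub_module C))).
by rewrite tensor_mapE sub_quot_incl_pi.
Qed.

Lemma tensor_image_min C (N : submodule (tensor M (quot_module A))) :
  (forall (x : M) (c : B), c \in C -> pure_tensor x (pi c) \in N) -> {subset image C <= N}.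
Proof.
move=> CN _ /asboolP[t <-]; move: t (tensor_span t); apply: submodule_span_ind.
  split=> [|s t sN tN|a t tN]; first by rewrite raddf0 rpred0.
    by rewrite raddfD rpredD.
  by rewrite linearZ rpredZ.
move=> _ [x [y ->]]; rewrite tensor_mapE; elim/quotW: y => c.
by rewrite sub_quot_incl_pi; apply: CN; apply: valP.
Qed.

End Images.

Section TensorQuotient.
Variables (M : lmodType R) (J : ideal R).

Let JM : submodule M := ideal_mul J (submodule_full M).
Let Q := quot_module J.

Lemma quot_scale_congr a b (x : M) : a - b \in J ->
  a *: (\pi_(quot_module JM)%qT x) = b *: (\pi_(quot_module JM)%qT x).
Proof.
move=> abJ; rewrite -!quot_piZ; apply/quot_module_eqP; rewrite -scalerBl.
by apply: mem_submodule_span; exists (a - b), x.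
Qed.

(** The bilinear map behind the identification of the tensor product of M and R/J with M/JM; modulo
    JM the choice of the representative does not matter. *)
Definition tensor_quot_pair (p : M * Q) : quot_module JM :=
  (repr p.2 : R) *: (\pi_(quot_module JM)%qT p.1).

Lemma tensor_quot_rel (D : {freeg (M * Q) / R}) :
  tensor_rel D -> freeg_lift tensor_quot_pair D = 0.
Proof.
have liftE p : freeg_lift tensor_quot_pair << p >> = tensor_quot_pair p.
  by rewrite /freeg_lift freeg.liftU scale1r.
have reprD (y y' : Q) : (repr (y + y') : R) - (repr y + repr y') \in J.
  apply/(quot_module_eqP J).
  apply: etrans (reprK _) _; rewrite -{1}[y]reprK -{1}[y']reprK.
  exact/esym/raddfD.
have reprZ a (y : Q) : (repr (a *: y) : R) - a * repr y \in J.
  apply/(quot_module_eqP J).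
  by apply: etrans (reprK _) _; rewrite -{1}[y]reprK; apply/esym/quot_piZ.
case=> *; rewrite !raddfB /=; try rewrite [freeg_lift _ (_ *: _)]linearZ /=.
all: rewrite !liftE /tensor_quot_pair /=.
- by rewrite raddfD scalerDr -addrA -opprD subrr.
- by rewrite (quot_scale_congr _ (reprD _ _)) scalerDl -addrA -opprD subrr.
- by rewrite quot_piZ !scalerA mulrC subrr.
- by rewrite (quot_scale_congr _ (reprZ _ _)) scalerA subrr.
Qed.

Lemma pure_tensor_eq0 (x : M) (u : R) :
  pure_tensor x (\pi_Q%qT (u : R^o)) = 0 -> u *: x \in JM.
Proof.
have rel0 D : D \in submodule_span (@tensor_rel R M Q) ->
    freeg_lift tensor_quot_pair D = 0.
  move: D; apply: submodule_span_ind; last exact: tensor_quot_rel.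
  split=> [|D E D0 E0|a D D0]; first exact: raddf0.
    exact: etrans (raddfD _ D E) (etrans (congr2 +%R D0 E0) (addr0 _)).
  by rewrite linearZ /= D0 scaler0.
move=> /(congr1 (quot_lift rel0)); rewrite raddf0 /pure_tensor quot_lift_pi.
rewrite /= /freeg_lift freeg.liftU scale1r /tensor_quot_pair /=.
rewrite (@quot_scale_congr _ u) => [|].
  by rewrite -quot_piZ => /quot_module_eq0P.
by apply/(quot_module_eqP J); rewrite reprK.
Qed.

End TensorQuotient.

End TensorProducts.

(** * The rank closure *)

Section SeparatedDeterminant.
Variables (R : comNzRingType) (K : fieldType) (phi : {rmorphism R -> K}).
Variables (m J : ideal R) (u : R).
Hypotheses (m1 : 1 \notin m) (u0 : phi u != 0) (sep : separated phi m (phi u) J).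

Let v := phi u.

Lemma frac_ideal_prod_congr (T : Type) (r : seq T) (c : T -> R) (f : T -> K) :
  (forall i, frac_ideal phi v J (f i)) ->
  frac_ideal phi v J (\prod_(i <- r) (phi (c i) + f i) - phi (\prod_(i <- r) c i)).
Proof.
move=> fJ; elim/big_rec2: _ => [|i y x _ xyJ].
  by rewrite rmorph1 subrr; apply: frac_ideal0.
have -> : (phi (c i) + f i) * x - phi (c i * y) =
    phi (c i) * (x - phi y) + (phi y * f i + f i * (x - phi y)).
  by rewrite rmorphM; ring.
apply: frac_idealD; first exact: frac_idealZ.
by apply: frac_idealD; [apply: frac_idealZ|apply: frac_idealM].
Qed.

Lemma frac_ideal_det_congr k (C : 'M[R]_k) (F : 'M[K]_k) :
  (forall i j, frac_ideal phi v J (F i j)) ->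
  frac_ideal phi v J (\det (map_mx phi C + F) - phi (\det C)).
Proof.
move=> FJ; rewrite /determinant rmorph_sum -sumrB; apply: frac_ideal_sum => s.
rewrite rmorphM rmorph_sign -mulrBr -(rmorph_sign phi); apply: frac_idealZ.
under eq_bigr => i _ do rewrite !mxE.
apply: (@frac_ideal_prod_congr _ _ (fun i => C i (perm.fun_of_perm s i))
  (fun i => F i (perm.fun_of_perm s i))) => i; exact: FJ.
Qed.

(** Division by [u] turns the matrix into [C] plus a matrix over the fraction ideal. If the
    determinant vanished, [\det C], which is 1 modulo [m], would be mapped into that ideal, against
    [sep]. *)
Lemma separated_det k (C B : 'M[R]_k) : (forall i j, C i j - (i == j)%:R \in m) ->
  (forall i j, B i j \in J) -> phi (\det (u *: C + B)) != 0.
Proof.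
move=> C1 BJ; pose F : 'M[K]_k := \matrix_(i, j) (phi (B i j) / v).
have -> : phi (\det (u *: C + B)) = v ^+ k * \det (map_mx phi C + F).
  rewrite -det_map_mx -detZ; congr (\det _); apply/matrixP => i j.
  by rewrite !mxE rmorphD rmorphM mulrDr mulrCA divff // mulr1.
apply: mulf_neq0; first exact: expf_neq0.
apply/eqP => det0.
have detC : \det C \notin m.
  have : \det C - \det (1%:M : 'M[R]_k) \in m.
    by apply: ideal_det_congr => i j; rewrite [1%:M i j]mxE.
  by rewrite det1 => /idealBr h; apply: contra m1.
apply: (sep detC); rewrite -[phi (\det C)]opprK; apply: frac_idealN.
have := @frac_ideal_det_congr k C F; rewrite det0 add0r; apply=> i j.
by rewrite mxE; apply: frac_ideal_gen.
Qed.

End SeparatedDeterminant.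

Section ImageBound.
Variables (R : comNzRingType) (K : fieldType) (phi : {rmorphism R -> K}).
Variables (m J : ideal R) (u : R) (M : lmodType R).
Hypotheses (m1 : 1 \notin m) (u0 : phi u != 0) (sep : separated phi m (phi u) J).

Let JM : submodule M := ideal_mul J (submodule_full M).
Let mM : submodule M := ideal_mul m (submodule_full M).

Lemma colon_is_submodule : is_submodule (fun x : M => u *: x \in JM).
Proof.
split=> [|x y xJ yJ|a x xJ]; first by rewrite scaler0 rpred0.
  by rewrite scalerDr rpredD.
by rewrite scalerA mulrC -scalerA rpredZ.
Qed.

Let Z := submodule_sum mM (submodule_of colon_is_submodule).

(* Cayley-Hamilton: if f generates M modulo Z then u g = (u c - b) g modulo the
   span of f, with c in m and b in J. *)
Lemma generators_modulo nu (g : 'I_nu -> M) s (f : 'I_s -> M) :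
  spans g (submodule_full M) ->
  (forall x, x \in submodule_sum (submodule_span (fun x => exists j, x = f j)) Z) ->
  exists2 d, phi d != 0 &
    forall i, d *: g i \in submodule_span (fun x => exists j, x = f j).
Proof.
move=> Mg fZ; set F := submodule_span _ in fZ *.
have dec i : exists cb : ('I_nu -> R) * ('I_nu -> R),
    [/\ forall j, cb.1 j \in m, forall j, cb.2 j \in J
      & u *: (g i - \sum_j cb.1 j *: g j) - \sum_j cb.2 j *: g j \in F].
  have /asboolP[y [z [yF zZ E]]] := fZ (g i).
  have /asboolP[w [t [/(module_mul_spans Mg)[c cm wE] tZ zE]]] := zZ.
  have /(module_mul_spans Mg)[b bJ tE] : u *: t \in JM by apply/submodule_ofP: tZ.
  exists (c, b); split=> //.
  rewrite -[_ \in F]/(u *: (g i - \sum_j c j *: g j) - \sum_j b j *: g j \in F) -wE -tE.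
  have -> : g i - w = y + t by rewrite E zE addrCA addrAC subrr add0r.
  by rewrite scalerDr addrK rpredZ.
pose c i := (projT1 (cid (dec i))).1; pose b i := (projT1 (cid (dec i))).2.
have cm i j : c i j \in m by have [+ _ _] := projT2 (cid (dec i)); apply.
have bJ i j : b i j \in J by have [_ + _] := projT2 (cid (dec i)); apply.
have cbF i : u *: (g i - \sum_j c i j *: g j) - \sum_j b i j *: g j \in F.
  by have [_ _] := projT2 (cid (dec i)).
pose C : 'M[R]_nu := \matrix_(i, j) ((i == j)%:R - c i j).
pose B : 'M[R]_nu := \matrix_(i, j) (- b i j).
exists (\det (u *: C + B)).
  apply: (separated_det m1 u0 sep) => i j; rewrite mxE ?idealN //.
  by rewrite addrAC subrr add0r idealN.
apply: det_scale_mem => i.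
have -> : \sum_j (u *: C + B) i j *: g j =
    u *: (g i - \sum_j c i j *: g j) - \sum_j b i j *: g j.
  have -> : g i = \sum_j (i == j)%:R *: g j.
    rewrite (bigD1 i) //= eqxx scale1r big1 ?addr0 // => j.
    by rewrite eq_sym => /negPf->; rewrite scale0r.
  rewrite -sumrB scaler_sumr -sumrB; apply: eq_bigr => j _.
  by rewrite !mxE scalerDl scaleNr -scalerA scalerBl.
exact: cbF.
Qed.

Lemma generators_chain nu (g : 'I_nu -> M) : spans g (submodule_full M) ->
  exists s (f : 'I_s -> M) (N : nat -> submodule M),
  [/\ forall x, x \in submodule_sum (submodule_span (fun x => exists j, x = f j)) Z,
      forall i, {subset Z <= N i}
    & forall i, (i < s)%N -> {subset N i <= N i.+1} /\ ~ {subset N i.+1 <= N i}].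
Proof.
move=> Mg; pose gen s (f : 'I_s -> M) := forall x,
  x \in submodule_sum (submodule_span (fun x => exists j, x = f j)) Z.
have ex : exists s, (fun s => `[< exists f : 'I_s -> M, gen s f >]) s.
  exists nu; apply/asboolP; exists g => x; apply: submodule_sum_l.
  by rewrite -Mg.
case: (ex_minnP ex) => s /asboolP[f genf] mins.
exists s, f, (fun i => submodule_sum
  (submodule_span (fun x => exists2 j : 'I_s, (j < i)%N & x = f j)) Z).
split=> // i; first exact: submodule_sum_r.
move=> iN; split.
  apply: submodule_sum_min; last exact: submodule_sum_r.
  apply: submodule_span_min => _ [j ji ->]; apply/submodule_sum_l/mem_submodule_span.
  by exists j => //; apply: ltnW.
move=> sub; case: s iN f genf mins sub => // s iN f genf mins sub.
suff: (s.+1 <= s)%N by rewrite ltnn.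
apply: mins; apply/asboolP; exists (fun j => f (lift (Ordinal iN) j)) => x.
set T := submodule_sum _ _.
have fT j : (Ordinal iN) != j -> f j \in T.
  move=> /unlift_some[j' jE _]; rewrite jE; apply/submodule_sum_l/mem_submodule_span.
  by exists j'.
move: x (genf x); apply: submodule_sum_min; last exact: submodule_sum_r.
apply: submodule_span_min => _ [j ->].
have [<-|] := eqVneq (Ordinal iN) j; last exact: fT.
have : f (Ordinal iN) \in submodule_sum
    (submodule_span (fun x => exists2 j : 'I_s.+1, (j < i)%N & x = f j)) Z.
  apply/sub/submodule_sum_l/mem_submodule_span.
  by exists (Ordinal iN).
apply: submodule_sum_min; last exact: submodule_sum_r.
apply: submodule_span_min => _ [k ki ->]; apply: fT.
by rewrite -val_eqE /= neq_ltn ki orbT.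
Qed.

(** [psi] tensors with the class of [u]. By [pure_tensor_eq0] its kernel lies in [Z] and so in every
    [N i]; hence strict inclusions stay strict under [psi]. *)
Lemma image_chain (C : ideal R) s (N : nat -> submodule M) : u \in C ->
  (forall i, {subset Z <= N i}) ->
  (forall i, (i < s)%N -> {subset N i <= N i.+1} /\ ~ {subset N i.+1 <= N i}) ->
  has_chain (lin_image (tensor_map (idfun : {linear M -> M}) (sub_quot_incl J C))) s.
Proof.
move=> uC ZN Ns; pose psi (x : M) := pure_tensor x (\pi_(quot_module J)%qT (u : R^o)).
have im i : is_submodule (fun t => exists2 x, x \in N i & t = psi x).
  split=> [|_ _ [x xN ->] [y yN ->]|a _ [x xN ->]].
  - by exists 0; rewrite ?rpred0 // /psi -[0 in RHS](scale0r 0) pure_tensorZl scale0r.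
  - by exists (x + y); rewrite ?rpredD // /psi pure_tensorDl.
  - by exists (a *: x); rewrite ?rpredZ // /psi pure_tensorZl.
exists (fun i => submodule_of (im i)); split=> [i iN|t /submodule_ofP[x _ ->]]; last first.
  exact: pure_tensor_image.
have [sub nsub] := Ns i iN; split=> [t /submodule_ofP[x /sub xN ->]|sub'].
  by apply/submodule_ofP; exists x.
apply: nsub => x xN; have /submodule_ofP[y yN xy] : psi x \in submodule_of (im i).
  by apply/sub'/submodule_ofP; exists x.
rewrite -[x](subrK y) rpredD //; apply/ZN/submodule_sum_r/submodule_ofP.
apply: pure_tensor_eq0; rewrite -[x - y]addrC -scaleN1r pure_tensorDl pure_tensorZl.
by rewrite -/(psi x) xy -/(psi y) scaleN1r addNr.
Qed.

Lemma image_length_bound (C : ideal R) l : finitely_generated (submodule_full M) ->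
  u \in C ->
  module_length (lin_image (tensor_map (idfun : {linear M -> M}) (sub_quot_incl J C)))
    = Some l ->
  exists s (f : 'I_s -> M) nu (g : 'I_nu -> M) d,
  [/\ (s <= l)%N, spans g (submodule_full M), phi d != 0
    & forall i, d *: g i \in submodule_span (fun x => exists j, x = f j)].
Proof.
move=> /finitely_generatedP[nu [g Mg]] uC len.
have [s [f [N [fZ ZN Ns]]]] := generators_chain Mg.
have [d d0 dg] := generators_modulo Mg fZ.
exists s, f, nu, g, d; split=> //; apply: module_length_le len _.
exact: image_chain uC ZN Ns.
Qed.

End ImageBound.

(** * Equations of integral dependence *)

Section IntegralRelations.
Variables (R : comNzRingType) (I : ideal R) (u : R).

(** The lower-order part of an equation of integral dependence of degree [N]. The coefficients are
    indexed by all of [nat], which makes shifting them easy. *)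
Definition lower_terms N (w : R) : Prop := exists2 a : nat -> R,
  forall i, (i < N)%N -> a i \in ideal_exp I (N - i) & w = \sum_(i < N) a i * u ^+ i.

Lemma lower_terms0 N : lower_terms N 0.
Proof.
by exists (fun=> 0) => [i _|]; [apply: ideal0|rewrite big1 // => i _; rewrite mul0r].
Qed.

Lemma lower_termsD N x y : lower_terms N x -> lower_terms N y -> lower_terms N (x + y).
Proof.
move=> [a aI ->] [b bI ->]; exists (fun i => a i + b i) => [i iN|].
  by rewrite idealD ?aI ?bI.
by rewrite -big_split; apply: eq_bigr => i _; rewrite mulrDl.
Qed.

Lemma lower_terms_scale N k c x : c \in ideal_exp I k -> lower_terms N x ->
  lower_terms (k + N) (c * x).
Proof.
move=> cI [a aI ->]; exists (fun i => if (i < N)%N then c * a i else 0) => [i _|].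
  case: ifP => [iN|_]; last exact: ideal0.
  by rewrite -addnBA ?(ltnW iN) // ideal_expD ?aI.
rewrite addnC big_split_ord /= [X in _ + X]big1 ?addr0 => [|i _]; last first.
  by rewrite ltnNge leq_addr /= mul0r.
by rewrite mulr_sumr; apply: eq_bigr => i _; rewrite ltn_ord mulrA.
Qed.

Lemma lower_termsZ N c x : lower_terms N x -> lower_terms N (c * x).
Proof. exact: (@lower_terms_scale N 0 c). Qed.

Lemma lower_terms_shift N k x : lower_terms N x -> lower_terms (k + N) (u ^+ k * x).
Proof.
move=> [a aI ->]; exists (fun i => if (i < k)%N then 0 else a (i - k)%N) => [i iN|].
  case: ifP => [_|/negbT]; first exact: ideal0.
  rewrite -leqNgt => ki; have -> : (k + N - i = N - (i - k))%N by rewrite subnBA // addnC.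
  by apply: aI; rewrite ltn_subLR.
rewrite big_split_ord /= [X in X + _]big1 ?add0r => [|i _]; last first.
  by rewrite ltn_ord mul0r.
rewrite mulr_sumr; apply: eq_bigr => i _.
by rewrite ltnNge leq_addr /= addKn exprD mulrCA.
Qed.

Lemma lower_termsM N N' x y : lower_terms N x -> lower_terms N' y ->
  lower_terms (N + N') (x * y).
Proof.
move=> [a aI ->] yN'; rewrite mulr_suml.
elim/big_rec: _ => [|i z _ zN]; first exact: lower_terms0.
apply: lower_termsD zN; rewrite -mulrA.
have -> : (N + N' = (N - i) + (i + N'))%N by rewrite addnA subnK // ltnW.
by apply: lower_terms_scale; [apply: aI|apply: lower_terms_shift].
Qed.

Lemma lower_terms_gen j : j \in I -> lower_terms 1 j.
Proof.
move=> jI; exists (fun=> j) => [[|//] _|]; last by rewrite big_ord1 mulr1.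
by rewrite ideal_exp1.
Qed.

Lemma integral_closure_lower_terms N c d w : lower_terms N w -> c * d = 1 ->
  c * u ^+ N + w = 0 -> (0 < N)%N -> u \in integral_closure I.
Proof.
case: N => // N [a aI ->] cd rel _; apply/asboolP.
exists N, (fun i => d * a i); split=> [i|]; first by rewrite ideal_mull ?aI.
transitivity (d * (c * u ^+ N.+1 + \sum_(i < N.+1) a i * u ^+ i)); last by rewrite rel mulr0.
rewrite mulrDr mulrA [d * c]mulrC cd mul1r mulr_sumr.
by congr (_ + _); apply: eq_bigr => i _; rewrite mulrA.
Qed.

Variable m : ideal R.
Hypotheses (noethR : noetherian R) (mp : prime_ideal m)
  (m_unit : forall a, a \notin m -> exists b, a * b = 1).

Lemma not_integral_separated : u \notin integral_closure I ->
  exists P, minimal_over (zero_ideal R) P /\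
  exists (K : fieldType) (phi : {rmorphism R -> K}),
    [/\ forall x, (phi x == 0) = (x \in P), phi u != 0 & separated phi m (phi u) I].
Proof.
move=> uI; pose S x := exists N c w,
  [/\ c \notin m, lower_terms N w & x = c * u ^+ N + w].
have m1 : 1 \notin m by case: mp.
have [||x /zero_idealP-> [N [c [w [cm wN rel]]]]|Q [[Qp _] QS]] :=
  @prime_avoiding _ noethR S (zero_ideal R).
- by exists 0%N, 1, 0; rewrite mulr1 addr0; split=> //; apply: lower_terms0.
- move=> _ _ [N [c [w [cm wN ->]]]] [N' [c' [w' [cm' wN' ->]]]].
  exists (N + N')%N, (c * c'), (c * (u ^+ N * w') + (c' * (u ^+ N' * w) + w * w')).
  split; first exact: prime_idealMn.
    apply: lower_termsD; first exact/lower_termsZ/lower_terms_shift.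
    apply: lower_termsD; last exact: lower_termsM.
    by rewrite addnC; apply/lower_termsZ/lower_terms_shift.
  by rewrite exprD; ring.
(* In degree 0 the relation reads [c = 0], impossible for [c] outside [m]; in positive degree,
   division by the unit [c] gives an integral equation. *)
- case: N wN rel => [|N] wN rel.
    case/negP: cm; have [a _ w0] := wN; move: rel.
    by rewrite w0 big_ord0 addr0 mulr1 => <-; apply: ideal0.
  have [d cd] := m_unit cm; case/negP: uI.
  exact: integral_closure_lower_terms wN cd (esym rel) _.
have [P minP PQ] : exists2 P, minimal_over (zero_ideal R) P & {subset P <= Q}.
  by apply: (minimal_over_exists noethR); split=> // x /zero_ideal_sub.
have [[Pp _] _] := minP; have [K [phi phiP]] := residue_field Pp.
have u0 : phi u != 0.
  rewrite phiP; apply/negP => /PQ/QS; apply; exists 1%N, 1, 0.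
  by rewrite mul1r addr0; split=> //; apply: lower_terms0.
exists P; split=> //; exists K, phi; split=> // c cm cI.
(* Clearing denominators presents [phi c] as [phi w / phi u ^+ N] with [w] of lower order. Then
   [c * u ^+ N - w] is in [P], although it belongs to [S]. *)
have [N [w [wN E]]] : exists N w, lower_terms N w /\ phi u ^+ N * phi c = phi w.
  move: (phi c) cI => y; elim=> {y} [|j jI|x y _ [N1 [w1 [L1 E1]]] _ [N2 [w2 [L2 E2]]]
    |a x _ [N [w [L E]]]|x y _ [N1 [w1 [L1 E1]]] _ [N2 [w2 [L2 E2]]]].
  - by exists 0%N, 0; rewrite mulr0 rmorph0; split=> //; apply: lower_terms0.
  - exists 1%N, j; split; first exact: lower_terms_gen.
    by rewrite mulrC divfK.
  - exists (N1 + N2)%N, (u ^+ N2 * w1 + u ^+ N1 * w2); split.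
      by apply: lower_termsD; [rewrite addnC|]; apply: lower_terms_shift.
    by rewrite rmorphD !rmorphM !rmorphXn /= -E1 -E2 exprD; ring.
  - exists N, (a * w); split; first exact: lower_termsZ.
    by rewrite rmorphM -E mulrCA.
  - exists (N1 + N2)%N, (w1 * w2); split; first exact: lower_termsM.
    by rewrite rmorphM -E1 -E2 exprD mulrACA.
have /PQ/QS : c * u ^+ N - w \in P.
  by rewrite -phiP rmorphB rmorphM rmorphXn mulrC E subrr.
by apply; exists N, c, (- w); split=> //; rewrite -mulN1r; apply: lower_termsZ.
Qed.

End IntegralRelations.

(** * Comparison of the rank closure with the integral closure *)

Section RankClosure.
Variables (R : comNzRingType) (m : idealr R).
Variables (M : nat -> lmodType R) (r : nat -> rat).
Hypotheses (localR : local_ring m) (equidim : formally_equidimensional m).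
Hypotheses (M_fg : forall n, finitely_generated (submodule_full (M n)))
  (M_rank : forall n, has_rank (M n) (r n)) (r_neq0 : forall n, r n <> 0).

Let mI := ideal_of_idealr m.
Let noethR := local_noetherian localR.
Let m_prime := local_prime localR.

Lemma rank_lengths (P : ideal R) n : minimal_over (zero_ideal R) P ->
  exists (P' : prime_idealr R) a b, [/\ P' =i P,
    module_length (submodule_full (loc_module P' (M n))) = Some a,
    module_length (submodule_full (loc_ring P')^o) = Some b, (0 < b)%N
    & a%:R = r n * b%:R].
Proof.
move=> [[Pp _] minP]; pose P' := prime_idealr_of Pp.
have minP' : minimal_prime P'.
  move=> Q QP; apply: (minP (ideal_of_idealr Q)) => //.
  by split; [apply: prime_idealr_prime|apply: zero_ideal_sub].
have [a [b [aE bE ab]]] := M_rank n minP' (minimal_prime_dim localR equidim minP').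
exists P', a, b; split=> //; exact: loc_ring_length_gt0 bE.
Qed.

Lemma rank_gt0 n : 0 < r n.
Proof.
have [|P minP _] := minimal_over_exists noethR (K := zero_ideal R) (Q := mI).
  by split=> //; apply: zero_ideal_sub.
have [P' [a [b [_ _ _ b0 ab]]]] := rank_lengths n minP.
rewrite lt_neqAle eq_sym; apply/andP; split; first exact/eqP.
by rewrite -(@pmulr_lge0 _ b%:R) ?ltr0n // -ab ler0n.
Qed.

Theorem rank_closure_integral (I : ideal R) :
  {subset rank_closure m M r I <= integral_closure I}.
Proof.
move=> u /asboolP uI; apply: contrapT => /negP nuI.
have [P [minP [K [phi [phiP u0 sep]]]]] :=
  not_integral_separated noethR m_prime (local_unit localR) nuI.
have /finitely_generatedP[k [g Ig]] := noethR I.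
have sepg : separated phi mI (phi u) (ideal_span g).
  by apply: separated_sub sep => x; rewrite Ig.
have [t sept] := separated_pow noethR m_prime u0 sepg.
pose J : ideal R := submodule_sum I
  (ideal_mul (R := R) (ideal_exp m t) (submodule_full R^o)).
have sepJ : separated phi mI (phi u) J.
  apply: separated_sub sept; apply: submodule_sum_min => x; rewrite ?Ig => xI.
    exact: submodule_sum_l.
  apply: submodule_sum_r; move: x xI.
  by apply: ideal_mulP => a x aI _; apply: ideal_mulr.
have /asboolP[C [[_ null] _ uC]] := uI t.
(* Any constant between 0 and 1 would serve: the bounds that follow give [r n0 <= s <= l] with
   [r n0] positive. *)
have [n0 /(_ n0 (leqnn _))[l [len small]]] := null (1 / 2%:R) isT.
have [s [f [nu [g' [d [sl Mg d0 dg]]]]]] :=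
  image_length_bound (local_proper m) u0 sepJ (M_fg n0) uC len.
have [P' [a [b [P'P aE bE b0 ab]]]] := rank_lengths n0 minP.
have dP' : d \notin P' by rewrite P'P -phiP.
have sb : (a <= s * b)%N.
  have [chain _] := iffLR (nat_supP _ _) aE.
  apply: has_chain_spans chain => [x _|c]; last exact: module_length_le bE.
  exact: (loc_module_spans Mg dP' dg).
have rs : r n0 <= s%:R.
  by rewrite -(@ler_pM2r _ b%:R) ?ltr0n // -ab -natrM ler_nat.
have sl' : (s%:R : rat) <= l%:R by rewrite ler_nat.
have := rank_gt0 n0; lra.
Qed.

Lemma image_module_length_sum (A C C' : ideal R) n l l' :
  module_length (tensor_image M A C n) = Some l ->
  module_length (tensor_image M A C' n) = Some l' ->
  exists2 k, module_length (tensor_image M A (submodule_sum C C') n) = Some k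
    & (k <= l + l')%N.
Proof.
move=> lenC lenC'; apply: nat_sup_exists; first by exists 0%N; apply: has_chain0.
move=> k chain; apply: has_chain_sum chain (fun j => module_length_le lenC)
  (fun j => module_length_le lenC').
apply: tensor_image_min => x _ /asboolP[c [c' [cC c'C' ->]]].
rewrite raddfD pure_tensorDr; apply: mem_submodule_sum; exact: pure_tensor_image.
Qed.

Lemma asymptotically_null_sum (A C C' : ideal R) :
  asymptotically_null M r A C -> asymptotically_null M r A C' ->
  asymptotically_null M r A (submodule_sum C C').
Proof.
move=> [AC nullC] [AC' nullC']; split=> [x /AC|eps eps0].
  exact: submodule_sum_l.
have eps2 : 0 < eps / 2%:R by lra.
have [n1 n1P] := nullC _ eps2; have [n2 n2P] := nullC' _ eps2.
exists (maxn n1 n2) => n; rewrite geq_max => /andP[/n1P[l [lenC lle]] /n2P[l' [lenC' lle']]].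
have [k lenk kle] := image_module_length_sum lenC lenC'.
exists k; split=> //; have : (k%:R : rat) <= l%:R + l'%:R by rewrite -natrD ler_nat.
lra.
Qed.

Lemma asymptotically_null_refl (A : ideal R) : asymptotically_null M r A A.
Proof.
split=> // eps eps0; exists 0%N => n _; exists 0%N; split; last first.
  by rewrite mulr_ge0 // ltW // rank_gt0.
apply/nat_supP; split=> [|k]; first exact: has_chain0.
move=> /has_chain_zero -> // t tA; apply/(zero_submoduleP t).
move: t tA; apply: tensor_image_min => x c cA.
have -> : \pi_(quot_module A)%qT c = 0 by apply/quot_module_eq0P.
by rewrite pure_tensor0 rpred0.
Qed.

(** [fin_closure] asks for a largest null submodule to exist. Noetherianity gives a maximal one, and
    it is the largest because null submodules are stable under sums. *)
Lemma rank_closure_sub (I : ideal R) : {subset I <= rank_closure m M r I}.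
Proof.
move=> x xI; apply/asboolP => t; set A := submodule_sum _ _.
have [C [nullC maxC]] := noetherian_maximal noethR (asymptotically_null_refl A).
apply/asboolP; exists C; split=> // [C' nullC' y yC'|].
  apply: (maxC (submodule_sum C C')); first exact: asymptotically_null_sum.
    exact: submodule_sum_l.
  exact: submodule_sum_r.
by apply: nullC.1; apply: submodule_sum_l.
Qed.

Lemma integrally_closed_rank_closed (I : ideal R) :
  integrally_closed I -> rank_closed m M r I.
Proof.
move=> Icl x; apply/idP/idP => [/rank_closure_integral|/rank_closure_sub//].
by rewrite Icl.
Qed.

Lemma integral_closure_sub (I : ideal R) : {subset I <= integral_closure I}.
Proof.
move=> x xI; apply/asboolP; exists 0%N, (fun=> - x).
split=> [i|]; last by rewrite big_ord1 expr1 mulr1 subrr.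
by rewrite ord1 ideal_exp1 idealN.
Qed.

Lemma radical_integrally_closed (I : ideal R) : radical_ideal I -> integrally_closed I.
Proof.
move=> Irad x; apply/idP/idP => [/asboolP[n [a [aI rel]]]|/integral_closure_sub//].
apply: (Irad _ n.+1); move/eqP: rel; rewrite addr_eq0 => /eqP->.
apply/idealN/ideal_sum => i _; apply: ideal_mulr.
rewrite -[a i \in I]ideal_exp1; apply: ideal_exp_le (aI i).
by rewrite subn_gt0.
Qed.

Lemma prime_radical (I : ideal R) : prime_ideal I -> radical_ideal I.
Proof. by move=> Ip x n; apply: prime_idealX. Qed.

End RankClosure.

Theorem theorem7p16 (R : comNzRingType) (m : idealr R)
    (M : nat -> lmodType R) (r : nat -> rat)
    (R_local : local_ring m)
    (R_equidim : formally_equidimensional m)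
    (M_fg : forall n : nat, finitely_generated (submodule_full (M n)))
    (M_rank : forall n : nat, has_rank (M n) (r n))
    (r_neq0 : forall n : nat, r n <> 0) :
  [/\ forall I : ideal R, {subset rank_closure m M r I <= integral_closure I},
      forall I : ideal R, integrally_closed I -> rank_closed m M r I,
      forall I : ideal R, radical_ideal I -> rank_closed m M r I
    & forall I : ideal R, prime_ideal I -> rank_closed m M r I].
Proof.
have closed (I : ideal R) : integrally_closed I -> rank_closed m M r I.
  exact: integrally_closed_rank_closed.
split=> // I; first exact: rank_closure_integral.
  by move=> /radical_integrally_closed/closed.
by move=> /prime_radical/radical_integrally_closed/closed.
Qed.
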